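(* Let $c\ge 1$ be an integer and define \[\min\nolimits^2_f(c)=\begin{cases} 7 & \text{if } c\in\{1,2\},\\ 10 & \text{if } c\in\{3,4\},\\ 12 & \text{if } c\ge 5.\end{cases}\] (i) There exist $c$-connected maps $G$ having two doubly intersecting faces $f,f'$ with $d(f)+d(f')=\min^2_f(c)$ and $d(f'')=3$ for every face $f''\notin\{f,f'\}$, such that the dual $G^*$ is simple and has a $2$-cut. (ii) If $G$ is a $c$-connected map with a simple dual $G^*$ such that every two doubly intersecting faces $f,f'$ of $G$ satisfy $d(f)+d(f')<\min^2_f(c)$, then $G^*$ is $3$-connected.
   Context: A map is a simple connected graph together with a cellular embedding in a closed orientable surface (equivalently, given by a rotation system); its faces are the closed facial walks, and $d(f)$ denotes the size (length of the facial walk) of a face $f$. The dual $G^*$ of a map $G$ has the faces of $G$ as vertices, with one edge $e^*$ for each edge $e$ of $G$ joining the (one or two) faces on the two sides of $e$; it is embedded in the same surface. ''Simple dual'' means $G^*$ has no loops and no multiple edges. A $k$-cut of a connected graph is a set of $k$ vertices whose removal disconnects the graph. Two faces are called doubly intersecting if in the facial walk of one of them one or more vertices of the other occur at at least two places (in particular, two faces sharing two or more distinct vertices are doubly intersecting). *)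

(* Defs.v *)
From mathcomp Require Import all_boot all_fingroup.

Set Implicit Arguments.
Unset Strict Implicit.
Unset Printing Implicit Defensive.

Local Open Scope group_scope.

(* A rotation system on a finite multigraph without isolated vertices; when the
   multigraph is connected, it encodes a cellular embedding in a closed
   orientable surface. Darts are oriented edges: [edge] reverses a dart and
   [rotation d] is the dart following [d] in the cyclic order around the start
   vertex of [d]. The one-vertex graph without edges is not represented; it is
   not c-connected for any c >= 1. *)
Record embedding := Embedding {
  dart : finType;
  edge : {perm dart};
  rotation : {perm dart};
  edgeK : involutive edge;
  edge_neq : forall d, edge d != d
}.

(* Since (s * t) d = t (s d), a facial walk goes from [d] to [rotation (edge d)]. *)
Definition face_perm (G : embedding) : {perm dart G} := edge G * rotation G.

(* The dart [d] of the dual crosses the dart [d] of [G]: it goes from the face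
   traversing [d] to the face traversing [edge d]. *)
Definition dual_map (G : embedding) : embedding :=
  @Embedding (dart G) (edge G) (face_perm G) (@edgeK G) (@edge_neq G).

(* Vertices and faces are sets of darts: those leaving the vertex, respectively
   those traversed by the facial walk, so the size of a face [f] is [#|f|]. *)
Definition vertices (G : embedding) : {set {set dart G}} := porbits (rotation G).
Definition faces (G : embedding) : {set {set dart G}} := porbits (face_perm G).

Definition start (G : embedding) (d : dart G) : {set dart G} := porbit (rotation G) d.
Definition target (G : embedding) (d : dart G) : {set dart G} :=
  start (edge G d).

Definition adjacent (G : embedding) : rel {set dart G} :=
  fun u v => [exists d, (start d == u) && (target d == v)].

Definition simple_graph (G : embedding) : Prop :=
  (forall d : dart G, start d <> target d) /\
  (forall d d' : dart G,
     start d = start d' -> target d = target d' -> d = d').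

Definition adjacent_off (G : embedding) (S : {set {set dart G}}) :
    rel {set dart G} :=
  fun u v => [&& u \notin S, v \notin S & adjacent u v].

Definition disconnects (G : embedding) (S : {set {set dart G}}) : Prop :=
  exists u v, [/\ u \in vertices G :\: S, v \in vertices G :\: S
                & ~~ connect (adjacent_off S) u v].

Definition connected_graph (G : embedding) : Prop :=
  forall u v, u \in vertices G -> v \in vertices G ->
    connect (@adjacent G) u v.

Definition is_cut (G : embedding) (k : nat) (S : {set {set dart G}}) : Prop :=
  [/\ S \subset vertices G, #|S| = k & disconnects S].

Definition k_connected (k : nat) (G : embedding) : Prop :=
  k < #|vertices G| /\
  (forall (j : nat) (S : {set {set dart G}}), j < k -> ~ is_cut j S).

Definition is_map (G : embedding) : Prop :=
  simple_graph G /\ connected_graph G.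

Definition face_vertices (G : embedding) (f : {set dart G}) :
    {set {set dart G}} :=
  [set start d | d in f].

(* The darts of [f] are the places of its facial walk, so this counts the
   places of [f] occupied by vertices of [f'], with repetitions. *)
Definition occurrences (G : embedding) (f f' : {set dart G}) : nat :=
  #|[set d in f | start d \in face_vertices f']|.

Definition doubly_intersecting (G : embedding) (f f' : {set dart G}) : Prop :=
  [/\ f \in faces G, f' \in faces G, f <> f'
    & 2 <= occurrences f f' \/ 2 <= occurrences f' f].

Definition min2f (c : nat) : nat :=
  if c <= 2 then 7 else if c <= 4 then 10 else 12.

(* Main.v *)
Require Import Defs.
From mathcomp Require Import all_boot all_fingroup all_algebra.
From mathcomp Require Import zify ring.

Set Implicit Arguments.
Unset Strict Implicit.
Unset Printing Implicit Defensive.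

(* A separation of the dual into sides [A] and [B] by at most two faces is studied
   through the two rims: the darts of the separating faces whose reversal lies on
   [A], respectively on [B]. Each rim enters and leaves every vertex equally often
   and the rims share no edge of the simple graph, so each of them has at least
   three darts, and counting the edges among the mixed vertices, those on both
   rims, bounds their total length from below in terms of the number [k] of mixed
   vertices. If [A] and [B] both have a vertex of their own, the mixed vertices,
   together with at most one more vertex, form a cut of the graph, so [k] is large;
   the few remaining configurations violate Euler's formula modulo 2. If one side
   has no vertex of its own, the total length is at least 12. If the separating
   faces are not doubly intersecting, or if there is only one of them, the count
   applies to each of them separately.
   Conversely, for [c >= 5] one takes the triangulation of the complete tripartite
   graph by the cyclic Latin square and turns over the quadrilateral formed by two
   adjacent triangles; smaller [c] are covered by two explicit maps. *)

(** The genus is arbitrary, so no Jordan-type argument is available; the only topological input is a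
    comparison of signs of permutations. The constants arise as follows. With $k$ mixed vertices and
    rims of $a$ and $b$ darts, counting gives $9k \le 2(a+b)+k^2$ and $a,b \ge \max(3,k)$. If the
    mixed vertices form a cut, then $k \ge c$, and the total can fall short of the claimed value
    only as 6 with $k=1$, as 9 with $k=3$, or as 10 or 11 with $k=5$, each time without an edge
    common to the two faces. Parity then demands an even $k$, which raises the bounds to 7, 10 and
    12. If such a common edge links the two sides, only $k=2$ is left, and now parity demands an odd
    $k$. The sign argument needs each rim to be a single cycle; this is automatic up to five darts,
    so rims of six darts get their own lemmas. Separating faces that are not doubly intersecting are
    still bounded by the hypothesis: where such a face passes from one rim to the other, it doubly
    intersects a neighbouring face of [A]. *)

Lemma porbit_closed (T : finType) (s : {perm T}) (P : T -> Prop) (x y : T) :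
  (forall z, P z -> P (s z)) -> P x -> y \in porbit s x -> P y.
Proof.
move=> Ps Px /porbitP[i ->]; elim: i => [|i IHi]; first by rewrite perm1.
by rewrite expgSr permM; apply: Ps.
Qed.

(** Both images are projections of the image of the pair map [h], and the common kernel makes the
    two projections injective. *)
Lemma card_imset_ker (T L M : finType) (f : T -> L) (g : T -> M) :
  (forall x y, f x = f y <-> g x = g y) -> #|f @: setT| = #|g @: setT|.
Proof.
move=> fg; pose h x := (f x, g x).
have fstE : f @: setT = fst @: (h @: setT) by rewrite -imset_comp.
have sndE : g @: setT = snd @: (h @: setT) by rewrite -imset_comp.
have injf : {in h @: setT &, injective fst}.
  move=> _ _ /imsetP[x _ ->] /imsetP[y _ ->] /= e; congr pair => //; exact/fg.
have injg : {in h @: setT &, injective snd}.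
  move=> _ _ /imsetP[x _ ->] /imsetP[y _ ->] /= e; congr pair => //; exact/fg.
by rewrite fstE sndE (card_in_imset injf) (card_in_imset injg).
Qed.

Lemma card_porbits_label (T L : finType) (s : {perm T}) (l : T -> L) :
  (forall x, l (s x) = l x) -> (forall x y, l x = l y -> y \in porbit s x) ->
  #|porbits s| = #|l @: setT|.
Proof.
move=> ls lt; transitivity #|porbit s @: setT|; last first.
  apply: card_imset_ker => x y; split=> [/eqP|/lt]; last first.
    by rewrite porbit_sym -eq_porbit_mem => /eqP.
  rewrite eq_porbit_mem porbit_sym => xy; symmetry.
  by apply: (porbit_closed (P := fun z => l z = l x)) xy => // z <-.
by congr #|pred_of_set _|; apply/setP=> C; apply/imsetP/imsetP=> -[x _ ->]; exists x.
Qed.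

(** * Balanced sets of darts *)

Definition face (G : embedding) (d : dart G) : {set dart G} := porbit (face_perm G) d.

Lemma simple_loopless (G : embedding) : simple_graph G ->
  forall d : dart G, start d <> target d.
Proof. by case. Qed.

Lemma simple_parallel (G : embedding) : simple_graph G -> forall d d' : dart G,
  start d = start d' -> target d = target d' -> d = d'.
Proof. by case=> _ h d d'; apply: h. Qed.

Lemma dual_simple_loopless (G : embedding) : simple_graph (dual_map G) ->
  forall d : dart G, face d <> face (edge G d).
Proof. by case. Qed.

Lemma dual_simple_parallel (G : embedding) : simple_graph (dual_map G) ->
  forall d d' : dart G,
  face d = face d' -> face (edge G d) = face (edge G d') -> d = d'.
Proof. by case=> _ h d d'; apply: h. Qed.

Section Darts.
Variable G : embedding.
Local Notation D := (dart G).
Local Notation e := (edge G).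
Local Notation r := (rotation G).
Local Notation phi := (face_perm G).
Implicit Types (d g x y z : D) (A B C E F S : {set D}) (v : {set D}).
Implicit Types (W X Y : {set {set D}}).

Lemma face_permE d : phi d = r (e d).
Proof. by rewrite permM. Qed.

Lemma rotationE d : r d = phi (e d).
Proof. by rewrite face_permE edgeK. Qed.

Lemma start_rotation d : start (r d) = start d.
Proof. by have := porbit_perm r 1 d; rewrite expg1. Qed.

Lemma start_face_perm d : start (phi d) = target d.
Proof. by rewrite face_permE start_rotation. Qed.

Lemma target_edge d : target (e d) = start d.
Proof. by rewrite /target edgeK. Qed.

Lemma face_face_perm d : face (phi d) = face d.
Proof. by have := porbit_perm phi 1 d; rewrite expg1. Qed.

(** A sweep around one vertex. The induction step may use that the current dart still leaves this
    vertex. *)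
Lemma start_ind (P : D -> Prop) x y :
  (forall z, start z = start x -> P z -> P (r z)) -> P x -> start y = start x ->
  P y.
Proof.
move=> Pr Px /eqP; rewrite eq_porbit_mem => xy.
suff [] : P y /\ start y = start x by [].
apply: (porbit_closed (P := fun z => P z /\ start z = start x)) xy => //.
by move=> z [Pz zx]; rewrite start_rotation zx; split=> //; apply: Pr.
Qed.

Lemma face_ind (P : D -> Prop) x y :
  (forall z, face z = face x -> P z -> P (phi z)) -> P x -> face y = face x ->
  P y.
Proof.
move=> Pr Px /eqP; rewrite eq_porbit_mem => xy.
suff [] : P y /\ face y = face x by [].
apply: (porbit_closed (P := fun z => P z /\ face z = face x)) xy => //.
by move=> z [Pz zx]; rewrite face_face_perm zx; split=> //; apply: Pr.
Qed.

Hypothesis G_simple : simple_graph G.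

Let loopless := simple_loopless G_simple.
Let simple := simple_parallel G_simple.

Definition outs E v := [set d in E | start d == v].
Definition ins E v := [set d in E | target d == v].
Definition balanced E := forall v, #|outs E v| = #|ins E v|.
Definition oriented E := forall d, d \in E -> e d \notin E.
Definition starts E : {set {set D}} := [set start d | d in E].
Definition inner E X := [set d in E | (start d \in X) && (target d \in X)].

Lemma mem_starts d E : d \in E -> start d \in starts E.
Proof. exact: imset_f. Qed.

Lemma card_starts E : #|starts E| <= #|E|.
Proof. exact: leq_imset_card. Qed.

Lemma card_eq0_mem (T : finType) (P Q : {set T}) (x : T) :
  #|P| = #|Q| -> x \in P -> exists y : T, y \in Q.
Proof.
move=> PQ Px; have : 0 < #|Q| by rewrite -PQ card_gt0; apply/set0Pn; exists x.
by rewrite card_gt0 => /set0Pn.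
Qed.

Lemma balanced_next E d :
  balanced E -> d \in E -> exists2 d', d' \in E & start d' = target d.
Proof.
move=> bE Ed; have [||d'] := @card_eq0_mem _ (ins E (target d)) (outs E (target d)) d.
- by rewrite bE.
- by rewrite inE Ed eqxx.
- by rewrite inE => /andP[E' /eqP]; exists d'.
Qed.

Lemma balanced_prev E d :
  balanced E -> d \in E -> exists2 d', d' \in E & target d' = start d.
Proof.
move=> bE Ed; have [||d'] := @card_eq0_mem _ (outs E (start d)) (ins E (start d)) d.
- by rewrite bE.
- by rewrite inE Ed eqxx.
- by rewrite inE => /andP[E' /eqP]; exists d'.
Qed.

Lemma target_starts E d : balanced E -> d \in E -> target d \in starts E.
Proof. by move=> bE /(balanced_next bE)[d' E' <-]; apply: mem_starts. Qed.

(** Two consecutive darts already give three vertices: were the second to return to the start of the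
    first, simplicity would make it the reversed first dart, which orientation excludes. *)
Lemma starts_ge3 E :
  balanced E -> oriented E -> E != set0 -> 3 <= #|starts E|.
Proof.
move=> bE oE /set0Pn[d Ed]; have [d1 E1 s1] := balanced_next bE Ed.
apply/card_geqP; exists [:: start d; target d; target d1]; split=> //=; last first.
  by move=> v; rewrite !inE => /or3P[] /eqP->; rewrite ?target_starts ?mem_starts.
rewrite !inE !negb_or andbT; apply/andP; split; first (apply/andP; split).
- exact/eqP/loopless.
- apply/eqP=> dd1; have : d1 = e d by apply: simple; rewrite ?target_edge.
  by move=> d1e; have := oE _ Ed; rewrite -d1e E1.
- by rewrite -s1; apply/eqP/loopless.
Qed.

(** Every vertex of [X] is left by a dart of [E] and, by balance, entered by one; the darts counted
    on both occasions are those of [inner E X]. *)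
Lemma inner_bound E X :
  balanced E -> X \subset starts E -> #|X| + #|X| <= #|E| + #|inner E X|.
Proof.
move=> bE XE; pose P := [set d in E | start d \in X].
pose Q := [set d in E | target d \in X].
have leP : #|X| <= #|P|.
  apply: leq_trans (leq_imset_card (@start G) _); apply/subset_leq_card/subsetP=> v Xv.
  have /imsetP[d Ed vd] := subsetP XE _ Xv.
  by apply/imsetP; exists d; rewrite // inE Ed -vd.
have leQ : #|X| <= #|Q|.
  apply: leq_trans (leq_imset_card (@target G) _); apply/subset_leq_card/subsetP=> v Xv.
  have /imsetP[d Ed vd] := subsetP XE _ Xv.
  have [d' E' td'] := balanced_prev bE Ed.
  by apply/imsetP; exists d'; rewrite ?inE ?E' ?td' -?vd.
have <- : P :&: Q = inner E X.
  by apply/setP=> d; rewrite !inE; case: (d \in E).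
apply: leq_trans (leq_add leP leQ) _; rewrite -cardsUI leq_add2r.
by apply/subset_leq_card/subsetP=> d; rewrite !inE => /orP[] /andP[].
Qed.

(** The case of equality in [inner_bound]: the darts leaving [X] and those entering it must cover
    [E], and no vertex of [X] can contribute more than one of either sort. *)
Lemma inner_tight E X :
  balanced E -> X \subset starts E -> #|E| + #|inner E X| <= #|X| + #|X| ->
  (forall d, d \in E -> (start d \in X) || (target d \in X)) /\
  {in [set d in E | start d \in X] &, injective (@start G)}.
Proof.
move=> bE XE tight; pose P := [set d in E | start d \in X].
pose Q := [set d in E | target d \in X].
have PX : (@start G) @: P = X.
  apply/eqP; rewrite eqEsubset; apply/andP; split; apply/subsetP=> v.
    by case/imsetP=> d; rewrite inE => /andP[_ Xd] ->.
  move=> Xv; have /imsetP[d Ed vd] := subsetP XE _ Xv.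
  by apply/imsetP; exists d; rewrite // inE Ed -vd.
have leP : #|X| <= #|P| by rewrite -{1}PX leq_imset_card.
have leQ : #|X| <= #|Q|.
  apply: leq_trans (leq_imset_card (@target G) _); apply/subset_leq_card/subsetP=> v Xv.
  have /imsetP[d Ed vd] := subsetP XE _ Xv.
  have [d' E' td'] := balanced_prev bE Ed.
  by apply/imsetP; exists d'; rewrite ?inE ?E' ?td' -?vd.
have PQ : P :&: Q = inner E X.
  by apply/setP=> d; rewrite !inE; case: (d \in E).
have sPQ : P :|: Q \subset E.
  by apply/subsetP=> d; rewrite !inE => /orP[] /andP[].
have := subset_leq_card sPQ; have := cardsUI P Q; rewrite PQ => cPQ lePQ.
split.
  have /setP EPQ : P :|: Q = E.
    apply/eqP; rewrite eqEcard sPQ -(leq_add2r #|inner E X|) cPQ.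
    exact: leq_trans tight (leq_add leP leQ).
  by move=> d; rewrite -EPQ !inE -andb_orr => /andP[].
apply/imset_injP; rewrite -/P PX eqn_leq leP -(leq_add2r #|Q|) -cPQ /=.
apply: leq_trans (leq_add (leqnn _) leQ); apply: leq_trans tight.
by rewrite leq_add2r.
Qed.

(** In a simple graph a dart is determined by the ordered pair of its ends, and pairs on the
    diagonal do not occur. *)
Lemma inside_bound F X :
  (forall d, d \in F -> (start d \in X) && (target d \in X)) ->
  #|F| + #|X| <= #|X| * #|X|.
Proof.
move=> FX; pose p d := (start d, target d); pose diag v := (v, v) : {set D} * {set D}.
have injp : injective p by move=> d d' [sd td]; apply: simple.
have injdiag : injective diag by move=> v v' [].
rewrite -[in X in X <= _](card_imset _ injp) -[in X in X <= _](card_imset _ injdiag).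
have dis : [disjoint diag @: X & p @: F].
  apply/pred0P=> w /=; apply/andP=> -[/imsetP[v _ ->] /imsetP[d _ [vs vt]]].
  by apply: (@loopless d); rewrite -vs -vt.
rewrite addnC -cardsUI; move: dis; rewrite -setI_eq0 => /eqP->.
rewrite cards0 addn0 -cardsX.
apply/subset_leq_card/subsetP=> w; rewrite !inE => /orP[] /imsetP[].
  by move=> v Xv -> /=; rewrite Xv.
by move=> d /FX + ->.
Qed.

Definition reversed E := [set d | e d \in E].

Lemma card_rev E : #|reversed E| = #|E|.
Proof.
rewrite -[RHS](card_imset _ (@perm_inj _ e)); apply: eq_card => d; rewrite inE.
by apply/idP/imsetP=> [Ed|[x Ex ->]]; [exists (e d); rewrite ?edgeK | rewrite edgeK].
Qed.

Lemma card_sym E : oriented E -> #|E :|: reversed E| = #|E| + #|E|.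
Proof.
move=> oE; rewrite -{2}(card_rev E) -cardsUI.
suff -> : E :&: reversed E = set0 by rewrite cards0 addn0.
apply/setP=> d; rewrite !inE; apply/andP=> -[/oE].
by move/negP.
Qed.

Lemma cardsU_disj (T : finType) (P Q : {set T}) :
  (forall x : T, x \in P -> x \in Q -> False) -> #|P :|: Q| = #|P| + #|Q|.
Proof.
move=> PQ; rewrite -cardsUI; suff -> : P :&: Q = set0 by rewrite cards0 addn0.
by apply/setP=> x; rewrite !inE; apply/andP=> -[/PQ].
Qed.

Lemma orientedS E F : E \subset F -> oriented F -> oriented E.
Proof.
move=> /subsetP EF oF d /EF /oF; apply: contra; exact: EF.
Qed.

Lemma inner_sub E X : inner E X \subset E.
Proof. by apply/subsetP=> d; rewrite inE => /andP[]. Qed.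

(** The inner darts of [E] and [F] and their reversals form four disjoint sets, all subject to
    [inside_bound]. *)
Lemma pair_inner_bound E F X :
  oriented E -> oriented F ->
  (forall d, d \in E -> d \notin F /\ e d \notin F) ->
  (#|inner E X| + #|inner F X|).*2 + #|X| <= #|X| * #|X|.
Proof.
move=> oE oF EF; rewrite -addnn addnACA.
rewrite -(card_sym (orientedS (inner_sub E X) oE)).
rewrite -(card_sym (orientedS (inner_sub F X) oF)) -cardsU_disj.
  apply: inside_bound => d; rewrite !inE /target edgeK.
  by case/orP => /orP[] /and3P[_ -> ->].
move=> d; rewrite !inE /target edgeK.
by case/orP=> /andP[/EF + _]; rewrite ?edgeK => -[/negPf-> /negPf->].
Qed.

(** Doubling the sum of the two instances of [inner_bound] gives $8|X| \le 2(|E|+|F|)$ plus twice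
    the number of inner darts, and the latter is at most $|X|^2-|X|$. *)
Lemma crossing_bound E F X :
  balanced E -> balanced F -> oriented E -> oriented F ->
  (forall d, d \in E -> d \notin F /\ e d \notin F) ->
  X \subset starts E -> X \subset starts F ->
  9 * #|X| <= 2 * (#|E| + #|F|) + #|X| * #|X|.
Proof.
move=> bE bF oE oF EF XE XF.
have := inner_bound bE XE; have := inner_bound bF XF.
have := pair_inner_bound X oE oF EF; lia.
Qed.

(** A directed cycle described without a walk: minimality among nonempty balanced sets replaces
    connectedness. *)
Definition simple_cycle E :=
  {in E &, injective (@start G)} /\
  (forall C, C \subset E -> C != set0 -> balanced C -> C = E).

Lemma balancedD E C : C \subset E -> balanced E -> balanced C -> balanced (E :\: C).
Proof.
move=> CE bE bC v; have := bE v; have := bC v.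
have outsD : #|outs E v| = #|outs C v| + #|outs (E :\: C) v|.
  rewrite -cardsU_disj; last by move=> d; rewrite !inE => /andP[->].
  congr #|pred_of_set _|; apply/setP=> d; rewrite !inE.
  by case Cd: (d \in C); rewrite //= ?orbF ?(subsetP CE _ Cd).
have insD : #|ins E v| = #|ins C v| + #|ins (E :\: C) v|.
  rewrite -cardsU_disj; last by move=> d; rewrite !inE => /andP[->].
  congr #|pred_of_set _|; apply/setP=> d; rewrite !inE.
  by case Cd: (d \in C); rewrite //= ?orbF ?(subsetP CE _ Cd).
lia.
Qed.

Lemma balanced_ge3 E : balanced E -> oriented E -> E != set0 -> 3 <= #|E|.
Proof.
by move=> bE oE E0; apply: leq_trans (starts_ge3 bE oE E0) (card_starts E).
Qed.

(** The remainder [E :\: C] is balanced too, so both pieces have at least three darts. *)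
Lemma balanced_split E C : balanced E -> oriented E ->
  C \subset E -> C != set0 -> balanced C -> C <> E -> 3 <= #|C| <= #|E| - 3.
Proof.
move=> bE oE CE C0 bC CnE.
have := balanced_ge3 bC (orientedS CE oE) C0.
have : E :\: C != set0.
  by apply: contra_notN CnE; rewrite setD_eq0 => EC; apply/eqP; rewrite eqEsubset CE.
move/(balanced_ge3 (balancedD CE bE bC) (orientedS (subsetDl E C) oE)).
rewrite cardsDS //; have := subset_leq_card CE; lia.
Qed.

Lemma four_neighbours E v x y :
  balanced E -> oriented E -> x \in E -> y \in E -> x <> y ->
  start x = v -> start y = v ->
  exists s : seq {set D}, [/\ uniq s, size s = 4, v \notin s &
    forall w, w \in s -> exists2 d, d \in E &
      start d = v /\ target d = w \/ start d = w /\ target d = v].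
Proof.
move=> bE oE Ex Ey xy sx sy.
have : 2 <= #|ins E v|.
  rewrite -bE; apply/card_geqP; exists [:: x; y]; split=> //=.
    by rewrite inE andbT; apply/eqP.
  by move=> z; rewrite !inE => /orP[] /eqP->; rewrite ?Ex ?Ey ?sx ?sy /=.
case/card_geqP=> -[|z [|t [|? ?]]] [uzt size2 zts] //.
move: uzt; rewrite /= inE andbT => zt.
have := zts z; have := zts t; rewrite !inE !eqxx orbT => /(_ isT)/andP[Et /eqP tt].
move=> /(_ isT)/andP[Ez /eqP tz].
have nst a b : a \in E -> b \in E -> start a = v -> target b = v -> target a <> start b.
  move=> Ea Eb sa tb ab; have : b = e a by apply: simple; rewrite ?target_edge ?sa.
  by move=> be; have := oE _ Ea; rewrite -be Eb.
exists [:: target x; target y; start z; start t]; split=> //=.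
- rewrite !inE !negb_or !andbT; apply/and3P; split; first (apply/and3P; split).
  + by apply/eqP=> txy; apply: xy; apply: simple; rewrite ?sx.
  + by apply/eqP/nst.
  + by apply/eqP/nst.
  + by apply/andP; split; apply/eqP/nst.
  + by apply: contra_neq zt => szt; apply: simple; rewrite ?tz.
- rewrite !inE !negb_or; apply/and4P; split; apply/eqP.
  + by rewrite -sx; apply: loopless.
  + by rewrite -sy; apply: loopless.
  + by rewrite -tz => /esym; apply: loopless.
  + by rewrite -tt => /esym; apply: loopless.
- move=> w; rewrite !inE => /or4P[] /eqP->;
    [exists x|exists y|exists z|exists t] => //; by [left|right].
Qed.

(** A vertex left twice comes with four neighbours, and five vertices are too many for the at most
    four darts other than [x]. A proper balanced subset would require 3 + 3 darts. *)
Lemma simple_cycle_small E :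
  balanced E -> oriented E -> #|E| <= 5 -> simple_cycle E.
Proof.
move=> bE oE E5; split.
  move=> x y Ex Ey sxy; apply/eqP/negPn/negP=> /eqP xy.
  have [s [us ss vs sE]] := four_neighbours bE oE Ex Ey xy sxy (erefl _).
  have : 5 <= #|starts (E :\ x)|.
    apply/card_geqP; exists (start y :: s); split; rewrite /= ?ss ?vs //.
    (* Dropping [x] loses no starting vertex, since [y] leaves the same vertex. *)
    move=> w; have suppE d : d \in E -> start d \in starts (E :\ x).
      move=> Ed; have [->|dx] := eqVneq d x; last by rewrite mem_starts // !inE dx.
      by rewrite sxy mem_starts // !inE Ey andbT; apply/eqP/nesym.
    rewrite inE => /orP[/eqP->|/sE[d Ed]]; first exact: suppE.
    case=> -[sd td]; last by rewrite -sd suppE.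
    by have [d' /suppE + sd'] := balanced_next bE Ed; rewrite -td sd'.
  have := card_starts (E :\ x); have := cardsD1 x E; rewrite Ex; lia.
move=> C CE C0 bC; apply/eqP/negPn/negP=> /eqP CnE.
by have := balanced_split bE oE CE C0 bC CnE; lia.
Qed.

End Darts.

(** * Separations of the dual *)

(** A dart stands both for a step of its face and for the corner of that face at its start. Hence
    the unions of faces [A] and [B] also mark the corners around every vertex of [G]. *)
Record separation (G : embedding) (A B : {set dart G}) : Prop := Separation {
  sep_left : forall d, (face_perm G d \in A) = (d \in A);
  sep_right : forall d, (face_perm G d \in B) = (d \in B);
  sep_disjoint : forall d, d \in A -> d \notin B;
  sep_edge : forall d, d \in A -> edge G d \notin B
}.

Lemma separation_sym (G : embedding) (A B : {set dart G}) :
  separation A B -> separation B A.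
Proof.
case=> sA sB dAB eAB; split=> // d Bd; first by apply: contraL Bd => /dAB.
by apply: contraL Bd => /eAB; rewrite edgeK.
Qed.

Definition separator (G : embedding) (A B : {set dart G}) := ~: (A :|: B).

Lemma separatorC (G : embedding) (A B : {set dart G}) :
  separator A B = separator B A.
Proof. by rewrite /separator setUC. Qed.

Definition rim (G : embedding) (S A : {set dart G}) := [set d in S | edge G d \in A].

Section Separations.
Variable G : embedding.
Local Notation D := (dart G).
Local Notation e := (edge G).
Local Notation r := (rotation G).
Local Notation phi := (face_perm G).
Implicit Types (d g x y z : D) (A B C E F S : {set D}) (v : {set D}).
Implicit Types (W X Y : {set {set D}}).

Lemma rotation_sep A B d : separation A B -> (r d \in A) = (e d \in A).
Proof. by move=> sAB; rewrite rotationE (sep_left sAB). Qed.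

Lemma in_separator A B d : (d \in separator A B) = (d \notin A) && (d \notin B).
Proof. by rewrite !inE negb_or. Qed.

Lemma separator_phi A B d : separation A B ->
  (phi d \in separator A B) = (d \in separator A B).
Proof. by move=> sAB; rewrite !in_separator (sep_left sAB) (sep_right sAB). Qed.

Lemma edge_sep A B d : separation A B -> d \in A -> e d \notin A ->
  e d \in separator A B.
Proof. by move=> sAB Ad Aed; rewrite in_separator Aed (sep_edge sAB). Qed.

Lemma rim_edge A B d : separation A B -> d \in A -> e d \notin A ->
  e d \in rim (separator A B) A.
Proof. by move=> sAB Ad Aed; rewrite inE (edge_sep sAB) // edgeK. Qed.

(** Turning from the corner [y] to the corner [x], one passes into [A] at some point; the dart
    crossed there belongs to the rim and leaves this vertex. *)
Lemma starts_rim A B x y : separation A B -> x \in A -> y \notin A ->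
  start x = start y -> start x \in starts (rim (separator A B) A).
Proof.
move=> sAB Ax Ay xy; apply: contraLR Ax => noE.
apply: (start_ind (P := fun z => z \notin A) _ Ay) => // z zy Az.
rewrite (rotation_sep _ sAB); apply: contra noE => Aez.
rewrite xy -zy -[z]edgeK; apply: mem_starts.
by apply: rim_edge; rewrite ?edgeK.
Qed.

Lemma rim_start A B d : separation A B -> d \in rim (separator A B) A ->
  r d \in A.
Proof. by move=> sAB; rewrite inE (rotation_sep _ sAB) => /andP[]. Qed.

Lemma starts_rim_left A B : separation A B ->
  starts (rim (separator A B) A) \subset starts A.
Proof.
move=> sAB; apply/subsetP=> _ /imsetP[d Ed ->].
by rewrite -start_rotation mem_starts // (rim_start sAB Ed).
Qed.

(** By [starts_rim] a vertex with corners on both sides starts a dart of each rim, so mixed vertices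
    can be counted along the rims. *)
Lemma mixedE A B : separation A B ->
  starts (rim (separator A B) A) :&: starts (rim (separator A B) B) =
  starts A :&: starts B.
Proof.
move=> sAB; have sBA := separation_sym sAB; apply/setP=> v; rewrite !inE.
apply/andP/andP=> -[vA vB]; split.
- exact: (subsetP (starts_rim_left sAB)) vA.
- by apply: (subsetP (starts_rim_left sBA)); rewrite separatorC.
- case/imsetP: vA vB => x Ax -> /imsetP[y By xy].
  by apply: (starts_rim sAB Ax _ xy); apply: sep_disjoint By.
- case/imsetP: vB vA => x Bx -> /imsetP[y Ay xy]; rewrite separatorC.
  by apply: (starts_rim sBA Bx _ xy); apply: sep_disjoint Ay.
Qed.

Lemma rim_oriented A B : oriented (rim (separator A B) A).
Proof. by move=> d; rewrite !inE negb_or => /andP[_ ->]. Qed.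

Lemma rim_rim A B d : separation A B -> d \in rim (separator A B) A ->
  d \notin rim (separator A B) B /\ e d \notin rim (separator A B) B.
Proof.
move=> sAB; rewrite !inE => /andP[_ Aed].
by rewrite Aed (negPf (sep_disjoint sAB Aed)) !andbF.
Qed.

(** In the cyclic order around a vertex, the corners enter [A] as often as they leave it. Each entry
    is a rim dart starting there, each exit a rim dart ending there. *)
Lemma rim_balanced A B : separation A B -> balanced (rim (separator A B) A).
Proof.
move=> sAB v; pose V d := start d == v.
have inE' : #|ins (rim (separator A B) A) v| = #|[set d | V d && (d \in A) && (r d \notin A)]|.
  rewrite -(card_rev _); apply: eq_card => d; rewrite !inE /target edgeK -/(V d).
  rewrite (rotation_sep _ sAB) [RHS]andbC andbA; case: (V d) => //=; rewrite ?andbF //= !andbT.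
  case Ad: (d \in A); rewrite ?andbF ?andbT //= negb_or.
  by rewrite (sep_edge sAB Ad) andbT.
have outE' : #|outs (rim (separator A B) A) v| = #|[set d | V d && (d \notin A) && (r d \in A)]|.
  apply: eq_card => d; rewrite !inE -/(V d) (rotation_sep _ sAB).
  case: (V d) => //=; rewrite ?andbF //= !andbT.
  case Ad: (d \in A) => //=; case Aed: (e d \in A); rewrite ?andbF // !andbT.
  by apply/negP=> Bd; have := sep_edge (separation_sym sAB) Bd; rewrite Aed.
rewrite inE' outE'.
have hr : #|[set d | V d && (r d \in A)]| = #|[set d | V d && (d \in A)]|.
  rewrite -[LHS](card_imset _ (@perm_inj _ r)); apply: eq_card => d.
  apply/imsetP/idP=> [[x + ->]|]; first by rewrite !inE /V start_rotation.
  rewrite !inE => /andP[dv Ad]; exists ((r^-1)%g d); last by rewrite permKV.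
  by rewrite inE permKV Ad /V -start_rotation permKV [_ == _]dv.
have split1 : #|[set d | V d && (r d \in A)]| =
    #|[set d | V d && (d \in A) && (r d \in A)]| + #|[set d | V d && (d \notin A) && (r d \in A)]|.
  rewrite -cardsU_disj; last by move=> d; rewrite !inE; case: (d \in A); rewrite ?andbF.
  by apply: eq_card => d; rewrite !inE; case: (V d); case: (d \in A); case: (r d \in A).
have split2 : #|[set d | V d && (d \in A)]| =
    #|[set d | V d && (d \in A) && (r d \in A)]| + #|[set d | V d && (d \in A) && (r d \notin A)]|.
  rewrite -cardsU_disj; last by move=> d; rewrite !inE; case: (r d \in A); rewrite ?andbF.
  by apply: eq_card => d; rewrite !inE; case: (V d); case: (d \in A); case: (r d \in A).
by apply/eqP; rewrite -(eqn_add2l #|[set d | V d && (d \in A) && (r d \in A)]|) -split1 -split2 hr.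
Qed.

(* A second sector of [A] at the vertex would give another rim dart entering it. *)
Lemma single_sector A B y x : separation A B ->
  y \in rim (separator A B) A -> phi y \in rim (separator A B) A ->
  (forall y', y' \in rim (separator A B) A -> target y' = target y -> y' = y) ->
  start x = target y -> x \in A \/ x = phi y.
Proof.
move=> sAB Ey Epy uniq_y; rewrite -start_face_perm => xy.
apply: (start_ind (P := fun z => z \in A \/ z = phi y) _ _ xy); last by right.
move=> z zy [Az|->]; last first.
  by left; apply: rim_start Epy.
rewrite (rotation_sep _ sAB); case Aez: (e z \in A); [by left|right].
have Ez : e z \in rim (separator A B) A by apply: rim_edge; rewrite ?Aez.
by rewrite rotationE (uniq_y _ Ez) // target_edge zy start_face_perm.
Qed.

Lemma ins_uniq E v y y' : balanced E ->
  (forall a b, a \in E -> b \in E -> start a = v -> start b = v -> a = b) ->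
  y \in E -> y' \in E -> target y = v -> target y' = v -> y' = y.
Proof.
move=> bE iE Ey Ey' ty ty'; apply/eqP/negPn/negP=> yy'.
have : 1 < #|outs E v|.
  rewrite bE; apply/card_geqP; exists [:: y'; y]; split=> //=; first by rewrite inE andbT.
  by move=> z; rewrite !inE => /orP[] /eqP->; rewrite ?Ey ?Ey' ?ty ?ty' eqxx.
case/card_geqP=> -[|a [|b [|? ?]]] [uab size2 abE] //.
have := abE a; have := abE b; rewrite !inE !eqxx orbT.
move=> /(_ isT)/andP[Eb /eqP sb] /(_ isT)/andP[Ea /eqP sa].
by move: uab; rewrite /= inE andbT (iE a b) ?eqxx.
Qed.

Lemma mem_rim A B d : separation A B -> d \in separator A B ->
  e d \notin separator A B ->
  d \in rim (separator A B) A \/ d \in rim (separator A B) B.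
Proof.
move=> sAB Sd; rewrite in_separator negb_and !negbK.
by case/orP=> ed; [left|right]; rewrite inE Sd.
Qed.

End Separations.

(** * Separators made of two faces *)

Section TwoFaces.
Variable G : embedding.
Local Notation D := (dart G).
Local Notation e := (edge G).
Local Notation r := (rotation G).
Local Notation phi := (face_perm G).
Implicit Types (d g x y z : D) (A B C E F S f : {set D}) (v : {set D}).
Implicit Types (W X Y : {set {set D}}).

Hypothesis G_simple : simple_graph G.
Hypothesis dual_simple : simple_graph (dual_map G).

Let loopless := simple_loopless G_simple.
Let dual_loopless := dual_simple_loopless dual_simple.
Let dual_simple2 := dual_simple_parallel dual_simple.

Definition within S f1 f2 := forall d, d \in S -> face d = f1 \/ face d = f2.

Definition ties S := [set d in S | e d \in S].

(** A tie is a dual edge joining [f1] to [f2], because the dual has no loops, and two faces are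
    joined by at most one dual edge. *)
Lemma tie_uniq S f1 f2 g d :
  within S f1 f2 -> g \in ties S -> d \in ties S -> d = g \/ d = e g.
Proof.
move=> S2; rewrite !inE => /andP[Sg Seg] /andP[Sd Sed].
have := @dual_loopless g; have := @dual_loopless d.
by case: (S2 _ Sg) (S2 _ Seg) (S2 _ Sd) (S2 _ Sed) => [] gf [] egf [] df [] edf;
  rewrite gf egf df edf // => _ _;
  [left|right|right|left]; apply: dual_simple2; rewrite ?edgeK ?df ?edf ?gf ?egf.
Qed.

Lemma ties_cases S f1 f2 :
  within S f1 f2 -> ties S = set0 \/ exists2 g, g \in ties S & ties S = [set g; e g].
Proof.
move=> S2; have [->|[g Tg]] := set_0Vmem (ties S); [by left|right].
exists g => //; apply/setP=> d; rewrite in_set2; apply/idP/orP.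
  by move=> Td; case: (tie_uniq S2 Tg Td) => ->; rewrite eqxx; [left|right].
by case=> /eqP-> //; move: Tg; rewrite !inE edgeK andbC.
Qed.

Lemma face_turn d : face (r d) = face (e d).
Proof. by rewrite rotationE face_face_perm. Qed.

(** Otherwise every dart at the vertex is a tie, so that [d] and [r d] are equal or reverse to each
    other. The former is a loop of the dual, the latter a loop of [G]. *)
Lemma vertex_side A B f1 f2 d : separation A B -> within (separator A B) f1 f2 ->
  start d \in starts A :|: starts B.
Proof.
move=> sAB S2; apply/negPn/negP; rewrite inE negb_or => /andP[nA nB].
have allS x : start x = start d -> x \in separator A B.
  move=> xd; rewrite in_separator; apply/andP; split.
    by apply: contra nA; rewrite -xd; apply: mem_starts.
  by apply: contra nB; rewrite -xd; apply: mem_starts.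
have allT x : start x = start d -> x \in ties (separator A B).
  move=> xd; rewrite inE allS //= -(separator_phi _ sAB) -rotationE allS //.
  by rewrite start_rotation.
have := tie_uniq S2 (allT d (erefl _)) (allT (r d) (start_rotation d)).
case=> rd; last by apply: (@loopless d); rewrite -{1}start_rotation rd.
by apply: (@dual_loopless d); rewrite -face_turn rd.
Qed.

Lemma starts_separator A B f1 f2 : separation A B -> within (separator A B) f1 f2 ->
  starts (separator A B) =
  starts (rim (separator A B) A) :|: starts (rim (separator A B) B).
Proof.
move=> sAB S2; have sBA := separation_sym sAB.
apply/eqP; rewrite eqEsubset; apply/andP; split; apply/subsetP=> v.
  case/imsetP=> d Sd ->; have := vertex_side d sAB S2.
  move: Sd; rewrite in_separator !in_setU => /andP[nA nB].
  case/orP=> /imsetP[x Px dx]; apply/orP; [left|right]; rewrite dx.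
    exact: (starts_rim sAB Px nA (esym dx)).
  by rewrite separatorC; apply: (starts_rim sBA Px nB (esym dx)).
by rewrite inE => /orP[] /imsetP[d + ->]; rewrite inE => /andP[Sd _]; apply: mem_starts.
Qed.

Lemma card_separator A B : separation A B ->
  #|separator A B| = #|rim (separator A B) A| + #|rim (separator A B) B| +
                     #|ties (separator A B)|.
Proof.
move=> sAB; set S := separator A B.
have SE : S = rim S A :|: rim S B :|: ties S.
  apply/setP=> d; apply/idP/idP=> [Sd|]; last first.
    by rewrite !in_setU => /orP[/orP[]|]; rewrite in_set => /andP[].
  rewrite !in_setU; case eS: (e d \in S); first by rewrite orbC in_set Sd eS.
  by have [->|->] := mem_rim sAB Sd (negbT eS); rewrite ?orbT.
rewrite {1}SE !cardsU_disj // => d.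
  by move=> /(rim_rim sAB)[/negP].
rewrite in_setU => RAB; rewrite in_set => /andP[_]; rewrite in_separator => /andP[nA nB].
by case/orP: RAB; rewrite in_set ?(negPf nA) ?(negPf nB) andbF.
Qed.

(** * Euler's formula modulo 2 for two separating faces *)

Section Parity.
Variables A B : {set D}.
Hypothesis sAB : separation A B.
Local Notation S := (separator A B).
Local Notation EA := (rim S A).
Local Notation EB := (rim S B).
Hypotheses (cycA : simple_cycle EA) (cycB : simple_cycle EB).
Hypotheses (EA0 : EA != set0) (EB0 : EB != set0).
Variables f1 f2 : {set D}.
Hypothesis S2 : within S f1 f2.
Hypothesis S_faces : #|[set face d | d in S]| = 2.
Hypothesis two_places : forall x y z, x \in S -> y \in S -> z \in S ->
  start x = start y -> start x = start z -> [\/ x = y, y = z | x = z].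

Let sBA : separation B A := separation_sym sAB.
Let bA : balanced EA := rim_balanced sAB.
Let bB : balanced EB. Proof. by rewrite separatorC; apply: rim_balanced. Qed.

(** The default [d] is never taken if [E] is balanced and contains [d]. *)
Definition succ E d := odflt d [pick x in E | start x == target d].

Lemma succP E d : balanced E -> d \in E -> succ E d \in E /\ start (succ E d) = target d.
Proof.
move=> bE Ed; rewrite /succ; case: pickP => [x /andP[Ex /eqP]|no] //=.
by have [x Ex sx] := balanced_next bE Ed; have := no x; rewrite Ex sx eqxx.
Qed.

Lemma succ_inj E : balanced E -> {in E &, injective (@start G)} ->
  {in E &, injective (succ E)}.
Proof.
move=> bE iE x y Ex Ey xy; have [_ sx] := succP bE Ex; have [_ sy] := succP bE Ey.
apply: (ins_uniq bE _ Ey Ex (erefl _)); last by rewrite -sx xy.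
by move=> a b Ea Eb sa sb; apply: iE; rewrite ?sa.
Qed.

(* The walk along the rims that ignores the faces of the separator. *)
Definition bypass d :=
  if e d \in S then e d else if e d \in A then succ EA d else succ EB d.

Lemma bypassP d : d \in S ->
  [\/ [/\ d \in ties S, bypass d = e d & bypass d \in ties S],
      [/\ d \in EA, bypass d = succ EA d & bypass d \in EA]
    | [/\ d \in EB, bypass d = succ EB d & bypass d \in EB]].
Proof.
move=> Sd; rewrite /bypass; case eS: (e d \in S).
  by constructor 1; split; rewrite // in_set ?edgeK ?eS Sd.
have [Ed|Ed] := mem_rim sAB Sd (negbT eS).
  have /andP[_ ->] : (d \in S) && (e d \in A) by move: Ed; rewrite in_set.
  by constructor 2; have [] := succP bA Ed.
have /andP[_ eB] : (d \in S) && (e d \in B) by move: Ed; rewrite in_set.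
have /negPf-> : e d \notin A by apply: sep_disjoint sBA _ eB.
by constructor 3; have [] := succP bB Ed.
Qed.

Lemma bypass_S d : d \in S -> bypass d \in S.
Proof. by case/bypassP=> -[_ _]; rewrite in_set => /andP[]. Qed.

Lemma start_bypass d : d \in S -> start (bypass d) = target d.
Proof.
case/bypassP=> -[Ed -> _] //; first by have [] := succP bA Ed.
by have [] := succP bB Ed.
Qed.

Lemma tie_not_rim d : d \in ties S -> d \notin EA /\ d \notin EB.
Proof.
rewrite in_set => /andP[_]; rewrite in_separator => /andP[nA nB].
by split; rewrite in_set ?(negPf nA) ?(negPf nB) andbF.
Qed.

Lemma bypass_inj : {in S &, injective bypass}.
Proof.
have dis d : d \in EA -> d \in EB -> False by move=> /(rim_rim sAB)[/negP].
have tA d : d \in ties S -> d \in EA -> False by move=> /tie_not_rim[/negP].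
have tB d : d \in ties S -> d \in EB -> False by move=> /tie_not_rim[_ /negP].
move=> x y Sx Sy; case: (bypassP Sx) => -[Ex bx Ebx]; case: (bypassP Sy) => -[Ey by_ Eby] xy.
- by apply: (@perm_inj _ e); rewrite -bx -by_.
- by case: (tA (bypass x)); rewrite // xy.
- by case: (tB (bypass x)); rewrite // xy.
- by case: (tA (bypass x)); rewrite // xy.
- by case: cycA => iA _; apply: (succ_inj bA iA Ex Ey); rewrite -bx -by_.
- by case: (dis (bypass x)); rewrite // xy.
- by case: (tB (bypass x)); rewrite // xy.
- by case: (dis (bypass x)); rewrite // xy.
- by case: cycB => iB _; apply: (succ_inj bB iB Ex Ey); rewrite -bx -by_.
Qed.

Let T := {d : D | d \in S}.

(** The fallback [x] of [insubd] concerns only maps that leave [S]; the maps lifted here preserve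
    it. *)
Definition lift_fun (h : D -> D) (x : T) : T := insubd x (h (val x)).

Lemma val_lift h (x : T) : (forall d, d \in S -> h d \in S) -> val (lift_fun h x) = h (val x).
Proof. by move=> hS; rewrite val_insubd hS // (valP x). Qed.

Lemma lift_inj h : (forall d, d \in S -> h d \in S) -> {in S &, injective h} ->
  injective (lift_fun h).
Proof.
move=> hS hI x y /(congr1 val); rewrite !val_lift // => /hI xy.
by apply: val_inj; apply: xy; apply: valP.
Qed.

Let phiS d : d \in S -> phi d \in S. Proof. by rewrite separator_phi. Qed.
Let phiI : {in S &, injective phi}. Proof. by move=> ? ? _ _; apply: perm_inj. Qed.

Let pbypass : {perm T} := perm (lift_inj bypass_S bypass_inj).
Let pphi : {perm T} := perm (lift_inj phiS phiI).
(** Chosen so that [pbypass * prho = pphi], in analogy with [edge * rotation = face_perm]. *)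
Let prho : {perm T} := (pbypass^-1 * pphi)%g.

Let val_pbypass (x : T) : val (pbypass x) = bypass (val x).
Proof. by rewrite permE val_lift //; apply: bypass_S. Qed.

Let val_pphi (x : T) : val (pphi x) = phi (val x).
Proof. by rewrite permE val_lift. Qed.

Let val_pbypassV (x : T) : bypass (val ((pbypass^-1)%g x)) = val x.
Proof. by rewrite -val_pbypass permKV. Qed.

Lemma card_val_image (L : finType) (l : D -> L) :
  #|(fun x : T => l (val x)) @: setT| = #|[set l d | d in S]|.
Proof.
apply: eq_card => v; apply/imsetP/imsetP=> [[x _ ->]|[d Sd ->]].
  by exists (val x) => //; apply: valP.
by exists (exist _ d Sd).
Qed.

Lemma card_porbits_pphi : #|porbits pphi| = 2.
Proof.
rewrite -S_faces -card_val_image; apply: card_porbits_label => x.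
  by rewrite val_pphi face_face_perm.
move=> y /esym /eqP; rewrite eq_porbit_mem => /porbitP[i xy].
apply/porbitP; exists i; apply: val_inj; rewrite {}xy.
elim: i => [|i IHi]; first by rewrite !expg0 !perm1.
by rewrite [in RHS]expgSr [in RHS]permM val_pphi -IHi expgSr [LHS]permM.
Qed.

(** [bypass] and [phi] both continue at the target of a dart, so [prho] keeps the starting vertex.
    Where a vertex has two places in [S], [prho] has to exchange them. *)
Lemma card_porbits_prho : #|porbits prho| = #|starts S|.
Proof.
rewrite -card_val_image; apply: card_porbits_label => x.
  rewrite permM val_pphi start_face_perm -start_bypass ?val_pbypassV //.
  exact: valP.
move=> y xy; have [<-|/eqP nxy] := eqVneq x y; first exact: porbit_id.
suff -> : y = prho x by have := mem_porbit prho 1 x; rewrite expg1.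
pose w := val ((pbypass^-1)%g x).
have rw : val (prho x) = phi w by rewrite permM val_pphi.
have xw : bypass w = val x by apply: val_pbypassV.
have Sw : w \in S by apply: valP.
have sx : start (val x) = target w by rewrite -xw start_bypass.
have [] := two_places (valP x) (valP y) (phiS Sw) xy.
- by rewrite start_face_perm.
- by move/val_inj/nxy.
- by move=> yw; apply: val_inj; rewrite rw.
(* The case left is a place fixed by [prho]: [phi] and [bypass] agree on [w], and then
   [single_sector] leaves no room for a second place [y]. *)
move=> xpw; exfalso.
case: (bypassP Sw) => -[Ew bw Ebw].
- by apply: (@dual_loopless w); rewrite -bw xw xpw face_face_perm.
- have Epw : phi w \in EA by rewrite -xpw -xw.
  have uniqw y' : y' \in EA -> target y' = target w -> y' = w.
    case: cycA => iA _ Ey' ty'; apply: (ins_uniq bA _ Ew Ey' _ ty') => //.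
    by move=> a b Ea Eb sa sb; apply: iA; rewrite ?sa.
  have [Ay|yw] := single_sector sAB Ew Epw uniqw (etrans (esym xy) sx).
    by have := valP y; rewrite /= in_separator Ay.
  by apply: nxy; apply: val_inj; rewrite xpw yw.
- have uniqw y' : y' \in EB -> target y' = target w -> y' = w.
    case: cycB => iB _ Ey' ty'; apply: (ins_uniq bB _ Ew Ey' _ ty') => //.
    by move=> a b Ea Eb sa sb; apply: iB; rewrite ?sa.
  have Epw : phi w \in EB by rewrite -xpw -xw.
  move: Ew Epw uniqw; rewrite separatorC => Ew Epw uniqw.
  have [By|yw] := single_sector sBA Ew Epw uniqw (etrans (esym xy) sx).
    by have := valP y; rewrite /= in_separator By andbF.
  by apply: nxy; apply: val_inj; rewrite xpw yw.
Qed.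

(** The successor map sends the darts of [C] entering [v] bijectively to those leaving [v]. *)
Lemma succ_balanced E C : balanced E -> {in E &, injective (@start G)} ->
  C \subset E -> (forall d, d \in E -> (succ E d \in C) = (d \in C)) -> balanced C.
Proof.
move=> bE iE /subsetP CE Cs v.
have inj : {in ins C v &, injective (succ E)}.
  by move=> x y; rewrite !in_set => /andP[/CE Ex _] /andP[/CE Ey _]; apply: succ_inj.
rewrite -(card_in_imset inj); apply: eq_card => d; rewrite in_set.
apply/andP/imsetP=> [[Cd /eqP sd]|[d']].
  have [d' Ed' td'] := balanced_prev bE (CE _ Cd).
  have [Es ss] := succP bE Ed'.
  have dE : d = succ E d' by apply: iE => //; [exact: CE|rewrite ss].
  by exists d' => //; rewrite in_set -(Cs _ Ed') -dE Cd td' sd /=.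
rewrite in_set => /andP[Cd' /eqP td'] ->; have Ed' := CE _ Cd'.
by rewrite Cs // Cd'; have [_ ->] := succP bE Ed'; rewrite td'.
Qed.

Let label d := (d \in EA, d \in EB).

Let label_tie d : d \in ties S -> label d = (false, false).
Proof. by case/tie_not_rim=> /negPf nA /negPf nB; rewrite /label nA nB. Qed.

Let label_left d : d \in EA -> label d = (true, false).
Proof. by move=> Ed; have [/negPf nB _] := rim_rim sAB Ed; rewrite /label Ed nB. Qed.

Let label_right d : d \in EB -> label d = (false, true).
Proof.
move=> Ed; rewrite /label Ed; congr pair; apply/negP=> /(rim_rim sAB)[/negP].
by case.
Qed.

(** The orbit is a nonempty balanced subset of the cycle [E], hence all of [E] by minimality. *)
Lemma bypass_orbit E (x y : T) :
  balanced E -> simple_cycle E -> E \subset S ->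
  (forall d, d \in E -> bypass d = succ E d) ->
  val x \in E -> val y \in E -> y \in porbit pbypass x.
Proof.
move=> bE [iE cE] /subsetP ES byE Ex Ey.
pose C := [set val z | z in porbit pbypass x].
suff : val y \in C by case/imsetP=> z zx /val_inj->.
have CE : C \subset E.
  apply/subsetP=> _ /imsetP[z zx ->].
  apply: (@porbit_closed _ pbypass (fun u : T => val u \in E) x z) => // w Ew.
  by rewrite val_pbypass byE //; have [] := succP bE Ew.
have C0 : C != set0 by apply/set0Pn; exists (val x); apply: imset_f; apply: porbit_id.
rewrite (cE C CE C0 _) //; apply: succ_balanced bE iE CE _ => d Ed.
pose z : T := exist _ d (ES _ Ed).
have -> : succ E d = val (pbypass z) by rewrite val_pbypass byE.
have -> : d = val z by [].
rewrite /C !(mem_imset _ _ val_inj) -!eq_porbit_mem.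
by have := porbit_perm pbypass 1 z; rewrite expg1 => ->.
Qed.

Lemma card_porbits_pbypass : #|porbits pbypass| = 2 + (ties S != set0).
Proof.
have -> : #|porbits pbypass| = #|(fun x : T => label (val x)) @: setT|.
  apply: card_porbits_label => [x|x y].
    rewrite val_pbypass; case: (bypassP (valP x)) => -[Ex _ Ebx].
    - by rewrite !label_tie.
    - by rewrite !label_left.
    - by rewrite !label_right.
  case: (bypassP (valP x)) => -[Ex bx Ebx]; case: (bypassP (valP y)) => -[Ey by_ Eby];
    rewrite ?(label_tie Ex) ?(label_tie Ey) ?(label_left Ex) ?(label_left Ey)
            ?(label_right Ex) ?(label_right Ey) // => _.
  - have [yx|yx] := tie_uniq S2 Ex Ey; first by rewrite (val_inj yx) porbit_id.
    suff -> : y = pbypass x by have := mem_porbit pbypass 1 x; rewrite expg1.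
    by apply: val_inj; rewrite val_pbypass bx.
  - apply: (bypass_orbit bA cycA) => //; first by apply/subsetP=> d; rewrite in_set => /andP[].
    by move=> d; rewrite in_set /bypass => /andP[Sd eA]; rewrite eA in_separator eA.
  - apply: (bypass_orbit bB cycB) => //; first by apply/subsetP=> d; rewrite in_set => /andP[].
    move=> d; rewrite in_set /bypass => /andP[Sd eB].
    by rewrite in_separator eB andbF (negPf (sep_disjoint sBA eB)).
rewrite card_val_image.
have [/set0Pn[a Ea] /set0Pn[b Eb]] := (EA0, EB0).
have SE d E : d \in rim S E -> d \in S by rewrite in_set => /andP[].
have SL E d : d \in rim S E -> label d \in [set label d | d in S].
  by move/SE=> Sd; apply: imset_f.
have [T0|[g Tg _]] := ties_cases S2.
  rewrite T0 eqxx /= addn0.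
  have -> : [set label d | d in S] = [set (true, false); (false, true)].
    apply/setP=> l; apply/imsetP/set2P=> [[d Sd ->]|[]->].
    - case: (bypassP Sd) => -[Ed _ _]; first by rewrite T0 inE in Ed.
        by left; apply: label_left.
      by right; apply: label_right.
    - by exists a; [apply: SE Ea|rewrite label_left].
    - by exists b; [apply: SE Eb|rewrite label_right].
  by rewrite cards2.
have -> : ties S != set0 by apply/set0Pn; exists g.
have -> : [set label d | d in S] = (false, false) |: [set (true, false); (false, true)].
  apply/setP=> l; rewrite in_setU1; apply/imsetP/orP=> [[d Sd ->]|[/eqP->|/set2P[]->]].
  - case: (bypassP Sd) => -[Ed _ _]; first by left; rewrite label_tie.
      by right; rewrite label_left // set21.
    by right; rewrite label_right // set22.
  - by exists g; [move: Tg; rewrite in_set => /andP[]|rewrite label_tie].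
  - by exists a; [apply: SE Ea|rewrite label_left].
  - by exists b; [apply: SE Eb|rewrite label_right].
by rewrite cardsU1 cards2 !inE.
Qed.

(* The orbits of [pphi], [pbypass] and [prho] are the two faces, the boundary
   curves of the regions [A] and [B] (and the edge common to the two faces) and
   the vertices of the two faces, so comparing signs amounts to Euler's formula
   modulo 2. *)
Lemma euler_parity :
  odd #|starts EA :&: starts EB| = (ties S != set0).
Proof.
(* In terms of orbits, multiplicativity of the sign says that [#|S| + #|starts S|] has the parity of
   the number of tie edges. The sizes of the rims cancel, and each mixed vertex is shared by both
   rims. *)
have := odd_permM pbypass prho; rewrite mulKVg /odd_perm.
rewrite card_porbits_pphi card_porbits_prho card_porbits_pbypass card_sig.
have -> : #|[pred d | d \in S]| = #|S| by apply: eq_card.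
rewrite (card_separator sAB) (starts_separator sAB S2).
have cA : #|starts EA| = #|EA| by case: cycA => iA _; rewrite card_in_imset.
have cB : #|starts EB| = #|EB| by case: cycB => iB _; rewrite card_in_imset.
have := cardsUI (starts EA) (starts EB); rewrite cA cB => <-.
have -> : #|ties S| = (ties S != set0).*2.
  have [->|[g Tg Tge]] := ties_cases S2; first by rewrite cards0 eqxx.
  have -> : ties S != set0 by apply/set0Pn; exists g.
  by rewrite Tge cards2 eq_sym edge_neq.
rewrite !oddD odd_double.
by case: (odd #|_ :|: _|); case: (odd #|_ :&: _|); case: (ties S != set0).
Qed.

End Parity.
End TwoFaces.

(** * Vertex cuts obtained from separations of the dual *)

Section Bounds.
Variable G : embedding.
Local Notation D := (dart G).
Local Notation e := (edge G).
Local Notation r := (rotation G).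
Local Notation phi := (face_perm G).
Implicit Types (d g x y z : D) (A B C E F S f : {set D}) (v : {set D}).
Implicit Types (P W X Y : {set {set D}}).

(** [P] is closed under adjacency off [W] and tells two remaining vertices apart, so [W] disconnects
    the graph. *)
Lemma connected_bound c W P x y :
  k_connected c G -> W \subset vertices G ->
  (forall g, start g \in P -> start g \notin W -> target g \notin W -> target g \in P) ->
  start x \in P -> start x \notin W -> start y \notin P -> start y \notin W ->
  c <= #|W|.
Proof.
case=> _ nocut WV closedP xP xW yP yW; rewrite leqNgt; apply/negP=> lt.
apply: (nocut _ W lt); split=> //; exists (start x), (start y).
rewrite !in_setD xW yW !imset_f //; split=> //.
apply: contra yP => /connectP[p]; elim: p (start x) xP => [|w p IHp] u uP /=.
  by move=> _ ->.
case/andP=> /and3P[uW wW /existsP[g /andP[/eqP gu /eqP gw]]] pw; apply: IHp pw.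
by rewrite -gw; apply: closedP; rewrite ?gu ?gw.
Qed.

Hypothesis G_simple : simple_graph G.
Hypothesis dual_simple : simple_graph (dual_map G).

Let loopless := simple_loopless G_simple.
Let simple := simple_parallel G_simple.
Let dual_loopless := dual_simple_loopless dual_simple.

Lemma face_perm_neq d : phi d <> d.
Proof. by move=> pd; apply: (@loopless d); rewrite -start_face_perm pd. Qed.

(** A facial walk of length two would, by simplicity, run back and forth along one edge, which is
    then a loop of the dual. *)
Lemma face_perm2_neq d : phi (phi d) <> d.
Proof.
move=> ppd; apply: (@dual_loopless d).
suff <- : phi d = e d by rewrite face_face_perm.
apply: simple; first by rewrite start_face_perm.
by rewrite target_edge -[RHS](congr1 (@start G) ppd) start_face_perm.
Qed.

Definition mixed A B := starts A :&: starts B.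

Lemma starts_vertices A : starts A \subset vertices G.
Proof. by apply/subsetP=> _ /imsetP[d _ ->]; apply: imset_f. Qed.

(** An edge from [P] to [Q] can border neither side, so it is the unique tie. Without it the mixed
    vertices form a cut; with it, one of its ends is added to them. *)
Lemma cut_bound c A B f1 f2 x y :
  k_connected c G -> separation A B -> within (separator A B) f1 f2 ->
  start x \in starts A :\: starts B -> start y \in starts B :\: starts A ->
  c <= #|mixed A B| \/
  exists g, [/\ g \in ties (separator A B), start g \in starts A :\: starts B,
                target g \in starts B :\: starts A & c <= #|mixed A B|.+1].
Proof.
move=> cG sAB S2 xP yQ.
set P := starts A :\: starts B in xP *; set Q := starts B :\: starts A in yQ *.
set X := mixed A B.
have XV : X \subset vertices G by apply: subset_trans (starts_vertices A); apply: subsetIl.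
have PQ u : u \in P -> u \in Q -> False.
  by rewrite !in_setD => /andP[/negP nB _] /andP[_ /nB].
have PX u : u \in P -> u \notin X.
  by rewrite in_setD in_setI => /andP[/negPf-> _]; rewrite andbF.
have QX u : u \in Q -> u \notin X.
  by rewrite in_setD in_setI => /andP[/negPf-> _].
have XPQ d : start d \notin X -> start d \in P \/ start d \in Q.
  have := vertex_side G_simple dual_simple d sAB S2; rewrite in_setU !in_setD in_setI.
  by case: (_ \in starts A); case: (_ \in starts B) => //= _ _; [left|right].
have link_tie g : start g \in P -> target g \in Q -> g \in ties (separator A B).
  rewrite !in_setD => /andP[sB _] /andP[tA _]; rewrite in_set !in_separator.
  apply/and3P; split; first (apply/andP; split).
  - by apply: contra tA; rewrite -(sep_left sAB) -start_face_perm; apply: mem_starts.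
  - by apply: contra sB; apply: mem_starts.
  - by apply: contra tA; apply: mem_starts.
  - by apply: contra sB; rewrite -target_edge -(sep_right sAB) -start_face_perm; apply: mem_starts.
case: (pickP [pred g | (start g \in P) && (target g \in Q)]) => [g /andP[gP gQ]|nolink].
  right; exists g; have Tg := link_tie _ gP gQ; split=> //.
  have uniq_g h : start h \in P -> target h \in Q -> h = g.
    move=> hP hQ; have [//|hg] := tie_uniq dual_simple S2 Tg (link_tie _ hP hQ).
    by case: (PQ (start h)); rewrite // hg.
  have [u /andP[uP ug]|noP] := pickP [pred u | (start u \in P) && (start u != start g)].
    apply: leq_trans (_ : #|start g |: X| <= _); last first.
      by rewrite cardsU1 (PX _ gP).
    apply: (connected_bound (P := P) (x := u) (y := e g) cG).
    - by rewrite subUset XV sub1set imset_f.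
    - move=> h hP; rewrite !in_setU1 !negb_or => /andP[hg _] /andP[_ hX].
      have [//|hQ] := XPQ (e h) hX; case/eqP: hg.
      by rewrite (uniq_g h hP hQ).
    - by [].
    - by rewrite in_setU1 negb_or ug PX.
    - by apply/negP=> /PQ; apply.
    - by rewrite in_setU1 negb_or QX // andbT; apply/eqP/nesym/loopless.
  have [u /andP[uQ ug]|noQ] := pickP [pred u | (start u \in Q) && (start u != target g)].
    apply: leq_trans (_ : #|target g |: X| <= _); last first.
      by rewrite cardsU1 (QX _ gQ).
    apply: (connected_bound (P := P) (x := g) (y := u) cG).
    - by rewrite subUset XV sub1set andbT; apply: imset_f.
    - move=> h hP; rewrite !in_setU1 !negb_or => /andP[hg _] /andP[htg hX].
      have [//|hQ] := XPQ (e h) hX; case/eqP: htg.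
      by rewrite (uniq_g h hP hQ).
    - by [].
    - by rewrite in_setU1 negb_or PX // andbT; apply/eqP/loopless.
    - by apply/negP=> /PQ; apply.
    - by rewrite in_setU1 negb_or ug QX.
  (* Here [P] and [Q] have only one vertex each, so no cut arises; instead the order of the graph is
     at most [#|X| + 2] and exceeds [c]. *)
  have [ltc _] := cG; rewrite -ltnS; apply: leq_trans ltc _.
  apply: leq_trans (_ : #|start g |: (target g |: X)| <= _); last first.
    rewrite cardsU1 cardsU1 (QX _ gQ); by case: (_ \notin _); rewrite /= ?add1n ?add0n.
  apply/subset_leq_card/subsetP=> _ /imsetP[d _ ->].
  rewrite !in_setU1; apply/or3P; have [dX|] := boolP (start d \in X); first by constructor 3.
  case/XPQ=> dPQ.
    by constructor 1; have := noP d; rewrite /= [start d \in P]dPQ => /negbFE.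
  by constructor 2; have := noQ d; rewrite /= [start d \in Q]dPQ => /negbFE.
left; apply: (connected_bound (P := P) (x := x) (y := y) cG XV) => //.
- move=> h hP _ hX; have [//|hQ] := XPQ (e h) hX.
  by have := nolink h; rewrite /= hP [target h \in Q]hQ.
- exact: PX.
- by apply/negP=> /PQ; apply.
- exact: QX.
Qed.

End Bounds.

(** * Lower bounds for the sizes of separating faces *)

Section OneSided.
Variable G : embedding.
Local Notation D := (dart G).
Local Notation e := (edge G).
Local Notation r := (rotation G).
Local Notation phi := (face_perm G).
Implicit Types (d g x y z : D) (E F f : {set D}) (v : {set D}).
Implicit Types (P W X Y : {set {set D}}).

Hypothesis G_simple : simple_graph G.
Hypothesis dual_simple : simple_graph (dual_map G).

Let loopless := simple_loopless G_simple.
Let simple := simple_parallel G_simple.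
Let dual_loopless := dual_simple_loopless dual_simple.
Let dual_simple2 := dual_simple_parallel dual_simple.

Variables (A B f1 f2 : {set D}).
Hypothesis sAB : separation A B.
Local Notation S := (separator A B).
Local Notation EA := (rim S A).
Local Notation EB := (rim S B).
Local Notation X := (mixed A B).
Hypothesis S2 : within S f1 f2.
Hypothesis BA : starts B \subset starts A.
Hypothesis B0 : B != set0.

Let sBA : separation B A := separation_sym sAB.
Let bA : balanced EA := rim_balanced sAB.
Let bB : balanced EB. Proof. by rewrite separatorC; apply: rim_balanced. Qed.
Let oA : oriented EA := @rim_oriented _ A B.
Let oB : oriented EB. Proof. by rewrite separatorC; apply: rim_oriented. Qed.

Definition inland := [set d in B | e d \in B].
Definition coast := reversed EB.

Lemma coastE d : (d \in coast) = (d \in B) && (e d \notin B).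
Proof.
rewrite in_set [e d \in _]in_set edgeK in_separator.
by case Bd: (d \in B); rewrite ?andbF // (sep_edge sBA Bd) andbT.
Qed.

Lemma card_B : #|B| = #|inland| + #|coast|.
Proof.
rewrite -cardsU_disj.
  by apply: eq_card => d; rewrite in_setU coastE in_set; case: (d \in B); case: (e d \in B).
by move=> d; rewrite coastE in_set => /andP[_ ->] /andP[].
Qed.

Lemma coast_face d : d \in coast -> face (e d) = f1 \/ face (e d) = f2.
Proof. by rewrite in_set in_set => /andP[/S2]. Qed.

(** Three consecutive darts of a face of [B] are distinct. If none were inland, two of them would
    border the same one of [f1] and [f2], against simplicity of the dual. *)
Lemma inland_face d : d \in B -> exists2 x, x \in inland & face x = face d.
Proof.
move=> Bd; have B1 : phi d \in B by rewrite (sep_right sAB).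
have B2 : phi (phi d) \in B by rewrite (sep_right sAB).
have [I|nI] := boolP (d \in inland); first by exists d.
have [I1|nI1] := boolP (phi d \in inland).
  by exists (phi d); rewrite ?face_face_perm.
have [I2|nI2] := boolP (phi (phi d) \in inland).
  by exists (phi (phi d)); rewrite ?face_face_perm.
have C x : x \in B -> x \notin inland -> face (e x) = f1 \/ face (e x) = f2.
  by move=> Bx; rewrite in_set Bx /= => nBx; apply: coast_face; rewrite coastE Bx.
have F1 : face (phi d) = face d := face_face_perm d.
have F2 : face (phi (phi d)) = face d by rewrite !face_face_perm.
have := @face_perm_neq _ G_simple d; have := @face_perm_neq _ G_simple (phi d).
have := @face_perm2_neq _ G_simple dual_simple d.
by case: (C _ Bd nI) (C _ B1 nI1) (C _ B2 nI2) => [] e0 [] e1 [] e2 n02 n12 n01;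
  exfalso; first [apply: n01; apply: dual_simple2; rewrite ?e0 ?e1 ?F1 //; fail
                 |apply: n12; apply: dual_simple2; rewrite ?e1 ?e2 ?F1 ?F2 //; fail
                 |apply: n02; apply: dual_simple2; rewrite ?e0 ?e2 ?F2 //; fail].
Qed.

(** A face of [B] has at most one edge on [f1] and at most one on [f2]. Choosing an inland dart in
    each face is therefore injective on the coast towards either of them. *)
Lemma coast_inland : #|EB| <= 2 * #|inland|.
Proof.
pose h d := odflt d [pick x in inland | face x == face d].
have hP d : d \in coast -> h d \in inland /\ face (h d) = face d.
  rewrite coastE /h => /andP[/inland_face[x Ix fx] _]; case: pickP => [y /andP[Iy /eqP]|no] //.
  by have := no x; rewrite Ix fx eqxx.
have half f : #|[set d in coast | face (e d) == f]| <= #|inland|.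
  have inj : {in [set d in coast | face (e d) == f] &, injective h}.
    move=> x y; rewrite !(in_set (fun _ => _ && _)) => /andP[Cx /eqP ex] /andP[Cy /eqP ey] hxy.
    have [_ fx] := hP _ Cx; have [_ fy] := hP _ Cy.
    by apply: dual_simple2; rewrite ?ex ?ey // -fx -fy hxy.
  rewrite -(card_in_imset inj); apply/subset_leq_card/subsetP=> _ /imsetP[d + ->].
  by rewrite in_set => /andP[/hP[]].
rewrite -(card_rev EB) mul2n -addnn; apply: leq_trans (leq_add (half f1) (half f2)).
apply: leq_trans (leq_card_setU _ _); apply/subset_leq_card/subsetP=> d Cd.
by rewrite in_setU !(in_set (fun _ => _ && _)) Cd; case: (coast_face Cd) => ->; rewrite eqxx ?orbT.
Qed.

Lemma starts_B : starts B \subset X.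
Proof. by rewrite subsetI BA subxx. Qed.

Lemma mixed_rims : starts EA :&: starts EB = X.
Proof. exact: mixedE. Qed.

Let XA : X \subset starts EA. Proof. by rewrite -mixed_rims subsetIl. Qed.
Let XB : X \subset starts EB. Proof. by rewrite -mixed_rims subsetIr. Qed.

Lemma B_ends d : d \in B -> (start d \in X) && (target d \in X).
Proof.
move=> Bd; apply/andP; split; apply: (subsetP starts_B); first exact: mem_starts.
by rewrite -start_face_perm mem_starts // (sep_right sAB).
Qed.

Lemma EB_ends d : d \in EB -> (start d \in X) && (target d \in X).
Proof.
by rewrite in_set => /andP[_ /B_ends]; rewrite target_edge andbC.
Qed.

(** Every vertex of [B] is mixed, so [B], [EB], the inner darts of [EA] and their reversals are
    disjoint sets of ordered pairs from [X]. *)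
Lemma inland_bound :
  2 * #|EB| + #|inland| + 2 * #|inner EA X| + #|X| <= #|X| * #|X|.
Proof.
have oI : oriented (inner EA X) := orientedS (inner_sub EA X) oA.
have dis1 d : d \in B -> d \in EB -> False.
  by move=> Bd; rewrite in_set in_separator Bd andbF.
have dis2 d : d \in B :|: EB -> d \in inner EA X :|: reversed (inner EA X) -> False.
  rewrite !in_setU [d \in reversed _]in_set => BE IA.
  have {}IA : d \in EA \/ e d \in EA.
    by case/orP: IA => /(subsetP (inner_sub EA X)); [left|right].
  case: IA => Ed; have [n1 n2] := rim_rim sAB Ed; rewrite ?edgeK in n2.
    case/orP: BE => [Bd|]; last exact/negP.
    by move: Ed; rewrite in_set in_separator Bd andbF.
  case/orP: BE => [Bd|]; last exact/negP.
  by move: Ed; rewrite in_set edgeK andbC; case/andP=> /(sep_disjoint sAB); rewrite Bd.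
have -> : 2 * #|EB| + #|inland| + 2 * #|inner EA X| =
    #|B :|: EB :|: (inner EA X :|: reversed (inner EA X))|.
  rewrite (cardsU_disj dis2) (cardsU_disj dis1) (card_sym oI) card_B card_rev; lia.
apply: (inside_bound G_simple) => d; rewrite !in_setU.
case/orP=> [/orP[/B_ends|/EB_ends]|/orP[]] //; first by rewrite in_set => /andP[].
by rewrite !in_set target_edge andbC => /andP[/andP[]] *; apply/andP.
Qed.

Lemma EB_neq0 : EB != set0.
Proof.
have [b Bb] := set0Pn _ B0; have := subsetP XB _ (subsetP starts_B _ (mem_starts Bb)).
by case/imsetP=> d Ed _; apply/set0Pn; exists d.
Qed.

Section Extremal.
Hypothesis S11 : #|S| <= 11.

(** At most three mixed vertices leave no room for [B]; five of them already force $|EA|+|EB| \ge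
    12$, and six or more make each rim too long. With four mixed vertices all inequalities are
    equalities. *)
Lemma extremal_counts : [/\ #|X| = 4, #|EB| = 4, #|inland| = 2,
  ties S = set0 & #|EA| + #|inner EA X| = 8 /\ #|inner EA X| = 1].
Proof.
suff [-> -> -> /cards0_eq-> [-> ->]] : [/\ #|X| = 4, #|EB| = 4, #|inland| = 2,
  #|ties S| = 0 & #|EA| + #|inner EA X| = 8 /\ #|inner EA X| = 1] by [].
have ge3 := balanced_ge3 G_simple bB oB EB_neq0.
have := coast_inland; have := inland_bound; have := inner_bound bA XA.
have := leq_trans (subset_leq_card XA) (card_starts EA).
have := leq_trans (subset_leq_card XB) (card_starts EB).
have := card_separator sAB.
move: S11 ge3; move: #|S| #|EA| #|EB| #|ties S| #|inland| #|inner EA X| #|X|.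
move=> s a b t i z x; case: x => [|[|[|[|[|[|x]]]]]] *; try (exfalso; lia).
by split; try split; lia.
Qed.

Let X4 : #|X| = 4. Proof. by case: extremal_counts. Qed.
Let EB4 : #|EB| = 4. Proof. by case: extremal_counts. Qed.
Let inland2 : #|inland| = 2. Proof. by case: extremal_counts. Qed.
Let no_ties d : d \in S -> e d \notin S.
Proof.
move=> Sd; apply/negP=> eS; have [_ _ _ T0 _] := extremal_counts.
by have : d \in ties S; [rewrite in_set Sd | rewrite T0 in_set0].
Qed.

Let startsEB : starts EB = X.
Proof.
by apply/esym/eqP; rewrite eqEcard XB X4 -EB4 card_starts.
Qed.

Let injEB : {in EB &, injective (@start G)}.
Proof. by case: (simple_cycle_small G_simple bB oB _); rewrite ?EB4. Qed.

Let tightEA : (forall d, d \in EA -> (start d \in X) || (target d \in X)) /\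
  {in [set d in EA | start d \in X] &, injective (@start G)}.
Proof. by apply: inner_tight bA XA _; case: extremal_counts; lia. Qed.

Let uniqEA y y' : y \in EA -> y' \in EA -> target y \in X -> target y' = target y -> y' = y.
Proof.
move=> Ey Ey' Xy ty; apply: (ins_uniq bA _ Ey Ey' (erefl _) ty) => a b Ea Eb sa sb.
by have [_ inj] := tightEA; apply: inj; rewrite ?sa ?sb // in_set ?Ea ?Eb ?sa ?sb.
Qed.

Let S_rims d : d \in S -> d \in EA \/ d \in EB.
Proof. by move=> Sd; apply: mem_rim (no_ties Sd). Qed.

Let EA_S d : d \in EA -> d \in S. Proof. by rewrite in_set => /andP[]. Qed.
Let EB_S d : d \in EB -> d \in S. Proof. by rewrite in_set => /andP[]. Qed.
Let EA_EB d : d \in EA -> d \in EB -> False.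
Proof. by move/(rim_rim sAB)=> [/negP]. Qed.

(** [EA] enters a mixed vertex only once. If the face went on along [EA], [single_sector] would give
    all other corners there to [A], while [EB] needs one. *)
Let switchA y : y \in EA -> target y \in X -> phi y \in EB.
Proof.
move=> Ey Xy; have [|Epy|//] := @S_rims (phi y); first by rewrite separator_phi ?EA_S.
have := Xy; rewrite -startsEB => /imsetP[x Ex sx].
have uniq_y y' : y' \in EA -> target y' = target y -> y' = y by move=> Ey'; apply: uniqEA.
have [Ax|xp] := single_sector sAB Ey Epy uniq_y (esym sx).
  by have := EB_S Ex; rewrite in_separator Ax.
by case: (EA_EB Epy); rewrite -xp.
Qed.

Let switchB y : y \in EB -> phi y \in EA.
Proof.
move=> Ey; have [|//|Epy] := @S_rims (phi y); first by rewrite separator_phi ?EB_S.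
have /andP[_ Xy] := EB_ends Ey.
have /imsetP[x Ex sx] := subsetP XA _ Xy.
have uniq_y y' : y' \in EB -> target y' = target y -> y' = y.
  move=> Ey' ty; apply: (ins_uniq bB _ Ey Ey' (erefl _) ty) => a b Ea Eb sa sb.
  by apply: injEB; rewrite ?sa.
move: Ey Epy uniq_y; rewrite separatorC => Ey Epy uniq_y.
have [Bx|xp] := single_sector sBA Ey Epy uniq_y (esym sx).
  by have := EA_S Ex; rewrite in_separator Bx andbF.
by case: (EA_EB Ex); rewrite xp separatorC.
Qed.

(* What remains is a quadrilateral [B], cut by the edge of [g] into two triangles.
   One more edge joins two of its corners, and the orientation of the surface
   then forces one of the two faces to close up too early. *)
Lemma extremal_false : False.
Proof.
have /set0Pn[g Ig] : inland != set0 by rewrite -card_gt0 inland2.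
have [Bg Beg] : g \in B /\ e g \in B by move: Ig; rewrite in_set => /andP[].
have Ieg : e g \in inland by rewrite in_set Beg edgeK.
have inlandE d : d \in inland -> d = g \/ d = e g.
  move=> Id; suff : d \in [set g; e g] by case/set2P; [left|right].
  suff -> : [set g; e g] = inland by [].
  apply/eqP; rewrite eqEcard inland2 cards2 eq_sym edge_neq subUset !sub1set.
  by rewrite Ig Ieg.
pose g1 := phi g; pose g2 := phi g1; pose h1 := phi (e g); pose h2 := phi h1.
have fg1 : face g1 = face g by rewrite face_face_perm.
have fg2 : face g2 = face g by rewrite !face_face_perm.
have fh1 : face h1 = face (e g) by rewrite face_face_perm.
have fh2 : face h2 = face (e g) by rewrite !face_face_perm.
have gh := @dual_loopless g.
have pn := @face_perm_neq _ G_simple.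
have p2n := @face_perm2_neq _ G_simple dual_simple.
have Bphi d : d \in B -> phi d \in B by rewrite (sep_right sAB).
have coastP d : d \in B -> d <> g -> d <> e g -> d \in coast.
  move=> Bd dg deg; rewrite coastE Bd /=; apply/negP=> Bed.
  by case: (inlandE d); rewrite // in_set Bd.
have Cg1 : g1 \in coast.
  apply: coastP; [exact: Bphi|exact: pn|move=> E; apply: gh; by rewrite -fg1 E].
have Cg2 : g2 \in coast.
  apply: coastP; [by apply: (Bphi); apply: (Bphi)|exact: p2n|move=> E; apply: gh; by rewrite -fg2 E].
have Ch1 : h1 \in coast.
  apply: coastP; [exact: Bphi|move=> E; apply: gh; by rewrite -fh1 E|exact: pn].
have Ch2 : h2 \in coast.
  apply: coastP; [by apply: (Bphi); apply: (Bphi)|move=> E; apply: gh; by rewrite -fh2 E|exact: p2n].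
have g12 : g2 <> g1 := @pn g1.
have h12 : h2 <> h1 := @pn h1.
have gneh x y : face x = face g -> face y = face (e g) -> x != y.
  by move=> fx fy; apply/eqP=> xy; apply: gh; rewrite -fx xy fy.
have coast4 d : d \in coast -> [\/ d = g1, d = g2, d = h1 | d = h2].
  suff <- : [set x in [:: g1; g2; h1; h2]] = coast.
    by rewrite !inE => /or4P[] /eqP; [constructor 1|constructor 2|constructor 3|constructor 4].
  apply/eqP; rewrite eqEcard card_rev EB4 cardsE; apply/andP; split.
    apply/subsetP=> x; rewrite in_set !in_cons in_nil orbF.
    by case/or4P=> /eqP->.
  have /card_uniqP-> // : uniq [:: g1; g2; h1; h2].
  rewrite /= !in_cons !in_nil !orbF !negb_or (gneh g1 h1) // (gneh g1 h2) //.
  rewrite (gneh g2 h1) // (gneh g2 h2) // !andbT.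
  by apply/andP; split; apply/eqP; apply: nesym.
have phi_g2 : phi g2 = g.
  have Bp : phi g2 \in B by do 3!apply: (Bphi).
  have fp : face (phi g2) = face g by rewrite face_face_perm.
  have [|Cp] := boolP (phi g2 \in inland).
    by case/inlandE=> // E; case: gh; rewrite -fp E.
  have {Cp} : phi g2 \in coast by move: Cp; rewrite in_set coastE Bp.
  case/coast4=> E; first by case: (@p2n g); apply: (@perm_inj _ phi).
  - by case: (@pn g2).
  - by case: gh; rewrite -fp E.
  - by case: gh; rewrite -fp E.
have phi_h2 : phi h2 = e g.
  have Bp : phi h2 \in B by do 3!apply: (Bphi).
  have fp : face (phi h2) = face (e g) by rewrite face_face_perm.
  have [|Cp] := boolP (phi h2 \in inland).
    by case/inlandE=> // E; case: gh; rewrite -fp E.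
  have {Cp} : phi h2 \in coast by move: Cp; rewrite in_set coastE Bp.
  case/coast4=> E; last by case: (@pn h2).
  - by case: gh; rewrite -fp E.
  - by case: gh; rewrite -fp E.
  - by case: (@p2n (e g)); apply: (@perm_inj _ phi).
(* [EB] runs around the quadrilateral in the order [p], [s], [r'], [q], and the diagonal [g] leads
   from [p] to [r']. *)
pose m1 := e h1; pose m2 := e h2; pose m3 := e g1; pose m4 := e g2.
pose p := start g; pose r' := target g; pose s := target g1; pose q := target h1.
have sm1 : start m1 = q by [].
have tm1 : target m1 = p by rewrite target_edge start_face_perm target_edge.
have sm2 : start m2 = r' by rewrite -[start m2]start_face_perm phi_h2.
have tm2 : target m2 = q by rewrite target_edge start_face_perm.
have sm3 : start m3 = s by [].
have tm3 : target m3 = r' by rewrite target_edge start_face_perm.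
have sm4 : start m4 = p by rewrite -[start m4]start_face_perm phi_g2.
have tm4 : target m4 = s by rewrite target_edge start_face_perm.
have inEB d : d \in coast -> e d \in EB by rewrite in_set.
have E1 : m1 \in EB := inEB _ Ch1.
have E2 : m2 \in EB := inEB _ Ch2.
have E3 : m3 \in EB := inEB _ Cg1.
have E4 : m4 \in EB := inEB _ Cg2.
have EBE d : d \in EB -> [\/ d = m1, d = m2, d = m3 | d = m4].
  rewrite -{1 2 3 4 5}[d](edgeK) => Ed; have /coast4 : e d \in coast by rewrite in_set.
  by case=> ->; [constructor 3|constructor 4|constructor 1|constructor 2].
have f34 : face m3 <> face m4.
  by move=> E; apply: g12; apply/esym/dual_simple2; rewrite ?fg1 ?fg2.
have f12 : face m1 <> face m2.
  by move=> E; apply: h12; apply/esym/dual_simple2; rewrite ?fh1 ?fh2.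
have XE v : v \in X -> [\/ v = p, v = q, v = r' | v = s].
  rewrite -startsEB => /imsetP[d /EBE[] -> ->].
  - by constructor 2. - by constructor 3. - by constructor 4. - by constructor 1.
have [w Iw] : exists w, w \in inner EA X.
  by apply/set0Pn; rewrite -card_gt0; have [_ _ _ _ [_ ->]] := extremal_counts.
have innerE d : d \in inner EA X -> d = w.
  move=> Id; have /eqP/cards1P[w' wE] : #|inner EA X| = 1.
    by have [_ _ _ _ [_ ->]] := extremal_counts.
  by move: Id Iw; rewrite wE !inE => /eqP-> /eqP->.
have [Ew Xsw Xtw] : [/\ w \in EA, start w \in X & target w \in X].
  by move: Iw; rewrite in_set => /and3P[].
have B_EA d : d \in B -> d \in EA -> False.
  by move=> Bd; rewrite in_set in_separator Bd andbF.
have nowB d : d \in B -> start w = start d -> target w = target d -> False.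
  by move=> Bd sd td; apply: (B_EA d) => //; rewrite -(simple sd td).
have nowE d : d \in EB -> start w = start d -> target w = target d -> False.
  by move=> Ed sd td; apply: (EA_EB Ew); rewrite (simple sd td).
(* The sides and the diagonal join every pair of corners except [q] and [s], so the extra inner dart
   joins these two. *)
have wqs : start w = q /\ target w = s \/ start w = s /\ target w = q.
  have sg1 : start g1 = r' by rewrite start_face_perm.
  have sg2 : start g2 = s by rewrite start_face_perm.
  have sh1 : start h1 = p by rewrite start_face_perm target_edge.
  have sh2 : start h2 = q by rewrite start_face_perm.
  have tg2 : target g2 = p := sm4.
  have th2 : target h2 = r' := sm2.
  have BC d : d \in coast -> d \in B by rewrite coastE => /andP[].
  case: (XE _ Xsw) (XE _ Xtw) => sw [] tw; try (by left); try (by right); exfalso;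
  first [ by apply: (@loopless w); rewrite sw tw
        | by apply: (nowB g); rewrite ?sw ?tw
        | by apply: (nowB (e g)); rewrite ?sw ?tw ?target_edge
        | by apply: (nowB g1); rewrite ?BC ?sw ?tw ?sg1
        | by apply: (nowB g2); rewrite ?BC ?sw ?tw ?sg2 ?tg2
        | by apply: (nowB h1); rewrite ?BC ?sw ?tw ?sh1
        | by apply: (nowB h2); rewrite ?BC ?sw ?tw ?sh2 ?th2
        | by apply: (nowE m1); rewrite ?sw ?tw ?sm1 ?tm1
        | by apply: (nowE m2); rewrite ?sw ?tw ?sm2 ?tm2
        | by apply: (nowE m3); rewrite ?sw ?tw ?sm3 ?tm3
        | by apply: (nowE m4); rewrite ?sw ?tw ?sm4 ?tm4 ].
have faces2 d : d \in EB -> face d = f1 \/ face d = f2 by move/EB_S/S2.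
have prev_w : exists2 y, phi y = w & y \in EB.
  exists ((phi^-1)%g w); first by rewrite permKV.
  set y := (phi^-1)%g w; have py : phi y = w by rewrite permKV.
  have [|Ey|//] := @S_rims y; first by rewrite -(separator_phi _ sAB) py EA_S.
  by case: (@EA_EB (phi y)); rewrite ?switchA ?py // -start_face_perm py.
have EBt y y' : y \in EB -> y' \in EB -> target y = target y' -> y = y'.
  move=> Ey Ey' ty; apply: (ins_uniq bB _ Ey' Ey (erefl _) ty) => a b Ea Eb sa sb.
  by apply: injEB; rewrite ?sa.
have Epw : phi w \in EB by apply: switchA.
have spw : start (phi w) = target w by rewrite start_face_perm.
have [y py Ey] := prev_w; have ty : target y = start w by rewrite -start_face_perm py.
(* The face along [w] contains the darts of [EB] just before and just after it. In one direction
   these are [m4] and [m1]; in the other they are [m2] and [m3], and then [m1] and [m4] share the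
   other of the two faces. *)
have f14 : face m1 = face m4.
  have fy : face y = face (phi w) by rewrite face_face_perm -py face_face_perm.
  case: wqs => -[sw tw].
    have ym : y = m2 by apply: EBt; rewrite ?ty ?sw.
    have pm : phi w = m3 by apply: injEB; rewrite ?spw ?tw.
    rewrite ym pm in fy; move: f12 f34.
    by case: (faces2 _ E1) (faces2 _ E2) (faces2 _ E3) (faces2 _ E4) =>
      [] -> [] e2 [] e3 [] -> //; rewrite ?e2 ?e3 // in fy *; rewrite ?fy.
  have ym : y = m4 by apply: EBt; rewrite ?ty ?sw ?tm4.
  have pm : phi w = m1 by apply: injEB; rewrite ?spw ?tw.
  by rewrite -pm -fy ym.
have pq : q <> p by rewrite -sm1 -tm1; apply: loopless.
have ps : p <> s by rewrite -sm4 -tm4; apply: loopless.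
(* After [m1] this face leaves the corners along [a1] and returns along [a2]. The next dart lies on
   [EB] in the same face and does not start at [p], so it is [m1] again; the face closes as a
   triangle that misses [m4]. *)
pose a1 := phi m1; pose a2 := phi a1.
have Ea1 : a1 \in EA by apply: switchB.
have sa1 : start a1 = p by rewrite start_face_perm.
have ta1 : target a1 \notin X.
  apply/negP=> Xa1; have /innerE a1w : a1 \in inner EA X.
    by rewrite in_set Ea1 Xa1 sa1 -sm4 -startsEB mem_starts.
  by case: wqs => -[sw _]; [apply: pq|apply: ps]; rewrite -sw -a1w sa1.
have sa2 : start a2 = target a1 by rewrite start_face_perm.
have Ea2 : a2 \in EA.
  have [|//|E] := @S_rims a2; first by rewrite separator_phi ?EA_S.
  by case/negP: ta1; rewrite -sa2 -startsEB mem_starts.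
have Xa2 : target a2 \in X.
  by have [/(_ _ Ea2) + _] := tightEA; rewrite sa2 (negPf ta1).
have ta2 : target a2 <> p.
  move=> ta2; have a21 : a2 = e a1 by apply: simple; rewrite ?target_edge ?sa1.
  by have := oA Ea1; rewrite -a21 Ea2.
have fa2 : face (phi a2) = face m1 by rewrite !face_face_perm.
have pa2 : phi a2 = m1.
  case/EBE: (switchA Ea2 Xa2) => // E.
  - by case: f12; rewrite -fa2 E.
  - by case: f34; rewrite -f14 -fa2 E.
  - by case: ta2; rewrite -start_face_perm E.
suff : [\/ m4 = m1, m4 = a1 | m4 = a2].
  case=> E; first by apply: pq; rewrite -sm1 -E.
    by apply: (EA_EB Ea1); rewrite -E.
  by apply: (EA_EB Ea2); rewrite -E.
apply: (@face_ind _ (fun x => [\/ x = m1, x = a1 | x = a2]) m1 m4) => //.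
  by move=> x _ [] ->; [constructor 2|constructor 3|constructor 1].
by constructor 1.
Qed.

End Extremal.

Lemma one_sided_bound : 12 <= #|S|.
Proof. by rewrite leqNgt; apply/negP=> S11; apply: extremal_false. Qed.

End OneSided.

(** * Rims of six darts are single cycles *)

Section Counting.
Variable G : embedding.
Local Notation D := (dart G).
Local Notation e := (edge G).
Implicit Types (d x y : D) (C E F : {set D}) (v : {set D}) (X Y : {set {set D}}).

Lemma card_outs E X : #|[set d in E | start d \in X]| = \sum_(v in X) #|outs E v|.
Proof.
rewrite -sum1_card (partition_big (@start G) (mem X)) /=; last first.
  by move=> d; rewrite in_set => /andP[].
apply: eq_bigr => v Xv; rewrite -sum1_card; apply: eq_bigl => d; rewrite !in_set.
by case: eqP => [->|]; rewrite ?Xv ?andbT ?andbF.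
Qed.

Lemma card_ins E X : #|[set d in E | target d \in X]| = \sum_(v in X) #|ins E v|.
Proof.
rewrite -sum1_card (partition_big (@target G) (mem X)) /=; last first.
  by move=> d; rewrite in_set => /andP[].
apply: eq_bigr => v Xv; rewrite -sum1_card; apply: eq_bigl => d; rewrite !in_set.
by case: eqP => [->|]; rewrite ?Xv ?andbT ?andbF.
Qed.

Lemma balanced_cut E X : balanced E ->
  #|[set d in E | start d \in X]| = #|[set d in E | target d \in X]|.
Proof. by move=> bE; rewrite card_outs card_ins; apply: eq_bigr => v _. Qed.

(** Summed over all vertices, outgoing and incoming darts both number [#|E|], so a single vertex
    cannot be out of balance. *)
Lemma balanced_except E v :
  (forall w, w <> v -> #|outs E w| = #|ins E w|) -> #|outs E v| = #|ins E v|.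
Proof.
move=> bE; have := card_outs E setT; have := card_ins E setT.
have -> : [set d in E | target d \in setT] = E by apply/setP=> d; rewrite !inE andbT.
have -> : [set d in E | start d \in setT] = E by apply/setP=> d; rewrite !inE andbT.
rewrite (bigD1 v (in_setT v)) => ->; rewrite (bigD1 v (in_setT v)) => /eqP.
rewrite (eq_bigr (fun w => #|outs E w|)); last by move=> w /andP[_ /eqP/bE].
by rewrite eqn_add2r => /eqP.
Qed.

Hypothesis G_simple : simple_graph G.

(* If [E] were not a single cycle, it would split into two triangles. *)
Lemma hexacycle3 E F X : balanced E -> balanced F -> oriented E -> oriented F ->
  (forall d, d \in E -> d \notin F /\ e d \notin F) ->
  X \subset starts E -> X \subset starts F ->
  #|E| = 6 -> #|F| = 3 -> #|X| = 3 -> simple_cycle E.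
Proof.
move=> bE bF oE oF EF XE XF E6 F3 X3.
(* [F] needs at least three inner darts, which use up all three pairs of vertices of [X]. Hence [E]
   alternates between [X] and its complement. *)
have zE : #|inner E X| = 0.
  have := inner_bound bE XE; have := inner_bound bF XF.
  have := pair_inner_bound G_simple X oE oF EF; rewrite E6 F3 X3; lia.
have [|touch inj] := inner_tight bE XE; first by rewrite zE E6 X3.
have one d : d \in E -> (start d \in X) = (target d \notin X).
  move=> Ed; have := touch _ Ed; case: (boolP (target d \in X)) => Xt; last by rewrite orbF.
  move=> _; apply/negP=> Xs; have : d \in inner E X by rewrite in_set Ed Xs.
  by rewrite (cards0_eq zE) inE.
split.
  move=> x y Ex Ey sxy; apply/eqP/negPn/negP=> /eqP xy.
  have [s [us ss vs sE]] := four_neighbours G_simple bE oE Ex Ey xy sxy (erefl _).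
  have [Xv|nXv] := boolP (start y \in X).
    by apply: xy; apply: inj; rewrite ?in_set ?Ex ?Ey ?sxy.
  have sX : {subset s <= X}.
    by move=> w /sE[d /one + [] [sd td]]; rewrite sd td (negPf nXv); case: (w \in X).
  have : size s <= #|X| by apply/card_geqP; exists s.
  by rewrite ss X3.
move=> C CE C0 bC; apply/eqP/negPn/negP=> /eqP CnE.
have := balanced_split G_simple bE oE CE C0 bC CnE; rewrite E6 => C3.
(* A balanced set that alternates in this way has even size, whereas the split would give size
   three. *)
have := balanced_cut X bC.
have : #|C| = #|[set d in C | start d \in X]| + #|[set d in C | target d \in X]|.
  rewrite -cardsU_disj.
    apply: eq_card => d; rewrite !in_set; case Cd: (d \in C) => //=.
    by rewrite (one _ (subsetP CE _ Cd)) orNb.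
  move=> d; rewrite !in_set => /andP[Cd]; rewrite (one _ (subsetP CE _ Cd)) Cd.
  by move/negP.
lia.
Qed.

(** At most one dart of [E] starts outside [X]. A vertex visited twice would put all six darts
    inside [X], where five of [F] lie as well: too many for ten pairs. Of two triangles, one would
    lie in [X] and occupy its three pairs, while [F] needs a dart on one of them. *)
Lemma hexacycle5 E F X : balanced E -> balanced F -> oriented E -> oriented F ->
  (forall d, d \in E -> d \notin F /\ e d \notin F) ->
  X \subset starts E -> X \subset starts F ->
  #|E| = 6 -> #|F| = 5 -> #|X| = 5 -> simple_cycle E.
Proof.
move=> bE bF oE oF EF XE XF E6 F5 X5.
pose P C := [set d in C | start d \in X]; pose N C := [set d in C | start d \notin X].
have PN C : #|C| = #|P C| + #|N C|.
  rewrite -cardsU_disj.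
    by apply: eq_card => d; rewrite !in_set; case: (d \in C); case: (start d \in X).
  by move=> d; rewrite !in_set => /andP[_ ->] /andP[].
have PX C : C \subset E -> X \subset starts C -> X \subset starts (P C).
  move=> CE /subsetP XC; apply/subsetP=> v Xv; have /imsetP[d Cd dv] := XC _ Xv.
  by apply/imsetP; exists d; rewrite // in_set Cd -dv.
have NE1 : #|N E| <= 1.
  have := leq_trans (subset_leq_card (PX _ (subxx E) XE)) (card_starts _).
  by have := PN E; rewrite E6 X5; lia.
have closed C : balanced C -> N C = set0 -> forall d, d \in C -> target d \in X.
  move=> bC NC0 d Cd.
  have allP : [set d in C | start d \in X] = C.
    apply/setP=> x; rewrite in_set; case Cx: (x \in C) => //=; apply/negPn/negP=> nX.
    by have : x \in N C; [rewrite in_set Cx|rewrite NC0 inE].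
  have /setP/(_ d) : [set d in C | target d \in X] = C.
    apply/eqP; rewrite eqEcard -balanced_cut // allP leqnn andbT.
    by apply/subsetP=> x; rewrite in_set => /andP[].
  by rewrite in_set Cd.
have inner_all C : C \subset E -> balanced C -> N C = set0 ->
    inner C (starts C) = C /\ starts C \subset X.
  move=> CE bC NC0; split.
    apply/setP=> d; rewrite in_set; case Cd: (d \in C) => //=.
    by rewrite mem_starts // target_starts.
  apply/subsetP=> _ /imsetP[d Cd ->]; apply/negPn/negP=> nX.
  by have : d \in N C; [rewrite in_set Cd|rewrite NC0 inE].
split.
  move=> x y Ex Ey sxy; apply/eqP/negPn/negP=> /eqP xy.
  have [Xv|nXv] := boolP (start y \in X); last first.
    have : 1 < #|N E|.
      apply/card_geqP; exists [:: x; y]; split=> //=; first by rewrite inE andbT; apply/eqP.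
      by move=> z; rewrite !inE => /orP[] /eqP->; rewrite ?Ex ?Ey ?sxy.
    by rewrite ltnNge NE1.
  have XEx : X \subset starts (P E :\ x).
    apply/subsetP=> v Xv'; have /imsetP[d Pd dv] := subsetP (PX _ (subxx E) XE) _ Xv'.
    apply/imsetP; have [dx|dx] := eqVneq d x; last by exists d; rewrite // in_setD1 dx.
    exists y; last by rewrite dv dx.
    by rewrite in_setD1 in_set Ey Xv !andbT; apply/eqP/nesym.
  have Px : x \in P E by rewrite in_set Ex sxy.
  have NE0 : N E = set0.
    apply/cards0_eq; have := PN E; have := cardsD1 x (P E); rewrite Px E6.
    by have := leq_trans (subset_leq_card XEx) (card_starts _); rewrite X5; lia.
  have [innE EX] := inner_all _ (subxx E) bE NE0.
  have XEs : starts E = X by apply/eqP; rewrite eqEsubset EX.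
  have := pair_inner_bound G_simple X oE oF EF; have := inner_bound bF XF.
  by rewrite XEs in innE; rewrite innE E6 F5 X5; lia.
move=> C CE C0 bC; apply/eqP/negPn/negP=> /eqP CnE.
have := balanced_split G_simple bE oE CE C0 bC CnE; rewrite E6 => C3.
have bD := balancedD CE bE bC.
suff triangle C' : C' \subset E -> balanced C' -> #|C'| = 3 -> N C' <> set0.
  have [NC0|[x Nx]] := set_0Vmem (N C); first by apply: (triangle C) => //; lia.
  have [NC0|[y Ny]] := set_0Vmem (N (E :\: C)).
    apply: (triangle (E :\: C)) => //; first exact: subsetDl.
    by rewrite cardsDS // E6; lia.
  have : 1 < #|N E|; last by rewrite ltnNge NE1.
  move: Nx Ny; rewrite !in_set => /andP[Cx sx] /andP[/andP[nCy Ey] sy].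
  apply/card_geqP; exists [:: x; y]; split=> //=.
    by rewrite inE andbT; apply: contraNneq nCy => <-.
  by move=> z; rewrite !inE => /orP[] /eqP->; rewrite ?sx ?sy ?Ey ?(subsetP CE _ Cx).
move=> C'E bC' C'3 NC0; have [innC CX] := inner_all _ C'E bC' NC0.
have oC' := orientedS C'E oE.
have C'0 : C' != set0 by rewrite -card_gt0 C'3.
have := starts_ge3 G_simple bC' oC' C'0; have := card_starts C'.
have := inner_bound bF (subset_trans CX XF).
have := pair_inner_bound G_simple (starts C') oC' oF (fun d Cd => EF d (subsetP C'E d Cd)).
rewrite innC C'3 F5; move: #|starts C'| => [|[|[|[|k]]]]; lia.
Qed.

End Counting.

(** The surviving values of [k] are odd, so parity will exclude them. Rims of six darts are listed
    apart because [simple_cycle_small] does not cover them. *)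
Lemma cut_counts c s a b t k : 1 <= c -> s = a + b + t -> s < min2f c -> c <= k ->
  k <= a -> k <= b -> 9 * k <= 2 * (a + b) + k * k -> 3 <= a -> 3 <= b ->
  t = 0 \/ t = 2 ->
  odd k /\ t <= 1 /\
  (a <= 5 /\ b <= 5 \/ a = 6 /\ b = 3 /\ k = 3 \/ b = 6 /\ a = 3 /\ k = 3 \/
   a = 6 /\ b = 5 /\ k = 5 \/ b = 6 /\ a = 5 /\ k = 5).
Proof.
rewrite /min2f; case: ifP => c2; [|case: ifP => c4];
  case: k => [|[|[|[|[|[|k]]]]]] *; try (exfalso; lia); split=> //; lia.
Qed.

Lemma link_counts c s a b k : 1 <= c -> s = a + b + 2 -> s < min2f c -> c <= k.+1 ->
  k < a -> k < b -> 3 <= a -> 3 <= b -> [/\ k = 2, a <= 5 & b <= 5].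
Proof.
rewrite /min2f; case: ifP => c2; [|case: ifP => c4] => *; split; lia.
Qed.

(** Here [n] is the size of a single separating face, and 3 is the least size of the neighbour that
    it doubly intersects. *)
Lemma face_counts c n a b k : 1 <= c -> n + 3 < min2f c -> a + b <= n ->
  k <= a -> k <= b -> 9 * k <= 2 * (a + b) + k * k -> 3 <= a -> 3 <= b ->
  2 * k < c /\ k <= 2.
Proof.
rewrite /min2f; case: ifP => c2; [|case: ifP => c4];
  case: k => [|[|[|[|[|[|k]]]]]] *; lia.
Qed.

(** * The bound for two separating faces *)

Section MinimalSeparations.
Variable G : embedding.
Local Notation D := (dart G).
Local Notation e := (edge G).
Local Notation r := (rotation G).
Local Notation phi := (face_perm G).
Implicit Types (d g x y z : D) (A B C E F S f : {set D}) (v : {set D}).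
Implicit Types (P W X Y : {set {set D}}).

Hypothesis G_simple : simple_graph G.
Hypothesis dual_simple : simple_graph (dual_map G).

Let loopless := simple_loopless G_simple.

Variable c : nat.
Hypothesis c_gt0 : 1 <= c.
Hypothesis G_connected : k_connected c G.

Lemma rim_S S A d : d \in rim S A -> d \in S.
Proof. by rewrite in_set => /andP[]. Qed.

Lemma two_face_bound A B f1 f2 :
  separation A B -> within (separator A B) f1 f2 ->
  #|[set face d | d in separator A B]| = 2 ->
  A != set0 -> B != set0 -> min2f c <= #|separator A B|.
Proof.
move=> sAB S2 S_faces A0 B0; have sBA := separation_sym sAB.
have min12 : min2f c <= 12 by rewrite /min2f; case: ifP => // _; case: ifP.
have [BA|/subsetPn[v vB vA]] := boolP (starts B \subset starts A).
  exact: leq_trans min12 (one_sided_bound G_simple dual_simple sAB S2 BA B0).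
have [AB|/subsetPn[w wA wB]] := boolP (starts A \subset starts B).
  apply: leq_trans min12 _; rewrite separatorC.
  by apply: (one_sided_bound G_simple dual_simple sBA _ AB A0); rewrite separatorC; apply: S2.
have [y By vy] := imsetP vB; have [x Ax wx] := imsetP wA.
have xP : start x \in starts A :\: starts B by rewrite in_setD -wx wB.
have yQ : start y \in starts B :\: starts A by rewrite in_setD -vy vA.
have link_or_cut := cut_bound G_simple dual_simple G_connected sAB S2 xP yQ.
have cardS := card_separator sAB.
have mixE := mixedE sAB; rewrite -/(mixed A B) in mixE.
set S := separator A B in S2 S_faces link_or_cut cardS mixE *.
set EA := rim S A in cardS mixE; set EB := rim S B in cardS mixE.
set X := mixed A B in link_or_cut mixE.
have bA : balanced EA by apply: rim_balanced.
have bB : balanced EB by rewrite /EB /S separatorC; apply: rim_balanced.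
have oA : oriented EA by apply: rim_oriented.
have oB : oriented EB by rewrite /EB /S separatorC; apply: rim_oriented.
have EAB d : d \in EA -> d \notin EB /\ e d \notin EB by apply: rim_rim.
have EBA d : d \in EB -> d \notin EA /\ e d \notin EA.
  by rewrite /EA /EB /S separatorC; apply: rim_rim.
have XA : X \subset starts EA by rewrite -mixE subsetIl.
have XB : X \subset starts EB by rewrite -mixE subsetIr.
have EA_A : starts EA \subset starts A by apply: starts_rim_left.
have EB_B : starts EB \subset starts B by rewrite /EB /S separatorC; apply: starts_rim_left.
have leXA := leq_trans (subset_leq_card XA) (card_starts EA).
have leXB := leq_trans (subset_leq_card XB) (card_starts EB).
have cross := crossing_bound G_simple bA bB oA oB EAB XA XB.
have ties_card : ties S = set0 \/ #|ties S| = 2.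
  case: (ties_cases dual_simple S2) => [|[g _ ->]]; first by left.
  by right; rewrite cards2 eq_sym edge_neq.
(* A vertex has at most one place of each kind: on [EA], on [EB], on the tie. All three together
   would make an end of the tie mixed, so two places remain at most. *)
have cycle_parity : simple_cycle EA -> simple_cycle EB ->
    EA != set0 -> EB != set0 ->
    (forall g, g \in ties S -> start g \notin X) ->
    odd #|X| = (ties S != set0).
  move=> cA cB EA0 EB0 tX; rewrite -mixE; apply: (euler_parity G_simple dual_simple sAB) S_faces _ => //.
    exact: S2.
  have tie_start g h : g \in ties S -> h \in ties S -> start g = start h -> g = h.
    move=> Tg Th gh; case: (tie_uniq dual_simple S2 Tg Th) => // hg.
    by case: (@loopless g); rewrite gh hg.
  have [iA _] := cA; have [iB _] := cB.
  have kind d : d \in S -> [\/ d \in EA, d \in EB | d \in ties S].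
    move=> Sd; have [eS|eS] := boolP (e d \in S); first by constructor 3; rewrite in_set Sd.
    by have [] := mem_rim sAB Sd eS; [constructor 1|constructor 2].
  have no3 a b t : a \in EA -> b \in EB -> t \in ties S -> start t = start a ->
      start t = start b -> False.
    move=> Ea Eb Tt ta tb; case/negP: (tX _ Tt).
    by rewrite -mixE in_setI {1}ta tb !mem_starts.
  move=> a b d Sa Sb Sd ab ad; have bd : start b = start d by rewrite -ab.
  case: (kind _ Sa) (kind _ Sb) (kind _ Sd) => Ka [] Kb [] Kd;
    first [ by constructor 1; apply: iA | by constructor 1; apply: iB
          | by constructor 1; apply: tie_start
          | by constructor 2; apply: iA | by constructor 2; apply: iB
          | by constructor 2; apply: tie_start
          | by constructor 3; apply: iA | by constructor 3; apply: iB
          | by constructor 3; apply: tie_start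
          | exfalso; first [ by apply: (no3 a b d) | by apply: (no3 a d b)
          | by apply: (no3 b a d) | by apply: (no3 b d a)
          | by apply: (no3 d a b) | by apply: (no3 d b a) ] ].
rewrite leqNgt; apply/negP=> ltS.
case: link_or_cut => [cX|[g [Tg gP gQ cX]]].
  have EA0 : EA != set0.
    by rewrite -card_gt0; apply: leq_trans leXA; apply: leq_trans c_gt0 cX.
  have EB0 : EB != set0.
    by rewrite -card_gt0; apply: leq_trans leXB; apply: leq_trans c_gt0 cX.
  have geA := balanced_ge3 G_simple bA oA EA0; have geB := balanced_ge3 G_simple bB oB EB0.
  have [kodd [tle EE]] : odd #|X| /\ #|ties S| <= 1 /\
     (#|EA| <= 5 /\ #|EB| <= 5 \/ #|EA| = 6 /\ #|EB| = 3 /\ #|X| = 3 \/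
      #|EB| = 6 /\ #|EA| = 3 /\ #|X| = 3 \/
      #|EA| = 6 /\ #|EB| = 5 /\ #|X| = 5 \/ #|EB| = 6 /\ #|EA| = 5 /\ #|X| = 5).
    have tie1 : #|ties S| = 0 \/ #|ties S| = 2.
      by case: ties_card => ->; [left; rewrite cards0|right].
    exact: cut_counts c_gt0 cardS ltS cX leXA leXB cross geA geB tie1.
  have T0 : ties S = set0 by case: ties_card => // T2; rewrite T2 in tle.
  have cA : simple_cycle EA.
    case: EE => [[a5 _]|[[a6 [b3 k3]]|[[b6 [a3 k3]]|[[a6 [b5 k5]]|[b6 [a5 k5]]]]]].
    - exact: simple_cycle_small.
    - exact: (hexacycle3 G_simple bA bB oA oB EAB XA XB).
    - by apply: simple_cycle_small; rewrite ?a3.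
    - exact: (hexacycle5 G_simple bA bB oA oB EAB XA XB).
    - by apply: simple_cycle_small; rewrite ?a5.
  have cB : simple_cycle EB.
    case: EE => [[_ b5]|[[a6 [b3 k3]]|[[b6 [a3 k3]]|[[a6 [b5 k5]]|[b6 [a5 k5]]]]]].
    - exact: simple_cycle_small.
    - by apply: simple_cycle_small; rewrite ?b3.
    - exact: (hexacycle3 G_simple bB bA oB oA EBA XB XA).
    - by apply: simple_cycle_small; rewrite ?b5.
    - exact: (hexacycle5 G_simple bB bA oB oA EBA XB XA).
  have tX h : h \in ties S -> start h \notin X by rewrite T0 inE.
  by have := cycle_parity cA cB EA0 EB0 tX; rewrite kodd T0 eqxx.
have sgX : start g \notin X.
  by move: gP; rewrite in_setD in_setI => /andP[/negPf-> _]; rewrite andbF.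
have tgX : target g \notin X.
  by move: gQ; rewrite in_setD in_setI => /andP[/negPf-> _].
have [Sg Seg] : g \in S /\ e g \in S by move: Tg; rewrite in_set => /andP[].
(* The ends of the link lie on the rims without being mixed, so each rim has a vertex outside [X];
   this makes both size bounds strict. *)
have gEA : start g \in starts EA.
  move: gP Sg; rewrite in_setD in_separator => /andP[_ /imsetP[d Ad gd]] /andP[nAg _].
  by rewrite gd; apply: (starts_rim sAB Ad nAg).
have gEB : target g \in starts EB.
  move: gQ Seg; rewrite in_setD in_separator => /andP[_ /imsetP[d Bd gd]] /andP[_ nBg].
  by rewrite gd /EB /S separatorC; apply: (starts_rim sBA Bd nBg).
have XA1 : #|X| < #|EA|.
  apply: leq_trans (card_starts EA); apply/proper_card/properP; split=> //.
  by exists (start g).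
have XB1 : #|X| < #|EB|.
  apply: leq_trans (card_starts EB); apply/proper_card/properP; split=> //.
  by exists (target g).
have EA0 : EA != set0 by rewrite -card_gt0; apply: leq_ltn_trans XA1.
have EB0 : EB != set0 by rewrite -card_gt0; apply: leq_ltn_trans XB1.
have geA := balanced_ge3 G_simple bA oA EA0; have geB := balanced_ge3 G_simple bB oB EB0.
have T0 : ties S != set0 by apply/set0Pn; exists g.
have T2 : #|ties S| = 2 by case: ties_card => // E; rewrite E eqxx in T0.
have [k2 a5 b5] : [/\ #|X| = 2, #|EA| <= 5 & #|EB| <= 5].
  by rewrite T2 in cardS; apply: link_counts c_gt0 cardS ltS cX XA1 XB1 geA geB.
have cA := simple_cycle_small G_simple bA oA a5.
have cB := simple_cycle_small G_simple bB oB b5.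
have tX h : h \in ties S -> start h \notin X.
  by move=> Th; case: (tie_uniq dual_simple S2 Tg Th) => ->.
by have := cycle_parity cA cB EA0 EB0 tX; rewrite k2 T0.
Qed.

End MinimalSeparations.

(** * Separating faces without double intersection *)

Section ThreeConnected.
Variable G : embedding.
Local Notation D := (dart G).
Local Notation e := (edge G).
Local Notation r := (rotation G).
Local Notation phi := (face_perm G).
Implicit Types (d g x y z : D) (A B C E F S f : {set D}) (v : {set D}).
Implicit Types (P W X Y : {set {set D}}).

Hypothesis G_simple : simple_graph G.
Hypothesis dual_simple : simple_graph (dual_map G).

Let dual_loopless := dual_simple_loopless dual_simple.

Variable c : nat.
Hypothesis c_gt0 : 1 <= c.
Hypothesis G_connected : k_connected c G.
Hypothesis small_faces : forall f f' : {set D},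
  doubly_intersecting f f' -> #|f| + #|f'| < min2f c.

Lemma mem_face x y : (x \in face y) = (face x == face y).
Proof. by rewrite eq_porbit_mem. Qed.

Lemma face_in_faces x : face x \in faces G.
Proof. exact: imset_f. Qed.

Lemma face_ge3 x : 3 <= #|face x|.
Proof.
apply/card_geqP; exists [:: x; phi x; phi (phi x)]; split=> //=; last first.
  by move=> y; rewrite !inE => /or3P[] /eqP->; rewrite mem_face ?face_face_perm.
rewrite !inE negb_or !andbT; apply/andP; split; first (apply/andP; split);
  apply/eqP/nesym.
- exact: face_perm_neq.
- exact: face_perm2_neq.
- exact: face_perm_neq.
Qed.

Definition face_rim E f := [set d in E | face d == f].

Section SeparateFaces.
Variables A B f1 f2 : {set D}.
Hypothesis sAB : separation A B.
Local Notation S := (separator A B).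
Local Notation EA := (rim S A).
Local Notation EB := (rim S B).
Local Notation X := (mixed A B).
Hypothesis S2 : within S f1 f2.
Hypotheses (A0 : A != set0) (B0 : B != set0).
Hypothesis fullA : forall x, x \in S -> exists2 y, y \in EA & face y = face x.
Hypothesis fullB : forall x, x \in S -> exists2 y, y \in EB & face y = face x.
Hypothesis no_ties : ties S = set0.
Hypothesis face_balancedA : forall x, x \in S -> balanced (face_rim EA (face x)).
Hypothesis face_balancedB : forall x, x \in S -> balanced (face_rim EB (face x)).
Hypothesis mixed_face : forall x y, x \in S -> y \in S -> start x = start y ->
  start x \in X -> face x = face y.

Let sBA : separation B A := separation_sym sAB.
Let oA : oriented EA := @rim_oriented _ A B.
Let oB : oriented EB. Proof. by rewrite separatorC; apply: rim_oriented. Qed.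
Let mixE : starts EA :&: starts EB = X := mixedE sAB.
Let frS E f : face_rim E f \subset E.
Proof. by apply/subsetP=> d; rewrite in_set => /andP[]. Qed.

Let X_EA v : v \in X -> exists2 d, d \in EA & start d = v.
Proof. by rewrite -mixE in_setI => /andP[/imsetP[d Ed ->] _]; exists d. Qed.
Let X_EB v : v \in X -> exists2 d, d \in EB & start d = v.
Proof. by rewrite -mixE in_setI => /andP[_ /imsetP[d Ed ->]]; exists d. Qed.

Let rims_disjoint d : d \in EA -> d \in EB -> False.
Proof. by move/(rim_rim sAB)=> [/negP]. Qed.

Let kind d : d \in S -> d \in EA \/ d \in EB.
Proof.
move=> Sd; apply: (mem_rim sAB Sd); apply/negP=> eS.
by have : d \in ties S; [rewrite in_set Sd|rewrite no_ties inE].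
Qed.

(** The face has darts on both rims and no ties, so its walk must pass from [EA] to [EB]
    somewhere. *)
Lemma face_switch x : x \in S -> exists y, [/\ y \in EA, phi y \in EB & face y = face x].
Proof.
move=> Sx; have [y Ey yx] := fullA Sx; have [z Ez zx] := fullB Sx.
have [/existsP[w /and3P[Ew Epw /eqP wx]]|no] :=
  boolP [exists w, [&& w \in EA, phi w \in EB & face w == face x]]; first by exists w.
exfalso; apply: (@rims_disjoint z) => //.
apply: (@face_ind _ (fun w => w \in EA) y z) => //; last by rewrite zx yx.
move=> w wy Ew; have [|//|Epw] := @kind (phi w); first by rewrite separator_phi ?(rim_S Ew).
by case/existsP: no; exists w; rewrite Ew Epw wy yx eqxx.
Qed.

(** The vertex of a switch is mixed, and by [mixed_face] its darts on both rims belong to this face.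
    The face thus visits a vertex of its neighbour [face (e y)] twice, and that neighbour has size
    at least three. *)
Lemma separate_face_le x : x \in S -> #|face x| + 3 < min2f c.
Proof.
move=> Sx; have [y [Ey Epy yx]] := face_switch Sx.
set v := start (phi y); have vt : v = target y by rewrite /v start_face_perm.
have eyA : e y \in A by move: Ey; rewrite in_set => /andP[].
have vX : v \in X.
  rewrite in_setI vt mem_starts //= -vt.
  apply: (subsetP (starts_rim_left sBA)).
  by rewrite separatorC; apply: mem_starts.
have [a Ea sa] := X_EA vX; have [b Eb sb] := X_EB vX.
have fa : face a = face x.
  rewrite -yx -(face_face_perm y); apply: mixed_face; rewrite ?sa //; first exact: rim_S Ea.
  exact: rim_S Epy.
have fb : face b = face x.
  rewrite -yx -(face_face_perm y); apply: mixed_face; rewrite ?sb //; first exact: rim_S Eb.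
  exact: rim_S Epy.
have := @small_faces (face x) (face (e y)).
suff : doubly_intersecting (face x) (face (e y)).
  move=> DI /(_ DI); apply: leq_ltn_trans.
  by rewrite leq_add2l face_ge3.
split; [exact: face_in_faces|exact: face_in_faces| |left].
  by rewrite -yx; apply: dual_loopless.
apply/card_geqP; exists [:: a; b]; split=> //=.
  by rewrite inE andbT; apply/eqP=> ab; apply: (rims_disjoint Ea); rewrite ab.
have vf : v \in face_vertices (face (e y)) by rewrite vt; apply: (imset_f (@start G)); rewrite mem_face.
by move=> d; rewrite !inE => /orP[] /eqP->; rewrite mem_face ?fa ?fb ?sa ?sb vf ?yx eqxx.
Qed.

Definition face_mixed f := starts (face_rim EA f) :&: starts (face_rim EB f).

Lemma card_face_rims f x : face x = f ->
  #|face_rim EA f| + #|face_rim EB f| <= #|face x|.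
Proof.
move=> fx; rewrite -cardsU_disj.
  apply/subset_leq_card/subsetP=> d; rewrite in_setU !(in_set (fun _ => _ && _)).
  by rewrite mem_face fx => /orP[] /andP[_ ->].
by move=> d /(subsetP (frS _ _)) Ed /(subsetP (frS _ _)); apply: rims_disjoint.
Qed.

Let frA x : x \in S -> [/\ balanced (face_rim EA (face x)),
  oriented (face_rim EA (face x)) & face_rim EA (face x) != set0].
Proof.
move=> Sx; split; [exact: face_balancedA|exact: orientedS (frS _ _) oA|].
by have [y Ey yx] := fullA Sx; apply/set0Pn; exists y; rewrite in_set Ey yx eqxx.
Qed.

Let frB x : x \in S -> [/\ balanced (face_rim EB (face x)),
  oriented (face_rim EB (face x)) & face_rim EB (face x) != set0].
Proof.
move=> Sx; split; [exact: face_balancedB|exact: orientedS (frS _ _) oB|].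
by have [y Ey yx] := fullB Sx; apply/set0Pn; exists y; rewrite in_set Ey yx eqxx.
Qed.

Lemma face_mixed_bound x : x \in S -> 2 * #|face_mixed (face x)| < c /\ #|face_mixed (face x)| <= 2.
Proof.
move=> Sx; have [bA' oA' A0'] := frA Sx; have [bB' oB' B0'] := frB Sx.
have := separate_face_le Sx; have := card_face_rims (erefl (face x)).
have geA := balanced_ge3 G_simple bA' oA' A0'; have geB := balanced_ge3 G_simple bB' oB' B0'.
have sA : face_mixed (face x) \subset starts (face_rim EA (face x)) by apply: subsetIl.
have sB : face_mixed (face x) \subset starts (face_rim EB (face x)) by apply: subsetIr.
have := leq_trans (subset_leq_card sA) (card_starts _).
have := leq_trans (subset_leq_card sB) (card_starts _).
have AB d : d \in face_rim EA (face x) ->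
    d \notin face_rim EB (face x) /\ e d \notin face_rim EB (face x).
  move=> /(subsetP (frS _ _)) /(rim_rim sAB)[n1 n2].
  by split; [apply: contra n1|apply: contra n2] => /(subsetP (frS _ _)).
have := crossing_bound G_simple bA' bB' oA' oB' AB sA sB.
by move=> cross leB leA sum le; apply: face_counts c_gt0 le sum leA leB cross geA geB.
Qed.

Lemma mixed_sub : X \subset face_mixed f1 :|: face_mixed f2.
Proof.
apply/subsetP=> v Xv; have [a Ea sa] := X_EA Xv; have [b Eb sb] := X_EB Xv.
have ab : face a = face b.
  by apply: mixed_face; rewrite ?sa ?sb // ?(rim_S Ea) ?(rim_S Eb).
have vf : v \in face_mixed (face a).
  by rewrite in_setI -{1}sa -sb !mem_starts // in_set ?Ea ?Eb ?ab eqxx.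
by rewrite in_setU; case: (S2 (rim_S Ea)) => <-; rewrite vf ?orbT.
Qed.

(** Together the faces have fewer than [c] mixed vertices, too few for a cut. Each side has a vertex
    of its own, because the rim of one face has at least three vertices, at most two of them
    mixed. *)
Lemma separate_faces_false : False.
Proof.
have Xc : #|X| < c.
  apply: leq_ltn_trans (subset_leq_card mixed_sub) _.
  apply: leq_ltn_trans (leq_card_setU _ _) _.
  have bound f : 2 * #|face_mixed f| < c.
    have [[x Sx xf]|nof] : (exists2 x, x \in S & face x = f) \/ face_mixed f = set0.
      have [|[v]] := set_0Vmem (face_mixed f); first by right.
      rewrite in_setI => /andP[/imsetP[d + _] _]; rewrite in_set => /andP[Ed /eqP df].
      by left; exists d => //; apply: rim_S Ed.
    by rewrite -xf; case: (face_mixed_bound Sx).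
    by rewrite nof cards0.
  by move: (bound f1) (bound f2); move: #|_| #|_| => m n *; lia.
have [xP yP] : (exists x, start x \in starts A :\: starts B) /\
               (exists y, start y \in starts B :\: starts A).
  have [S0|[x Sx]] := set_0Vmem S.
    have [a Aa] := set0Pn _ A0; have [b Bb] := set0Pn _ B0.
    have X0 v : v \notin X.
      by apply/negP=> /X_EA[d /rim_S]; rewrite S0 inE.
    split; [exists a; rewrite in_setD (mem_starts Aa)|exists b; rewrite in_setD (mem_starts Bb)]; rewrite andbT.
      by apply: contra (X0 (start a)) => Ba; rewrite in_setI Ba mem_starts.
    by apply: contra (X0 (start b)) => Ab; rewrite in_setI Ab mem_starts.
  have [_ Xx] := face_mixed_bound Sx.
  have [bA' oA' A0'] := frA Sx; have [bB' oB' B0'] := frB Sx.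
  have gA := starts_ge3 G_simple bA' oA' A0'; have gB := starts_ge3 G_simple bB' oB' B0'.
  have nA : ~~ (starts (face_rim EA (face x)) \subset face_mixed (face x)).
    by apply/negP=> /subset_leq_card; rewrite leqNgt; case/negP; apply: leq_ltn_trans Xx _.
  have nB : ~~ (starts (face_rim EB (face x)) \subset face_mixed (face x)).
    by apply/negP=> /subset_leq_card; rewrite leqNgt; case/negP; apply: leq_ltn_trans Xx _.
  have [_ /imsetP[a frEa ->] aX] := subsetPn nA; have [_ /imsetP[b frEb ->] bX] := subsetPn nB.
  have Ea := subsetP (frS _ _) _ frEa; have Eb := subsetP (frS _ _) _ frEb.
  have fa : face a = face x by move: frEa; rewrite in_set => /andP[_ /eqP].
  have fb : face b = face x by move: frEb; rewrite in_set => /andP[_ /eqP].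
  have aA : start a \in starts A by apply: (subsetP (starts_rim_left sAB)); apply: mem_starts.
  have bB : start b \in starts B.
    by apply: (subsetP (starts_rim_left sBA)); rewrite separatorC; apply: mem_starts.
  split; [exists a|exists b]; rewrite in_setD ?aA ?bB andbT.
    apply: contra aX => aB; have aX : start a \in X by rewrite in_setI aA.
    rewrite in_setI mem_starts //=; have [d Ed sd] := X_EB aX.
    rewrite -sd mem_starts // in_set Ed /= -fa.
    by apply/eqP/mixed_face; rewrite ?sd ?(rim_S Ed) ?(rim_S Ea).
  apply: contra bX => bA; have bX : start b \in X by rewrite in_setI bB bA.
  rewrite in_setI andbC mem_starts //=; have [d Ed sd] := X_EA bX.
  rewrite -sd mem_starts // in_set Ed /= -fb.
  by apply/eqP/mixed_face; rewrite ?sd ?(rim_S Ed) ?(rim_S Eb).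
have [[x xP'] [y yP']] := (xP, yP).
have [|[g [Tg _ _ _]]] := cut_bound G_simple dual_simple G_connected sAB S2 xP' yP'.
  by rewrite leqNgt Xc.
by rewrite no_ties inE in Tg.
Qed.

End SeparateFaces.

End ThreeConnected.

Section NoSeparation.
Variable G : embedding.
Local Notation D := (dart G).
Local Notation e := (edge G).
Local Notation r := (rotation G).
Local Notation phi := (face_perm G).
Implicit Types (d g x y z : D) (A B C E F S f : {set D}) (v : {set D}).
Implicit Types (P W X Y : {set {set D}}).

Hypothesis G_simple : simple_graph G.
Hypothesis dual_simple : simple_graph (dual_map G).

Let dual_loopless := dual_simple_loopless dual_simple.

Section SharedPlaces.
Variables (A B f1 f2 : {set D}).
Hypothesis sAB : separation A B.
Local Notation S := (separator A B).
Hypothesis S2 : within S f1 f2.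
Hypothesis one_place : forall x y, x \in S -> y \in S -> face x = face y ->
  (exists2 x', x' \in S & start x' = start x /\ face x' <> face x) ->
  (exists2 y', y' \in S & start y' = start y /\ face y' <> face y) -> x = y.

Let sBA : separation B A := separation_sym sAB.

(** Both ends of a tie are shared by the two faces, which gives two shared places on one of them. *)
Lemma separate_ties : ties S = set0.
Proof.
apply/setP=> g; rewrite in_set0; apply/negP; rewrite in_set => /andP[Sg Seg].
apply: (@face_perm_neq _ G_simple g); apply: one_place; rewrite ?separator_phi //.
- by rewrite face_face_perm.
- exists (e g) => //; rewrite start_face_perm; split=> // E.
  by apply: (@dual_loopless g); rewrite E face_face_perm.
- exists (phi (e g)); first by rewrite separator_phi.
  by rewrite start_face_perm target_edge face_face_perm; split=> //; apply: nesym.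
Qed.

Lemma in_face_rim d E f : (d \in face_rim E f) = (d \in E) && (face d == f).
Proof. by rewrite in_set. Qed.

Lemma in_outs d E v : (d \in outs E v) = (d \in E) && (start d == v).
Proof. by rewrite in_set. Qed.

Lemma in_ins d E v : (d \in ins E v) = (d \in E) && (target d == v).
Proof. by rewrite in_set. Qed.

(** At a vertex not shared with the other separating face, the separator darts belong all or none to
    this face, so balance is inherited from the whole rim. At most one shared vertex is left, and
    [balanced_except] settles it. *)
Lemma separate_balanced x : x \in S -> balanced (face_rim (rim S A) (face x)).
Proof.
set E := rim S A => Sx; pose f := face x.
have bE : balanced E := rim_balanced sAB.
have ES d : d \in E -> d \in S by apply: rim_S.
pose shared v := [exists d, [exists d', [&& (d \in S) && (d' \in S), start d == v,
  start d' == v, face d == f & face d' != f]]].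
have local v : ~~ shared v -> #|outs (face_rim E f) v| = #|ins (face_rim E f) v|.
  move=> nsh; have [[d Sd [dv df]]|nod] :
      (exists2 d, d \in S & start d = v /\ face d = f) \/
      (forall d, d \in S -> start d = v -> face d <> f).
    have [/existsP[d /and3P[Sd /eqP dv /eqP df]]|/existsPn no] :=
      boolP [exists d, [&& d \in S, start d == v & face d == f]]; first by left; exists d.
    by right=> d Sd dv df; have := no d; rewrite Sd dv df !eqxx.
    have all_f d' : d' \in S -> start d' = v -> face d' = f.
      move=> Sd' d'v; apply/eqP/negPn/negP=> d'f; case/negP: nsh.
      by apply/existsP; exists d; apply/existsP; exists d'; rewrite Sd Sd' dv d'v df d'f !eqxx.
    have -> : outs (face_rim E f) v = outs E v.
      apply/setP=> y; rewrite !in_outs in_face_rim.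
      case Ey: (y \in E) => //=; case: (start y =P v) => // yv; rewrite ?andbF // andbT.
      by apply/eqP/all_f => //; apply: ES.
    have -> : ins (face_rim E f) v = ins E v.
      apply/setP=> y; rewrite !in_ins in_face_rim.
      case Ey: (y \in E) => //=; case: (target y =P v) => // yv; rewrite ?andbF // andbT.
      apply/eqP; rewrite -(face_face_perm y); apply: all_f; rewrite ?start_face_perm //.
      by rewrite separator_phi ?ES.
    exact: bE.
  have -> : outs (face_rim E f) v = set0.
    apply/setP=> y; rewrite in_outs in_face_rim in_set0; apply/negP.
    case/andP=> /andP[Ey /eqP yf] /eqP yv; exact: (nod y (ES _ Ey) yv yf).
  have -> // : ins (face_rim E f) v = set0.
  apply/setP=> y; rewrite in_ins in_face_rim in_set0; apply/negP.
  case/andP=> /andP[Ey /eqP yf] /eqP yv; apply: (nod (phi y)).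
  - by rewrite separator_phi ?ES.
  - by rewrite start_face_perm.
  - by rewrite face_face_perm.
have sharedP v : shared v -> exists2 d, d \in S & [/\ start d = v, face d = f &
    exists2 d', d' \in S & start d' = start d /\ face d' <> face d].
  case/existsP=> d /existsP[d' /and5P[/andP[Sd Sd'] /eqP dv /eqP d'v /eqP df /eqP d'f]].
  by exists d => //; split=> //; exists d'; rewrite // dv df.
move=> v; have [/sharedP[d Sd [dv df d']]|/local//] := boolP (shared v).
apply: balanced_except => w wv; apply: local; apply/negP=> /sharedP[y Sy [yw yf y']].
by apply: wv; rewrite -yw -dv; congr start; apply: one_place => //; rewrite yf df.
Qed.

(** Otherwise [x] and [y] are the only separator darts at their vertex. The face of [x] then enters
    and leaves it along the rim of [A], and [single_sector] allows no corner [y]. *)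
Lemma separate_mixed x y : x \in rim S A -> y \in rim S B -> start x = start y ->
  face x = face y.
Proof.
set EA := rim S A => Ex Ey xy; apply/eqP/negPn/negP=> /eqP fxy.
have bA : balanced EA := rim_balanced sAB.
have Sx := rim_S Ex; have Sy := rim_S Ey.
have place z : z \in S -> start z = start x -> z = x \/ z = y.
  move=> Sz zx.
  have [zfx|zfy] : face z = face x \/ face z = face y.
    case: (S2 Sx) (S2 Sy) (S2 Sz) fxy => -> [] -> [] ->; try (by left); try (by right);
      by move=> [].
    left; apply: one_place => //; first by exists y; rewrite // zx zfx; split=> //; apply: nesym.
    by exists y => //; split=> //; apply: nesym.
  right; apply: one_place => //; first by exists x; rewrite // zx zfy.
  by exists x.
have notB z : z \in EA -> z \in rim S B -> False by move/(rim_rim sAB)=> [/negP].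
have Efx : x \in face_rim EA (face x) by rewrite in_set Ex eqxx.
have [w + wx] := balanced_prev (separate_balanced Sx) Efx.
rewrite in_set => /andP[Ew /eqP wf].
have Sw := rim_S Ew.
have pw : phi w = x.
  have [||//|E] := place (phi w); rewrite ?separator_phi ?start_face_perm //.
  by case: fxy; rewrite -E face_face_perm wf.
have uniq_w w' : w' \in EA -> target w' = target w -> w' = w.
  move=> Ew' tw; apply: (ins_uniq bA _ Ew Ew' (erefl _) tw) => a b Ea Eb sa sb.
  have one z : z \in EA -> start z = target w -> z = x.
    move=> Ez zw; have [||//|E] := place z; rewrite ?(rim_S Ez) ?zw //.
    by case: (notB z); rewrite // E.
  by rewrite (one a) // (one b).
have [|Ay|yw] := @single_sector _ A B w y sAB Ew _ uniq_w (etrans (esym xy) (esym wx)).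
- by rewrite pw.
- by have := Sy; rewrite in_separator Ay.
- by apply: fxy; rewrite yw pw.
Qed.

End SharedPlaces.

Variable c : nat.
Hypothesis c_gt0 : 1 <= c.
Hypothesis G_connected : k_connected c G.
Hypothesis small_faces : forall f f' : {set D},
  doubly_intersecting f f' -> #|f| + #|f'| < min2f c.

Definition separator_faces A B := [set face d | d in separator A B].

Lemma one_place_of_not_DI A B f1 f2 : separation A B -> within (separator A B) f1 f2 ->
  f1 \in separator_faces A B -> f2 \in separator_faces A B -> f1 <> f2 ->
  ~ (2 <= occurrences f1 f2 \/ 2 <= occurrences f2 f1) ->
  forall x y, x \in separator A B -> y \in separator A B -> face x = face y ->
  (exists2 x', x' \in separator A B & start x' = start x /\ face x' <> face x) ->
  (exists2 y', y' \in separator A B & start y' = start y /\ face y' <> face y) -> x = y.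
Proof.
move=> sAB S2 F1 F2 f12 nDI x y Sx Sy fxy [x' Sx' [sx fx]] [y' Sy' [sy fy]].
apply/eqP/negPn/negP=> xy; apply: nDI.
have occ : 2 <= occurrences (face x) (face x').
  have fyx : face y' = face x'.
    rewrite -fxy in fy; case: (S2 _ Sx) (S2 _ Sx') (S2 _ Sy') fx fy => -> [] -> [] -> //;
      by move=> H1 H2; first [case: H1 | case: H2].
  apply/card_geqP; exists [:: x; y]; split=> //=; first by rewrite inE andbT.
  have vx : start x \in face_vertices (face x').
    by rewrite -sx; apply: (imset_f (@start G)); rewrite mem_face.
  have vy : start y \in face_vertices (face x').
    by rewrite -sy; apply: (imset_f (@start G)); rewrite mem_face fyx.
  by move=> z; rewrite !in_cons in_nil orbF in_set => /orP[] /eqP->;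
    rewrite mem_face ?vx ?vy ?fxy eqxx.
case: (S2 _ Sx) (S2 _ Sx') occ fx => -> [] -> occ fx; by [left|right|case: fx].
Qed.

End NoSeparation.

(** * From separations to 3-connectivity of the dual *)

Section DualConnectivity.
Variable G : embedding.
Local Notation D := (dart G).
Local Notation e := (edge G).
Local Notation r := (rotation G).
Local Notation phi := (face_perm G).
Implicit Types (d g x y z : D) (A B C E F S f : {set D}) (v : {set D}).
Implicit Types (P W X Y : {set {set D}}).

Lemma sep_face A B x y : separation A B -> face x = face y -> (x \in A) = (y \in A).
Proof.
move=> sAB xy.
apply: (@face_ind _ (fun z => (z \in A) = (y \in A)) y x) => // z _.
by rewrite (sep_left sAB).
Qed.

(** Reduces a separation to a minimal one, in which every separating face borders both sides. *)
Lemma absorb_face A B x : separation A B -> x \in separator A B ->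
  (forall y, face y = face x -> e y \notin B) ->
  separation (A :|: face x) B /\
  #|separator_faces (A :|: face x) B| < #|separator_faces A B|.
Proof.
move=> sAB Sx xB; have sBA := separation_sym sAB.
have /andP[xA xB'] : (x \notin A) && (x \notin B) by rewrite -in_separator.
split.
  split=> [d|d|d|d].
  - by rewrite !in_setU (sep_left sAB) !mem_face face_face_perm.
  - exact: sep_right sAB d.
  - rewrite in_setU mem_face => /orP[/(sep_disjoint sAB) //|/eqP dx].
    by rewrite (sep_face sBA dx).
  - by rewrite in_setU mem_face => /orP[/(sep_edge sAB) //|/eqP/xB].
apply/proper_card/properP; split.
  apply: imsetS; apply/subsetP=> d; rewrite !in_separator in_setU negb_or.
  by case/andP=> /andP[-> _] ->.
exists (face x); first exact: imset_f.
apply/imsetP=> -[d + xd]; rewrite in_separator in_setU mem_face xd eqxx.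
by rewrite orbT.
Qed.

Hypothesis G_simple : simple_graph G.
Hypothesis dual_simple : simple_graph (dual_map G).

Let dual_loopless := dual_simple_loopless dual_simple.
Let dual_simple2 := dual_simple_parallel dual_simple.

Variable c : nat.
Hypothesis c_gt0 : 1 <= c.
Hypothesis G_connected : k_connected c G.
Hypothesis small_faces : forall f f' : {set D},
  doubly_intersecting f f' -> #|f| + #|f'| < min2f c.

Lemma no_full_separation A B : separation A B ->
  #|separator_faces A B| <= 2 -> A != set0 -> B != set0 ->
  (forall x, x \in separator A B -> exists2 y, y \in rim (separator A B) A & face y = face x) ->
  (forall x, x \in separator A B -> exists2 y, y \in rim (separator A B) B & face y = face x) ->
  False.
Proof.
move=> sAB F2 A0 B0 fullA fullB; have sBA := separation_sym sAB.
have SF d : d \in separator A B -> face d \in separator_faces A B by move=> Sd; apply: imset_f.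
(* Either shared places are so rare that the faces can be counted one by one, or the separator
   consists of two doubly intersecting faces and the bound on their sum applies. *)
suff [[f1 [f2 [S2 place]]]|[f1 [f2 [S2 F1 F2' F12]]]] :
   (exists f1 f2, within (separator A B) f1 f2 /\
     forall x y, x \in separator A B -> y \in separator A B -> face x = face y ->
     (exists2 x', x' \in separator A B & start x' = start x /\ face x' <> face x) ->
     (exists2 y', y' \in separator A B & start y' = start y /\ face y' <> face y) ->
     x = y) \/
   (exists f1 f2, [/\ within (separator A B) f1 f2, #|separator_faces A B| = 2,
      doubly_intersecting f1 f2 & separator A B = f1 :|: f2]).
- have placeC := place; have S2C := S2; rewrite separatorC in placeC S2C.
  have mixed_face x y : x \in separator A B -> y \in separator A B ->
      start x = start y -> start x \in mixed A B -> face x = face y.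
    move=> Sx Sy xy; rewrite -[mixed A B](mixedE sAB) in_setI => /andP[/imsetP[a Ea xa] /imsetP[b Eb xb]].
    have T0 := separate_ties G_simple dual_simple sAB place.
    have kind z : z \in separator A B -> start z = start x ->
        face z = face a \/ face z = face b.
      move=> Sz zx; have [|Ez|Ez] := @mem_rim _ A B z sAB Sz.
      - by apply/negP=> eS; have : z \in ties (separator A B);
          [rewrite in_set Sz|rewrite T0 inE].
      - by right; apply: (separate_mixed sAB S2 place Ez Eb); rewrite zx.
      - by left; apply/esym/(separate_mixed sAB S2 place Ea Ez); rewrite zx.
    have ab := separate_mixed sAB S2 place Ea Eb (etrans (esym xa) xb).
    by case: (kind _ Sx (erefl _)) (kind _ Sy (esym xy)) => -> [] ->; rewrite ?ab.
  apply: (separate_faces_false G_simple dual_simple c_gt0 G_connected small_faces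
    sAB S2 A0 B0 fullA fullB _ _ _ mixed_face).
  + exact: (separate_ties G_simple dual_simple sAB place).
  + by move=> x Sx; apply: (separate_balanced sAB place Sx).
  + move=> x; rewrite separatorC => Sx.
    exact: (separate_balanced sBA placeC Sx).
- have := two_face_bound G_simple dual_simple c_gt0 G_connected sAB S2 F1 A0 B0.
  rewrite F12 leqNgt => /negP; apply; apply: leq_ltn_trans (small_faces F2').
  exact: leq_card_setU.
have [c2|c2] := eqVneq #|separator_faces A B| 2; last first.
  left; have F1 x y : x \in separator A B -> y \in separator A B -> face x = face y.
    move=> /SF Fx /SF Fy; have /card_le1_eqP eqF : #|separator_faces A B| <= 1.
      by rewrite -ltnS ltn_neqAle c2.
    exact: eqF.
  have [S0|[x Sx]] := set_0Vmem (separator A B).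
    exists set0, set0; split=> [d|x y]; by rewrite S0 inE.
  exists (face x), (face x); split=> [d Sd|y z Sy Sz _ [y' Sy' [_ fy]]].
    by left; apply: F1.
  by case: fy; apply: F1.
have /eqP/cards2P[f1 [f2 [f12 FE]]] := c2.
have Ff1 : f1 \in separator_faces A B by rewrite FE set21.
have Ff2 : f2 \in separator_faces A B by rewrite FE set22.
have S2 : within (separator A B) f1 f2.
  by move=> d /SF; rewrite FE => /set2P.
have [DI|nDI] := boolP ((2 <= occurrences f1 f2) || (2 <= occurrences f2 f1)); last first.
  left; exists f1, f2; split=> //.
  apply: (one_place_of_not_DI sAB S2 Ff1 Ff2); first exact/eqP.
  by move=> h; case/negP: nDI; apply/orP.
right; exists f1, f2.
have [d1 Sd1 fd1] := imsetP Ff1; have [d2 Sd2 fd2] := imsetP Ff2.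
split=> //.
  split; rewrite ?fd1 ?fd2 ?face_in_faces //; rewrite -?fd1 -?fd2; first exact/eqP.
  exact/orP.
apply/setP=> d; rewrite in_setU fd1 fd2 !mem_face -fd1 -fd2.
apply/idP/orP=> [/S2[] ->|]; rewrite ?eqxx; [by left|by right|].
have closed x : x \in separator A B -> face d = face x -> d \in separator A B.
  by rewrite !in_separator => + dx; rewrite (sep_face sAB dx) (sep_face sBA dx).
by case=> /eqP; [rewrite fd1; apply: closed|rewrite fd2; apply: closed].
Qed.

Lemma no_separation A B : separation A B ->
  #|separator_faces A B| <= 2 -> A != set0 -> B != set0 -> False.
Proof.
have [n] := ubnP #|separator_faces A B|; elim: n A B => // n IHn A B.
rewrite ltnS => leFn sAB F2 A0 B0; have sBA := separation_sym sAB.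
have separator_facesC : separator_faces B A = separator_faces A B.
  by rewrite /separator_faces separatorC.
have [fullA|] := boolP [forall x, (x \in separator A B) ==>
    [exists y, (y \in rim (separator A B) A) && (face y == face x)]]; last first.
  case/forallPn=> x; rewrite negb_imply => /andP[Sx /existsPn no].
  have Sx' : x \in separator B A by rewrite separatorC.
  have [|sep' lt] := absorb_face sBA Sx'.
    move=> y yx; apply: contra (no y) => Ay; rewrite in_set Ay yx eqxx !andbT.
    move: Sx; rewrite !in_separator.
    by rewrite (sep_face sAB (esym yx)) (sep_face sBA (esym yx)).
  rewrite separator_facesC in lt.
  apply: (IHn _ A _ sep') => //; first exact: leq_trans lt leFn.
    exact: leq_trans (ltnW lt) F2.
  by have [b Bb] := set0Pn _ B0; apply/set0Pn; exists b; rewrite in_setU Bb.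
have [fullB|] := boolP [forall x, (x \in separator A B) ==>
    [exists y, (y \in rim (separator A B) B) && (face y == face x)]]; last first.
  case/forallPn=> x; rewrite negb_imply => /andP[Sx /existsPn no].
  have [|sep' lt] := absorb_face sAB Sx.
    move=> y yx; apply: contra (no y) => By; rewrite in_set By yx eqxx !andbT.
    move: Sx; rewrite !in_separator.
    by rewrite (sep_face sAB (esym yx)) (sep_face sBA (esym yx)).
  apply: (IHn _ B _ sep') => //; first exact: leq_trans lt leFn.
    exact: leq_trans (ltnW lt) F2.
  by have [a Aa] := set0Pn _ A0; apply/set0Pn; exists a; rewrite in_setU Aa.
apply: (no_full_separation sAB F2 A0 B0) => x Sx.
  have /existsP[y /andP[Ey /eqP yx]] := implyP (forallP fullA x) Sx; by exists y.
have /existsP[y /andP[Ey /eqP yx]] := implyP (forallP fullB x) Sx; by exists y.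
Qed.

(** A face and its neighbours across three consecutive edges are distinct, as the dual is simple. *)
Lemma card_dual_vertices : 3 < #|vertices (dual_map G)|.
Proof.
have [x _] : exists x : D, x \in setT.
  have [ltV _] := G_connected; have : 0 < #|vertices G| by apply: leq_ltn_trans ltV.
  by rewrite card_gt0 => /set0Pn[_ /imsetP[x _ _]]; exists x; rewrite inE.
have p1 := face_perm_neq G_simple; have p2 := face_perm2_neq G_simple dual_simple.
have fp d : face (phi d) = face d := face_face_perm d.
apply/card_geqP.
exists [:: face x; face (e x); face (e (phi x)); face (e (phi (phi x)))]; split=> //.
  rewrite /= !inE !negb_or !andbT -!andbA; apply/and5P; split; first exact/eqP.
  - by apply/eqP; rewrite -(fp x).
  - by apply/eqP; rewrite -(fp x) -(fp (phi x)).
  - by apply/eqP=> E; apply/(p1 x)/esym/dual_simple2; rewrite ?fp.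
  apply/andP; split.
  - by apply/eqP=> E; apply/(p2 x)/esym/dual_simple2; rewrite ?fp.
  - by apply/eqP=> E; apply/(p1 (phi x))/esym/dual_simple2; rewrite ?fp.
by move=> v; rewrite !inE => /or4P[] /eqP->; apply: (imset_f (porbit phi)).
Qed.

Lemma dual_three_connected : k_connected 3 (dual_map G).
Proof.
split=> [|j W]; first exact: card_dual_vertices.
rewrite ltnS => j2 [/subsetP WV Wj [u [v [uV vV nuv]]]].
have [uW /imsetP[x _ ux]] : u \notin W /\ u \in vertices (dual_map G) by case/setDP: uV.
have [vW /imsetP[y _ vy]] : v \notin W /\ v \in vertices (dual_map G) by case/setDP: vV.
pose R := connect (@adjacent_off (dual_map G) W) u.
(* The faces reachable from [u] off [W] against all other faces off [W]. *)
pose A : {set D} := [set d | (@face G d \notin W) && R (@face G d)].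
pose B : {set D} := [set d | (@face G d \notin W) && ~~ R (@face G d)].
have sAB : separation A B.
  split=> [d|d|d|d]; rewrite !in_set ?face_face_perm //.
    by case/andP=> -> ->.
  case/andP=> dW Rd; apply/negP=> /andP[eW /negP]; apply.
  apply: connect_trans Rd (connect1 _); rewrite /adjacent_off [X in [&& X, _ & _]]dW.
  rewrite [X in [&& _, X & _]]eW /=; apply/existsP; exists d.
  by rewrite /target /start /= !eqxx.
apply: (no_separation sAB).
- apply: leq_trans j2; rewrite -Wj; apply/subset_leq_card/subsetP=> f.
  case/imsetP=> d + ->; rewrite in_separator !in_set.
  by case: (@face G d \in W) => //=; case: (R _).
- apply/set0Pn; exists x; rewrite in_set.
  by rewrite /R /face -[porbit _ x]ux uW connect0.
- apply/set0Pn; exists y; rewrite in_set /R /face -[porbit _ y]vy.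
  by rewrite vW nuv.
Qed.

End DualConnectivity.

(** * Extremal maps *)

Section Labels.
Variables (G : embedding) (L : finType) (l : dart G -> L).
Local Notation e := (edge G).
Hypothesis startE : forall d d' : dart G, start d = start d' <-> l d = l d'.

Lemma label_simple :
  (forall d, l d <> l (e d)) ->
  (forall d d', l d = l d' -> l (e d) = l (e d') -> d = d') -> simple_graph G.
Proof.
by move=> loopless simple; split=> [d /startE /loopless|d d' /startE sd /startE td] //;
  apply: simple.
Qed.

Definition label_off (W : {set L}) : rel L :=
  fun a b => [&& a \notin W, b \notin W & [exists d, (l d == a) && (l (e d) == b)]].

Lemma label_k_connected c :
  (forall a, exists d, l d = a) -> c < #|L| ->
  (forall W : {set L}, #|W| < c -> forall a b, a \notin W -> b \notin W ->
     connect (label_off W) a b) ->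
  k_connected c G.
Proof.
move=> onto cL conn; split.
  have -> : #|vertices G| = #|(@start G) @: setT|.
    by apply: eq_card => v; apply/imsetP/imsetP=> -[d _ ->]; exists d.
  rewrite (card_imset_ker startE); apply: leq_trans cL _.
  rewrite -cardsT; apply/subset_leq_card/subsetP=> a _.
  by have [d <-] := onto a; apply: imset_f.
move=> j S jc [SV Sj [u [v [uV vV /negP]]]]; apply.
have /setDP[/imsetP[x _ ux] uS] := uV; have /setDP[/imsetP[y _ vy] vS] := vV.
have {}ux : u = start x := ux; have {}vy : v = start y := vy.
subst u v.
pose W : {set L} := [set a | [exists d, (l d == a) && (start d \in S)]].
have memW d : (l d \in W) = (start d \in S).
  rewrite in_set; apply/existsP/idP=> [[d' /andP[/eqP/startE <-]]|] //.
  by exists d; rewrite eqxx.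
have leW : #|W| <= #|S|.
  pose h a := odflt set0 [pick w in S | [exists d, (l d == a) && (start d == w)]].
  have hP d : start d \in S -> h (l d) = start d.
    move=> Sd; rewrite /h; case: pickP => [w /andP[_ /existsP[d' /andP[/eqP/startE <- /eqP]]]|no] //.
    by have := no (start d); rewrite Sd /= => /existsP[]; exists d; rewrite !eqxx.
  have inj : {in W &, injective h}.
    move=> a b; rewrite !in_set => /existsP[d /andP[/eqP <- Sd]] /existsP[d' /andP[/eqP <- Sd']].
    by rewrite !hP // => /startE.
  rewrite -(card_in_imset inj); apply/subset_leq_card/subsetP=> _ /imsetP[a + ->].
  by rewrite in_set => /existsP[d /andP[/eqP <- Sd]]; rewrite hP.
have Wc : #|W| < c by apply: leq_ltn_trans leW _; rewrite Sj.
have := conn W Wc (l x) (l y); rewrite !memW => /(_ uS vS) /connectP[p].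
elim: p x {uV uS} => [|a p IHp] x /=.
  by move=> _ /startE ->.
case/andP=> /and3P[xW aW /existsP[d /andP[/eqP dx /eqP da]]] pa lastp.
move: pa lastp aW; rewrite -da memW => pa lastp aW.
apply: connect_trans (IHp _ pa lastp); apply: connect1.
rewrite /adjacent_off -memW xW aW /=; apply/existsP; exists d.
by rewrite eqxx andbT; apply/eqP/startE.
Qed.

End Labels.

Lemma k_connected_connected c G : 1 <= c -> k_connected c G -> connected_graph G.
Proof.
move=> c1 [_ nocut] u v uV vV; apply/negPn/negP=> nuv.
apply: (nocut 0 set0 c1); split; rewrite ?cards0 ?sub0set //.
exists u, v; rewrite !setD0; split=> //; apply: contra nuv => /connectP[p pu ->].
apply/connectP; exists p => //; apply: sub_path pu => a b.
by rewrite /adjacent_off => /and3P[].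
Qed.

Section DualCriteria.
Variables (G : embedding) (L : finType) (l : dart G -> L).
Local Notation e := (edge G).
Local Notation r := (rotation G).
Local Notation phi := (face_perm G).

Lemma label_start : (forall d, l (r d) = l d) ->
  (forall d d', l d = l d' -> d' \in porbit r d) ->
  forall d d' : dart G, start d = start d' <-> l d = l d'.
Proof.
move=> lr lt d d'; split=> [dd'|/lt].
  by apply: (start_ind (P := fun z => l z = l d') (x := d')) => // z _; rewrite lr.
by rewrite -eq_porbit_mem => /eqP.
Qed.

Lemma separation_cut (A B f1 f2 : {set dart G}) : separation A B ->
  A != set0 -> B != set0 -> f1 \in faces G -> f2 \in faces G -> f1 <> f2 ->
  separator A B = f1 :|: f2 ->
  is_cut 2 ([set f1; f2] : {set {set dart (dual_map G)}}).
Proof.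
move=> sAB /set0Pn[a Aa] /set0Pn[b Bb] F1 F2 f12 SE; have sBA := separation_sym sAB.
have memS x : face x \in [set f1; f2] -> x \in separator A B.
  by case/set2P=> E; rewrite SE in_setU -E mem_face eqxx ?orbT.
have inS x : x \in separator A B -> face x \in [set f1; f2].
  have [[d1 _ Ed1] [d2 _ Ed2]] := (imsetP F1, imsetP F2).
  rewrite SE in_setU Ed1 Ed2 !mem_face in_set2.
  by case/orP=> /eqP->; rewrite eqxx ?orbT.
split.
- by apply/subsetP=> f /set2P[] ->.
- by rewrite cards2; move/eqP: f12 => ->.
have vertexS x : x \notin separator A B ->
    face x \in vertices (dual_map G) :\: ([set f1; f2] : {set {set dart (dual_map G)}}).
  by move=> nSx; rewrite in_setD; apply/andP; split; [apply: contra nSx; apply: memS|apply: face_in_faces].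
exists (face a), (face b); split.
- by apply: vertexS; rewrite in_separator Aa.
- by apply: vertexS; rewrite in_separator Bb andbF.
apply/negP=> /connectP[p].
have : exists2 x, x \in A & face x = face a by exists a.
elim: p (face a) => [|f p IHp] f0 [x Ax <-] /=.
  by move=> _ /esym /(sep_face sAB) bA; move: (sep_disjoint sBA Bb); rewrite -bA Ax.
case/andP=> /and3P[_ fS /existsP[d /andP[/eqP dx /eqP df]]]; apply: IHp.
have {}dx : @face G d = @face G x := dx; have {}df : @face G (e d) = f := df.
have Ad : d \in A by rewrite (sep_face sAB dx).
exists (e d) => //; apply: contraNT fS => Aed; rewrite -df.
exact/inS/(edge_sep sAB).
Qed.

(** Two darts of a triangle are consecutive. If their edges also shared the opposite face, that face
    would pass their common vertex only once, and the vertex would have degree two. *)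
Lemma dual_simple_criterion : simple_graph G ->
  (forall d : dart G, r (r d) <> d) ->
  (forall d d' : dart G, face d = face d' -> start d = start d' -> d = d') ->
  (forall d : dart G, phi (phi (phi d)) = d \/ phi (phi (phi (e d))) = e d) ->
  simple_graph (dual_map G).
Proof.
move=> [loopless simple] deg3 once tri.
have next d d' : d' = phi d -> face (e d) = face (e d') -> False.
  move=> d'E ee; have E : phi (e d') = e d.
    apply: once; first by rewrite face_face_perm ee.
    by rewrite start_face_perm target_edge d'E start_face_perm.
  by apply: (deg3 d'); rewrite [r d']rotationE E rotationE edgeK d'E.
have tri_face d d' : phi (phi (phi d)) = d -> face d' = face d ->
    [\/ d' = d, d' = phi d | d = phi d'].
  move=> td; apply: (face_ind (P := fun z => [\/ z = d, z = phi d | d = phi z])).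
    by move=> z _ [->|->|<-]; [constructor 2|constructor 3; rewrite td|constructor 1].
  by constructor 1.
split=> [d dd|d d' ff ee].
  have E : phi d = e d.
    by apply: once; [rewrite face_face_perm|rewrite start_face_perm].
  by apply: (deg3 (e d)); rewrite ![r (e d)]rotationE edgeK E rotationE edgeK E.
have {}ff : @face G d = @face G d' := ff.
have {}ee : @face G (e d) = @face G (e d') := ee.
case: (tri d) => [td|ted].
  have [//|E|E] := tri_face d d' td (esym ff); first by case: (next d d').
  by case: (next d' d).
have [/perm_inj//|E|E] := tri_face _ _ ted (esym ee).
  by case: (next (e d) (e d')); rewrite ?edgeK.
by case: (next (e d') (e d)); rewrite ?edgeK.
Qed.

End DualCriteria.

Lemma fpath_porbit (T : finType) (s : {perm T}) x p :
  fpath s x p -> {subset x :: p <= porbit s x}.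
Proof.
elim: p x => [|a p IHp] x /=; first by move=> _ y; rewrite inE => /eqP->; apply: porbit_id.
case/andP=> /eqP<- /IHp sub y; rewrite inE => /predU1P[->|/sub]; first exact: porbit_id.
by have := porbit_perm s 1 x; rewrite expg1 => ->.
Qed.

Lemma porbit_fcycle (T : finType) (s : {perm T}) c x :
  fcycle s c -> x \in c -> porbit s x = [set y in c].
Proof.
case: c => // h c cyc xc; have := cyc; rewrite /= => /fpath_porbit sub.
have subc : {subset h :: c <= porbit s h}.
  by move=> y yc; apply: sub; rewrite inE mem_rcons yc orbT.
have /eqP-> : porbit s x == porbit s h by rewrite eq_porbit_mem subc.
apply/setP=> y; rewrite in_set; apply/idP/idP; last exact: subc.
apply: (porbit_closed (P := fun z => z \in h :: c)); last exact: mem_head.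
by move=> z zc; have /eqP-> := next_cycle cyc zc; rewrite mem_next.
Qed.

(** * Turning over a quadrilateral in a triangulation *)

Section Flip.
Variables (M : embedding) (L : finType) (l : dart M -> L).
Local Notation D := (dart M).
Local Notation e := (edge M).
Local Notation r := (rotation M).
Local Notation phi := (face_perm M).

Hypothesis l_loopless : forall d, l d <> l (e d).
Hypothesis l_simple : forall d d', l d = l d' -> l (e d) = l (e d') -> d = d'.
Hypothesis l_rotation : forall d, l (r d) = l d.
Hypothesis l_orbit : forall d d', l d = l d' -> d' \in porbit r d.
Hypothesis phi3 : forall d, phi (phi (phi d)) = d.
Hypothesis r2 : forall d, r (r d) <> d.

Variables g a1 a2 a3 a4 b1 b2 b3 b4 c1 c2 c3 c4 : D.
Hypotheses (phi_g : phi g = a1) (phi_a1 : phi a1 = a2) (phi_a2 : phi a2 = g).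
Hypotheses (phi_eg : phi (e g) = a3) (phi_a3 : phi a3 = a4) (phi_a4 : phi a4 = e g).
Hypotheses (phi_ea1 : phi (e a1) = b1) (phi_b1 : phi b1 = c1) (phi_c1 : phi c1 = e a1).
Hypotheses (phi_ea2 : phi (e a2) = b2) (phi_b2 : phi b2 = c2) (phi_c2 : phi c2 = e a2).
Hypotheses (phi_ea3 : phi (e a3) = b3) (phi_b3 : phi b3 = c3) (phi_c3 : phi c3 = e a3).
Hypotheses (phi_ea4 : phi (e a4) = b4) (phi_b4 : phi b4 = c4) (phi_c4 : phi c4 = e a4).

Let us := [:: l g; l a1; l a2; l a4; l c1; l c2; l c3; l c4].
Hypothesis us_uniq : uniq us.

Let l_phi d : l (phi d) = l (e d). Proof. by rewrite face_permE l_rotation. Qed.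

(** The named darts are told apart by the positions of their ends among the eight distinct vertices
    [us], which turns their disequalities into computations. *)
Let code d := (index (l d) us, index (l (e d)) us).

Let idx (i : 'I_8) : index (nth (l g) us i) us = i.
Proof. by rewrite index_uniq. Qed.

Let i0 : index (l g) us = 0. Proof. exact: (idx (@Ordinal 8 0 isT)). Qed.
Let i1 : index (l a1) us = 1. Proof. exact: (idx (@Ordinal 8 1 isT)). Qed.
Let i2 : index (l a2) us = 2. Proof. exact: (idx (@Ordinal 8 2 isT)). Qed.
Let i3 : index (l a4) us = 3. Proof. exact: (idx (@Ordinal 8 3 isT)). Qed.
Let i4 : index (l c1) us = 4. Proof. exact: (idx (@Ordinal 8 4 isT)). Qed.
Let i5 : index (l c2) us = 5. Proof. exact: (idx (@Ordinal 8 5 isT)). Qed.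
Let i6 : index (l c3) us = 6. Proof. exact: (idx (@Ordinal 8 6 isT)). Qed.
Let i7 : index (l c4) us = 7. Proof. exact: (idx (@Ordinal 8 7 isT)). Qed.

Let leg : l (e g) = l a1. Proof. by rewrite -l_phi phi_g. Qed.
Let lea1 : l (e a1) = l a2. Proof. by rewrite -l_phi phi_a1. Qed.
Let lea2 : l (e a2) = l g. Proof. by rewrite -l_phi phi_a2. Qed.
Let la3 : l a3 = l g. Proof. by rewrite -phi_eg l_phi edgeK. Qed.
Let lea3 : l (e a3) = l a4. Proof. by rewrite -l_phi phi_a3. Qed.
Let lea4 : l (e a4) = l a1. Proof. by rewrite -l_phi phi_a4. Qed.
Let lb1 : l b1 = l a1. Proof. by rewrite -phi_ea1 l_phi edgeK. Qed.
Let lb2 : l b2 = l a2. Proof. by rewrite -phi_ea2 l_phi edgeK. Qed.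
Let lb3 : l b3 = l g. Proof. by rewrite -phi_ea3 l_phi edgeK. Qed.
Let lb4 : l b4 = l a4. Proof. by rewrite -phi_ea4 l_phi edgeK. Qed.
Let leb1 : l (e b1) = l c1. Proof. by rewrite -l_phi phi_b1. Qed.
Let leb2 : l (e b2) = l c2. Proof. by rewrite -l_phi phi_b2. Qed.
Let leb3 : l (e b3) = l c3. Proof. by rewrite -l_phi phi_b3. Qed.
Let leb4 : l (e b4) = l c4. Proof. by rewrite -l_phi phi_b4. Qed.
Let lec1 : l (e c1) = l a2. Proof. by rewrite -l_phi phi_c1. Qed.
Let lec2 : l (e c2) = l g. Proof. by rewrite -l_phi phi_c2. Qed.
Let lec3 : l (e c3) = l a4. Proof. by rewrite -l_phi phi_c3. Qed.
Let lec4 : l (e c4) = l a1. Proof. by rewrite -l_phi phi_c4. Qed.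

Let lE := (leg, lea1, lea2, la3, lea3, lea4, lb1, lb2, lb3, lb4, leb1, leb2, leb3, leb4,
           lec1, lec2, lec3, lec4).
Let iE := (i0, i1, i2, i3, i4, i5, i6, i7).

Let code_neq x y : code x != code y -> x != y.
Proof. by apply: contraNneq => ->. Qed.

Ltac by_code := by apply: code_neq; rewrite /code ?edgeK ?lE ?iE.

(* Turns over the quadrilateral formed by the two triangles along [g]. The graph
   does not change, and the four triangles around the quadrilateral merge with
   its sides into two hexagonal faces. *)
Definition flip : {perm D} :=
  (tperm a1 (e a4) * tperm a2 (e a1) * tperm a3 (e a2) * tperm a4 (e a3))%g.

Let lt x y d : l x = l y -> l (tperm x y d) = l d.
Proof. by move=> xy; case: tpermP => // ->; rewrite xy. Qed.

Let l_flip d : l (flip d) = l d.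
Proof. by rewrite !permM !lt ?lE. Qed.

Let flip_a1 : flip a1 = e a4.
Proof. by rewrite !permM tpermL !tpermD //; by_code. Qed.
Let flip_ea4 : flip (e a4) = a1.
Proof. by rewrite !permM tpermR !tpermD //; by_code. Qed.
Let flip_a2 : flip a2 = e a1.
Proof. by rewrite !permM (@tpermD _ a1) ?tpermL ?tpermD //; by_code. Qed.
Let flip_ea1 : flip (e a1) = a2.
Proof. by rewrite !permM (@tpermD _ a1) ?tpermR ?tpermD //; by_code. Qed.
Let flip_a3 : flip a3 = e a2.
Proof. by rewrite !permM (@tpermD _ a1) ?(@tpermD _ a2) ?tpermL ?tpermD //; by_code. Qed.
Let flip_ea2 : flip (e a2) = a3.
Proof. by rewrite !permM (@tpermD _ a1) ?(@tpermD _ a2) ?tpermR ?tpermD //; by_code. Qed.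
Let flip_a4 : flip a4 = e a3.
Proof. by rewrite !permM (@tpermD _ a1) ?(@tpermD _ a2) ?(@tpermD _ a3) ?tpermL //; by_code. Qed.
Let flip_ea3 : flip (e a3) = a4.
Proof. by rewrite !permM (@tpermD _ a1) ?(@tpermD _ a2) ?(@tpermD _ a3) ?tpermR //; by_code. Qed.

Definition flipped : embedding :=
  @Embedding D e (rotation M ^ flip)%g (@edgeK M) (@edge_neq M).

Local Notation psi := (face_perm flipped).

(** The rotation is conjugated by [flip]: a face step goes back through [flip], makes one old
    rotation step, and goes forward through [flip] again. *)
Let psi_step d x z w : flip x = e d -> phi (e x) = z -> flip z = w -> psi d = w.
Proof.
move=> xd <- <-; rewrite face_permE /= -xd conjgE [LHS]permM permK [LHS]permM.
by rewrite rotationE.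
Qed.

Let eight := [:: a1; a2; a3; a4; e a1; e a2; e a3; e a4].

Let flip_fix d : d \notin eight -> flip d = d.
Proof.
rewrite !inE !negb_or => /and4P[n1 n2 n3 /and5P[n4 n5 n6 n7 n8]].
by rewrite !permM !tpermD // eq_sym.
Qed.

Ltac by_fix := by apply: flip_fix; rewrite !inE !negb_or; do ?[apply/andP; split]; by_code.

Let psi_g : psi g = e a4.
Proof. by apply: (psi_step (x := e g)) flip_a1; [by_fix|rewrite edgeK]. Qed.
Let psi_ea4 : psi (e a4) = e a3.
Proof. by apply: (psi_step (x := e a3)) flip_a4; rewrite ?edgeK. Qed.
Let psi_ea3 : psi (e a3) = g.
Proof. by apply: (psi_step (x := e a2) (z := g)); rewrite ?edgeK ?flip_ea2 //; by_fix. Qed.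
Let psi_eg : psi (e g) = e a2.
Proof. by apply: (psi_step (x := g)) flip_a3; rewrite ?edgeK //; by_fix. Qed.
Let psi_ea2 : psi (e a2) = e a1.
Proof. by apply: (psi_step (x := e a1)) flip_a2; rewrite ?edgeK. Qed.
Let psi_ea1 : psi (e a1) = e g.
Proof. by apply: (psi_step (x := e a4) (z := e g)); rewrite ?edgeK ?flip_ea4 //; by_fix. Qed.
Let psi_a1 : psi a1 = b2.
Proof. by apply: (psi_step (x := a2) (z := b2)); rewrite ?flip_a2 //; by_fix. Qed.
Let psi_b2 : psi b2 = c2.
Proof. by apply: (psi_step (x := e b2) (z := c2)); rewrite ?edgeK //; by_fix. Qed.
Let psi_c2 : psi c2 = a3.
Proof. by apply: (psi_step (x := e c2)) flip_ea2; rewrite ?edgeK //; by_fix. Qed.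
Let psi_a3 : psi a3 = b4.
Proof. by apply: (psi_step (x := a4) (z := b4)); rewrite ?flip_a4 //; by_fix. Qed.
Let psi_b4 : psi b4 = c4.
Proof. by apply: (psi_step (x := e b4) (z := c4)); rewrite ?edgeK //; by_fix. Qed.
Let psi_c4 : psi c4 = a1.
Proof. by apply: (psi_step (x := e c4)) flip_ea4; rewrite ?edgeK //; by_fix. Qed.
Let psi_a2 : psi a2 = b3.
Proof. by apply: (psi_step (x := a3) (z := b3)); rewrite ?flip_a3 //; by_fix. Qed.
Let psi_b3 : psi b3 = c3.
Proof. by apply: (psi_step (x := e b3) (z := c3)); rewrite ?edgeK //; by_fix. Qed.
Let psi_c3 : psi c3 = a4.
Proof. by apply: (psi_step (x := e c3)) flip_ea3; rewrite ?edgeK //; by_fix. Qed.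
Let psi_a4 : psi a4 = b1.
Proof. by apply: (psi_step (x := a1) (z := b1)); rewrite ?flip_a1 //; by_fix. Qed.
Let psi_b1 : psi b1 = c1.
Proof. by apply: (psi_step (x := e b1) (z := c1)); rewrite ?edgeK //; by_fix. Qed.
Let psi_c1 : psi c1 = a2.
Proof. by apply: (psi_step (x := e c1)) flip_ea1; rewrite ?edgeK //; by_fix. Qed.

Let quad := [:: g; e a4; e a3; e g; e a2; e a1].
Let hex1 := [:: a1; b2; c2; a3; b4; c4].
Let hex2 := [:: a2; b3; c3; a4; b1; c1].
Let special := quad ++ hex1 ++ hex2.

Let special_phi d : phi d \in special -> d \in special.
Proof.
have E : special = [seq phi x | x <- [:: a2; c4; c3; a4; c2; c1; g; e a2; b2; e g; e a4;
    b4; a1; e a3; b3; a3; e a1; b1]].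
  by rewrite /= !(phi_g, phi_a1, phi_a2, phi_eg, phi_a3, phi_a4, phi_ea1, phi_ea2, phi_ea3,
    phi_ea4, phi_b1, phi_b2, phi_b3, phi_b4, phi_c1, phi_c2, phi_c3, phi_c4).
rewrite {1}E (mem_map (@perm_inj _ phi)) /special /quad /hex1 /hex2 /= !inE.
by do ![case/orP]; move=> /eqP->; rewrite eqxx ?orbT.
Qed.

Let special_eight d : e d \in eight -> d \in special.
Proof.
have -> : eight = [seq e x | x <- [:: e a1; e a2; e a3; e a4; a1; a2; a3; a4]].
  by rewrite /= !edgeK.
rewrite (mem_map (@perm_inj _ e)) /special /quad /hex1 /hex2 /= !inE.
by do ![case/orP]; move=> /eqP->; rewrite eqxx ?orbT.
Qed.

Let eight_special d : d \in eight -> d \in special.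
Proof.
rewrite /special /quad /hex1 /hex2 /= !inE.
by do ![case/orP]; move=> /eqP->; rewrite eqxx ?orbT.
Qed.

Let psi_regular d : d \notin special -> psi d = phi d /\ phi d \notin special.
Proof.
move=> nd; have np : phi d \notin special by apply: contra nd; apply: special_phi.
split=> //; apply: (psi_step (x := e d) (z := phi d)); rewrite ?edgeK //.
  by apply: flip_fix; apply: contra nd; apply: special_eight.
by apply: flip_fix; apply: contra np; apply: eight_special.
Qed.

Let cyc1 : fcycle psi hex1.
Proof. by rewrite /= psi_a1 psi_b2 psi_c2 psi_a3 psi_b4 psi_c4 !eqxx. Qed.

Let cyc2 : fcycle psi hex2.
Proof. by rewrite /= psi_a2 psi_b3 psi_c3 psi_a4 psi_b1 psi_c1 !eqxx. Qed.

Let psi3 d : d \notin hex1 ++ hex2 -> psi (psi (psi d)) = d.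
Proof.
move=> nd; have [sd|nsd] := boolP (d \in special); last first.
  have [E1 n1] := psi_regular nsd; have [E2 n2] := psi_regular n1.
  by have [E3 _] := psi_regular n2; rewrite E1 E2 E3 phi3.
have : d \in quad by move: sd; rewrite mem_cat (negPf nd) orbF.
rewrite !inE; do ![case/orP]; move=> /eqP->;
  by rewrite !(psi_g, psi_ea4, psi_ea3, psi_eg, psi_ea2, psi_ea1).
Qed.

Let face1 d : d \in hex1 -> @face flipped d = [set x in hex1].
Proof. by move=> hd; apply: porbit_fcycle cyc1 hd. Qed.

Let face2 d : d \in hex2 -> @face flipped d = [set x in hex2].
Proof. by move=> hd; apply: porbit_fcycle cyc2 hd. Qed.

Let uniq_codes s (ns : seq nat) : [seq index (l x) us | x <- s] = ns -> uniq ns ->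
  uniq s /\ {in s &, injective l}.
Proof.
move=> <- us'; split; first exact: map_uniq us'.
elim: s us' => //= y s IHs /andP[ys /IHs inj] x z.
have notin w : w \in s -> l w <> l y.
  by move=> sw wy; case/negP: ys; rewrite -wy map_f.
rewrite !inE => /predU1P[->|sx] /predU1P[->|sz] // xz.
- by case: (notin z).
- by case: (notin x).
- exact: inj.
Qed.

Let hex1_uniq : uniq hex1 /\ {in hex1 &, injective l}.
Proof.
apply: (@uniq_codes hex1 [:: 1; 2; 5; 0; 3; 7]) => //.
by rewrite /hex1; cbn [map]; rewrite !lE !iE.
Qed.

Let hex2_uniq : uniq hex2 /\ {in hex2 &, injective l}.
Proof.
apply: (@uniq_codes hex2 [:: 2; 0; 6; 3; 1; 4]) => //.
by rewrite /hex2; cbn [map]; rewrite !lE !iE.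
Qed.

Let l_flipped d : l (rotation flipped d) = l d.
Proof.
rewrite /= conjgE [in LHS]permM [in LHS]permM l_flip l_rotation.
by rewrite -{2}(permKV flip d) l_flip.
Qed.

Let l_psi d : l (psi d) = l (e d).
Proof. by rewrite face_permE l_flipped. Qed.

Let r2_flipped d : rotation flipped (rotation flipped d) <> d.
Proof.
rewrite /= -[d](permKV flip) !permJ => /perm_inj; exact: r2.
Qed.

Lemma flipped_startE (d d' : dart flipped) : start d = start d' <-> l d = l d'.
Proof.
apply: (@label_start flipped) => // {d d'} d d' dd'.
have /porbitP[i di] : ((flip^-1)%g d') \in porbit r ((flip^-1)%g d).
  by apply: l_orbit; rewrite -l_flip permKV -[RHS]l_flip permKV.
apply/porbitP; exists i; rewrite -[LHS](permKV flip) di -[in RHS](permKV flip d).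
by rewrite /= -conjXg permJ.
Qed.

Lemma flipped_simple : simple_graph flipped.
Proof. exact: (label_simple flipped_startE). Qed.

Let tri_face d d' : d \notin hex1 ++ hex2 -> @face flipped d' = @face flipped d ->
  [\/ d' = d, d' = psi d | d' = psi (psi d)].
Proof.
move=> nd.
apply: (@face_ind flipped (fun z => [\/ z = d, z = psi d | z = psi (psi d)])).
  by move=> z _ [] ->; [constructor 2|constructor 3|constructor 1; rewrite psi3].
by constructor 1.
Qed.

Let face_once (d d' : dart flipped) : face d = face d' -> start d = start d' -> d = d'.
Proof.
move=> ff /flipped_startE ll.
have mem_own (x y : dart flipped) : face x = face y -> x \in face y.
  by move=> xy; rewrite mem_face xy.
have [h1|n1] := boolP (d \in hex1).
  have h1' : d' \in hex1 by have := mem_own d' d (esym ff); rewrite face1 // in_set.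
  by have [_ inj] := hex1_uniq; apply: inj.
have [h2|n2] := boolP (d \in hex2).
  have h2' : d' \in hex2 by have := mem_own d' d (esym ff); rewrite face2 // in_set.
  by have [_ inj] := hex2_uniq; apply: inj.
have nd : d \notin hex1 ++ hex2 by rewrite mem_cat negb_or n1.
case: (tri_face nd (esym ff)) => [//|E|E].
  by case: (@l_loopless d); rewrite -l_psi -E.
by case: (@l_loopless d'); rewrite -l_psi -ll E psi3.
Qed.

Let hex_edge d : d \in hex1 ++ hex2 -> e d \notin hex1 ++ hex2.
Proof.
rewrite /hex1 /hex2 /= !inE !negb_or; do ![case/orP]; move=> /eqP->;
  do ?[apply/andP; split]; by_code.
Qed.

(** All faces but the two hexagons are triangles, and no edge has hexagons on both sides. *)
Lemma flipped_dual_simple : simple_graph (dual_map flipped).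
Proof.
apply: dual_simple_criterion flipped_simple r2_flipped face_once _ => d.
have [hd|nd] := boolP (d \in hex1 ++ hex2); last by left; apply: psi3.
by right; apply/psi3/hex_edge.
Qed.

Let F1 : {set dart flipped} := [set x in hex1].
Let F2 : {set dart flipped} := [set x in hex2].

Let mem_F1 d : (d \in F1) = (d \in hex1). Proof. by rewrite in_set. Qed.
Let mem_F2 d : (d \in F2) = (d \in hex2). Proof. by rewrite in_set. Qed.

Let F1_face : F1 \in faces flipped.
Proof. by rewrite /F1 -(@face1 a1) ?mem_head //; apply: face_in_faces. Qed.

Let F2_face : F2 \in faces flipped.
Proof. by rewrite /F2 -(@face2 a2) ?mem_head //; apply: face_in_faces. Qed.

Let F12 : F1 <> F2.
Proof.
move/setP/(_ a1); rewrite mem_F1 mem_F2 mem_head => /esym; apply/negP.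
by rewrite /hex2 !inE !negb_or; do ?[apply/andP; split]; by_code.
Qed.

Lemma flipped_doubly_intersecting : doubly_intersecting F1 F2.
Proof.
split=> //; left; apply/card_geqP; exists [:: a1; a3]; split=> //=.
  by rewrite inE andbT; by_code.
have v1 : @start flipped a1 \in face_vertices F2.
  have -> : @start flipped a1 = @start flipped b1 by apply/flipped_startE; rewrite lb1.
  by apply: (imset_f (@start flipped)); rewrite mem_F2 !inE eqxx !orbT.
have v3 : @start flipped a3 \in face_vertices F2.
  have -> : @start flipped a3 = @start flipped b3 by apply/flipped_startE; rewrite la3 lb3.
  by apply: (imset_f (@start flipped)); rewrite mem_F2 !inE eqxx !orbT.
move=> d; rewrite !in_cons in_nil orbF in_set mem_F1 => /orP[] /eqP->.
  by rewrite v1 mem_head.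
by rewrite v3 andbT !inE eqxx !orbT.
Qed.

Lemma flipped_card : #|F1| + #|F2| = 12.
Proof.
have [/card_uniqP u1 _] := hex1_uniq; have [/card_uniqP u2 _] := hex2_uniq.
by rewrite !cardsE u1 u2.
Qed.

Lemma flipped_triangles f : f \in faces flipped -> f <> F1 -> f <> F2 -> #|f| = 3.
Proof.
case/imsetP=> d _ ->; rewrite -/(@face flipped d) => n1 n2.
have nd : d \notin hex1 ++ hex2.
  by rewrite mem_cat; apply/negP=> /orP[/face1/n1|/face2/n2].
have lp := l_psi; have ll := l_loopless.
have cyc : fcycle psi [:: d; psi d; psi (psi d)] by rewrite /= psi3 // !eqxx.
rewrite /face (porbit_fcycle cyc (mem_head _ _)) cardsE; apply/card_uniqP.
rewrite /= !inE negb_or !andbT; apply/andP; split; first (apply/andP; split).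
- by apply/eqP=> E; apply: (ll d); rewrite -lp -E.
- by apply/eqP=> E; apply: (ll (psi (psi d))); rewrite -lp psi3 // -E.
- by apply/eqP=> E; apply: (ll (psi d)); exact: etrans (congr1 l E) (lp _).
Qed.

Let fcycle_stable c d : fcycle psi c -> (psi d \in c) = (d \in c).
Proof.
move=> cyc; apply/idP/idP=> cd.
  have /eqP/perm_inj <- := prev_cycle cyc cd; by rewrite mem_prev.
by have /eqP-> := next_cycle cyc cd; rewrite mem_next.
Qed.

Let quad_stable d : (psi d \in quad) = (d \in quad).
Proof.
have c1' : fcycle psi [:: g; e a4; e a3] by rewrite /= psi_g psi_ea4 psi_ea3 !eqxx.
have c2' : fcycle psi [:: e g; e a2; e a1] by rewrite /= psi_eg psi_ea2 psi_ea1 !eqxx.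
have quadE x : (x \in quad) = (x \in [:: g; e a4; e a3]) || (x \in [:: e g; e a2; e a1]).
  by rewrite -mem_cat.
by rewrite !quadE !fcycle_stable.
Qed.

Let special_stable d : (psi d \in special) = (d \in special).
Proof. by rewrite !mem_cat quad_stable !fcycle_stable. Qed.

Let hex_quad d : d \in hex1 ++ hex2 -> d \notin quad.
Proof.
rewrite /quad /hex1 /hex2 /= !inE !negb_or; do ![case/orP]; move=> /eqP->;
  do ?[apply/andP; split]; by_code.
Qed.

(** The hexagons take up all sides of the quadrilateral, so they cut its two triangles off from the
    faces outside. *)
Lemma flipped_cut : exists S : {set {set dart (dual_map flipped)}}, is_cut 2 S.
Proof.
pose A : {set dart flipped} := [set x | x \notin special].
pose B : {set dart flipped} := [set x in quad].
have memA d : (d \in A) = (d \notin special) by rewrite in_set.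
have memB d : (d \in B) = (d \in quad) by rewrite in_set.
exists [set F1; F2]; apply: (@separation_cut _ A B) => //.
- split=> d; rewrite ?memA ?memB.
  + by rewrite special_stable.
  + exact: quad_stable.
  + by rewrite mem_cat negb_or => /andP[].
  + apply: contra; rewrite /=.
    have -> : quad = [seq e x | x <- [:: e g; a4; a3; g; a2; a1]] by rewrite /= edgeK.
    rewrite (mem_map (@perm_inj _ e)) /special /quad /hex1 /hex2 /= !inE.
    by do ![case/orP]; move=> /eqP->; rewrite eqxx ?orbT.
- apply/set0Pn; exists (e b1); rewrite memA.
  rewrite /special /quad /hex1 /hex2 /= !inE !negb_or.
  by do ?[apply/andP; split]; by_code.
- by apply/set0Pn; exists g; rewrite memB mem_head.
apply/setP=> d; rewrite in_separator memA memB negbK in_setU mem_F1 mem_F2 -mem_cat.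
have := @hex_quad d; rewrite /special [d \in quad ++ _]mem_cat.
by case: (d \in quad); case: (d \in hex1 ++ hex2) => // /(_ isT).
Qed.

Lemma flipped_example c : 1 <= c -> k_connected c flipped ->
  [/\ is_map flipped, k_connected c flipped,
    exists f f' : {set dart flipped},
      [/\ doubly_intersecting f f', #|f| + #|f'| = 12
        & forall f'' : {set dart flipped},
            f'' \in faces flipped -> f'' <> f -> f'' <> f' -> #|f''| = 3],
    simple_graph (dual_map flipped)
  & exists S : {set {set dart (dual_map flipped)}}, is_cut 2 S].
Proof.
move=> c_gt0 conn; split=> //.
- by split; [apply: flipped_simple|apply: k_connected_connected c_gt0 conn].
- exists F1, F2; split; [exact: flipped_doubly_intersecting|exact: flipped_card|].
  exact: flipped_triangles.
- exact: flipped_dual_simple.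
- exact: flipped_cut.
Qed.

End Flip.

(** * Triangulated complete tripartite graphs *)

Section TripartiteTriangulation.
Import GRing.Theory.
Local Open Scope ring_scope.
Variable c : nat.
Local Notation I := 'I_c.+3.

(* [(s, t, i, j)] is the dart from the vertex [i] of the part [t] to the vertex
   [j] of the part [t + 1] (if [s]) or [t - 1] (otherwise); the triangles are
   those with indices summing to [0], respectively to [1] in the reverse
   orientation. *)
Let dartT : finType := (bool * 'I_3 * I * I)%type.

Let next_part (s : bool) (t : 'I_3) : 'I_3 := if s then t + 1 else t - 1.

Definition tri_edge_fun (d : dartT) : dartT :=
  let: (s, t, i, j) := d in (~~ s, next_part s t, j, i).

Definition tri_rot_fun (d : dartT) : dartT :=
  let: (s, t, i, j) := d in (~~ s, t, i, (s%:R - (i + j))).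

Let next_partK s t : next_part (~~ s) (next_part s t) = t.
Proof. by case: s; rewrite /next_part ?addrK ?subrK. Qed.

Let tri_edge_invol : involutive tri_edge_fun.
Proof. by move=> [[[s t] i] j]; rewrite /tri_edge_fun negbK next_partK. Qed.

Let tri_rot_inj : injective tri_rot_fun.
Proof.
move=> [[[s t] i] j] [[[s' t'] i'] j'] E.
have /negb_inj Es : ~~ s = ~~ s' := congr1 (fun d : dartT => d.1.1.1) E.
have Et : t = t' := congr1 (fun d : dartT => d.1.1.2) E.
have Ei : i = i' := congr1 (fun d : dartT => d.1.2) E.
have : s%:R - (i + j) = s'%:R - (i' + j') := congr1 (fun d : dartT => d.2) E.
by rewrite Es Et Ei => /addrI/oppr_inj/addrI->.
Qed.

Let tri_edge : {perm dartT} := perm (inv_inj tri_edge_invol).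
Let tri_rot : {perm dartT} := perm tri_rot_inj.

Let tri_edgeE s t i j : tri_edge (s, t, i, j) = (~~ s, next_part s t, j, i).
Proof. by rewrite permE. Qed.

Let tri_rotE s t i j : tri_rot (s, t, i, j) = (~~ s, t, i, s%:R - (i + j)).
Proof. by rewrite permE. Qed.

Let tri_edgeK : involutive tri_edge.
Proof. by move=> [[[s t] i] j]; rewrite !tri_edgeE negbK next_partK. Qed.

Let tri_edge_neq d : tri_edge d != d.
Proof.
case: d => [[[s t] i] j]; rewrite tri_edgeE; apply/eqP=> E.
by have : ~~ s = s := congr1 (fun d : dartT => d.1.1.1) E; case: s E.
Qed.

Definition tripartite : embedding := @Embedding dartT tri_edge tri_rot tri_edgeK tri_edge_neq.

Let lab (d : dart tripartite) : 'I_3 * I := (d.1.1.2, d.1.2).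

Local Notation phi := (face_perm tripartite).

Let phiE s t i j : phi (s, t, i, j) = (s, next_part s t, j, (~~ s)%:R - (j + i)).
Proof. by rewrite face_permE [edge _ _]tri_edgeE [LHS]tri_rotE negbK. Qed.

Let part3 s t : next_part s (next_part s (next_part s t)) = t.
Proof. by case: s; case: t => -[|[|[|]]] // ?; apply: val_inj. Qed.

Let next_neq s t : next_part s t <> t.
Proof. by case: s; case: t => -[|[|[|]]] // ? /(congr1 val). Qed.

Let next_part_inj s s' t : next_part s t = next_part s' t -> s = s'.
Proof. by case: s s' t => -[] // [[|[|[|]]] // ?] /(congr1 val). Qed.

Let tri_phi3 d : phi (phi (phi d)) = d.
Proof.
case: d => [[[s t] i] j]; rewrite !phiE part3; congr (_, _, _, _).
- by ring.
- by ring.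
Qed.

Let lab_edge s t i j : lab (edge tripartite (s, t, i, j)) = (next_part s t, j).
Proof. by rewrite /lab [edge _ _]tri_edgeE. Qed.

Let tri_loopless d : lab d <> lab (edge tripartite d).
Proof.
by case: d => [[[s t] i] j]; rewrite lab_edge => /(congr1 fst) /esym /next_neq.
Qed.

Let tri_simple d d' : lab d = lab d' -> lab (edge tripartite d) = lab (edge tripartite d') -> d = d'.
Proof.
case: d d' => [[[s t] i] j] [[[s' t'] i'] j']; rewrite !lab_edge.
by move=> [<- <-] [/next_part_inj<- <-].
Qed.

Let tri_rotation d : lab (rotation tripartite d) = lab d.
Proof. by case: d => [[[s t] i] j]; rewrite /lab [rotation _ _]tri_rotE. Qed.

Let tri_r2E s t i j : tri_rot (tri_rot (s, t, i, j)) = (s, t, i, j + (~~ s)%:R - s%:R).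
Proof. by rewrite !tri_rotE negbK; congr (_, _, _, _); ring. Qed.

Let tri_r2 d : rotation tripartite (rotation tripartite d) <> d.
Proof.
case: d => [[[s t] i] j]; rewrite [LHS]tri_r2E => E.
have {E} : j + (~~ s)%:R - s%:R = j := congr1 (fun d : dartT => d.2) E.
move/eqP; rewrite -subr_eq0.
have -> : j + (~~ s)%:R - s%:R - j = (~~ s)%:R - s%:R by ring.
by case: s; rewrite ?sub0r ?subr0 ?oppr_eq0 oner_eq0.
Qed.

Let tri_true t i j : (true, t, i, j) \in porbit tri_rot (true, t, i, 0).
Proof.
(* For [s = true] two rotation steps lower the last index by one, so [j] is reached from 0 by
   counting down. *)
have -> : j = - (nat_of_ord (- j))%:R by rewrite [X in - X]natr_Zp opprK.
elim: (nat_of_ord (- j)) => [|k IHk].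
  by rewrite oppr0 porbit_id.
have -> : (true, t, i, - k.+1%:R) = (tri_rot ^+ 2)%g (true, t, i, - k%:R : I).
  rewrite expgSr expg1 permM tri_r2E; congr (_, _, _, _).
  by rewrite -natr1 /= addr0 opprD.
by rewrite -eq_porbit_mem porbit_perm eq_porbit_mem.
Qed.

Let tri_orbit d d' : lab d = lab d' -> d' \in porbit tri_rot d.
Proof.
have base x : porbit tri_rot x = porbit tri_rot (true, (lab x).1, (lab x).2, 0).
  case: x => [[[s t] i] j]; apply/eqP; rewrite eq_porbit_mem.
  case: s; first exact: tri_true.
  have := tri_true t i ((false%:R - (i + j))); rewrite -!eq_porbit_mem.
  have -> : (true, t, i, false%:R - (i + j)) = (tri_rot ^+ 1)%g (false, t, i, j : I).
    by rewrite expg1 tri_rotE.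
  by rewrite porbit_perm.
by move=> dd'; rewrite base dd' -base porbit_id.
Qed.

Let phiT t i j : phi (true, t, i, j) = (true, t + 1, j, - (j + i)).
Proof. by rewrite phiE sub0r. Qed.

Let phiF t i j : phi (false, t, i, j) = (false, t - 1, j, 1 - (j + i)).
Proof. by rewrite phiE. Qed.

Let edgeT t i j : edge tripartite (true, t, i, j) = (false, t + 1, j, i).
Proof. exact: tri_edgeE. Qed.

Let edgeF t i j : edge tripartite (false, t, i, j) = (true, t - 1, j, i).
Proof. exact: tri_edgeE. Qed.

Let p0 : 0 + 1 = 1 :> 'I_3. Proof. exact: val_inj. Qed.
Let p1 : 1 + 1 = -1 :> 'I_3. Proof. exact: val_inj. Qed.
Let p2 : -1 + 1 = 0 :> 'I_3. Proof. exact: val_inj. Qed.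
Let p3 : 0 - 1 = -1 :> 'I_3. Proof. exact: val_inj. Qed.
Let p4 : 1 - 1 = 0 :> 'I_3. Proof. exact: val_inj. Qed.
Let p5 : -1 - 1 = 1 :> 'I_3. Proof. exact: val_inj. Qed.
Let q0 : 0 + 0 = 0 :> I. Proof. by ring. Qed.
Let q1 : 0 + 1 = 1 :> I. Proof. by ring. Qed.
Let q2 : 1 + 0 = 1 :> I. Proof. by ring. Qed.
Let q3 : 0 - 1 = -1 :> I. Proof. by ring. Qed.
Let q4 : 1 - 1 = 0 :> I. Proof. by ring. Qed.
Let q5 : -1 + 1 = 0 :> I. Proof. by ring. Qed.
Let q6 : -1 + 0 = -1 :> I. Proof. by ring. Qed.
Let q7 : - 0 = 0 :> I. Proof. by ring. Qed.
Let q8 : 1 - 0 = 1 :> I. Proof. by ring. Qed.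
Let q9 : - - 1 = 1 :> I. Proof. by ring. Qed.
Let part_sums := (p0, p1, p2, p3, p4, p5).
Let index_sums := (q0, q1, q2, q3, q4, q5, q6, q7, q8, q9).

(** The eight vertices around the quadrilateral have indices 0, 1 and -1; these differ because there
    are at least three residues. *)
Let opp1_neq : (1 == -1 :> I) = false.
Proof. by apply/negP=> /eqP/(congr1 val) /=; rewrite !modn_small //; lia. Qed.

Let g : dart tripartite := (true, 0, 0, 0).
Let ev := edge tripartite.
Let a1 := phi g.
Let a2 := phi a1.
Let a3 := phi (ev g).
Let a4 := phi a3.

Definition flipped_tripartite : embedding := flipped a1 a2 a3 a4.

Let labels_uniq : uniq [:: lab g; lab a1; lab a2; lab a4; lab (phi (phi (ev a1)));
  lab (phi (phi (ev a2))); lab (phi (phi (ev a3))); lab (phi (phi (ev a4)))].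
Proof.
rewrite /a4 /a3 /a2 /a1 /ev /g.
do ![rewrite ?(phiT, phiF, edgeT, edgeF) ?part_sums ?index_sums].
rewrite /lab; cbn [fst snd]; rewrite /= !inE !xpair_eqE.
have n10 : (1 == 0 :> I) = false by apply: oner_eq0.
have nm0 : (-1 == 0 :> I) = false by rewrite oppr_eq0 oner_eq0.
have o1 := opp1_neq; have n01 := n10; have n0m := nm0; have o2 := o1.
by rewrite eq_sym in n01; rewrite eq_sym in n0m; rewrite eq_sym in o2;
  rewrite ?(n10, n01, nm0, n0m, o1, o2) ?andbF.
Qed.

(** Fewer than [c.+3] deletions leave a vertex in each part, and vertices of different parts are
    adjacent. *)
Lemma flipped_tripartite_connected c' : (c' <= c.+3)%N ->
  k_connected c' flipped_tripartite.
Proof.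
move=> c'c; apply: (@label_k_connected flipped_tripartite _ lab).
- exact: (flipped_startE tri_rotation tri_orbit (erefl a1) (erefl a2) (tri_phi3 g)
    (erefl a3) (erefl a4) (tri_phi3 (ev g))).
- by case=> t i; exists (true, t, i, 0).
- apply: leq_ltn_trans c'c _; rewrite card_prod !card_ord; lia.
move=> W Wc.
have adj (a b : 'I_3 * I) : a.1 <> b.1 -> a \notin W -> b \notin W ->
    @label_off flipped_tripartite _ lab W a b.
  case: a b => [t i] [t' j] /= tt' aW bW; rewrite /label_off aW bW /=.
  have [s st] : exists s, t' = next_part s t.
    have : [|| t' == next_part true t, t' == next_part false t | t == t'].
      by case: t t' {tt' aW bW} => -[|[|[|]]] // ? [[|[|[|]]] //].
    by case/or3P=> /eqP E; [exists true|exists false|case: tt'].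
  by apply/existsP; exists (s, t, i, j); rewrite [lab (edge _ _)]lab_edge -st /lab /= !eqxx.
move=> a b aW bW; have [tt|/eqP tt] := eqVneq a.1 b.1; last exact/connect1/adj.
have [j jW] : exists j : I, (a.1 + 1, j) \notin W.
  apply/existsP; apply: contraLR Wc => /existsPn allW; rewrite -leqNgt.
  apply: leq_trans c'c _; rewrite -{1}(card_ord c.+3) -cardsT.
  rewrite -(card_imset (f := fun j => (a.1 + 1, j)) [set: I]); last by move=> x y [].
  apply/subset_leq_card/subsetP=> _ /imsetP[j _ ->]; exact/negPn/allW.
have next_a : a.1 + 1 <> a.1 := @next_neq true a.1.
apply: (@connect_trans _ _ (a.1 + 1, j)); apply/connect1/adj => //=.
- exact: nesym.
- by rewrite -tt.
Qed.

Lemma flipped_tripartite_example : (1 <= c)%N ->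
  let G := flipped_tripartite in
  [/\ is_map G, k_connected c G,
    exists f f' : {set dart G},
      [/\ doubly_intersecting f f', (#|f| + #|f'| = 12)%N
        & forall f'' : {set dart G},
            f'' \in faces G -> f'' <> f -> f'' <> f' -> #|f''| = 3%N],
    simple_graph (dual_map G)
  & exists S : {set {set dart (dual_map G)}}, is_cut 2 S].
Proof.
move=> c_gt0; have conn : k_connected c flipped_tripartite.
  by apply: flipped_tripartite_connected; rewrite -addn3 leq_addr.
exact: (flipped_example tri_loopless tri_simple tri_rotation tri_orbit tri_phi3 tri_r2
  (erefl a1) (erefl a2) (tri_phi3 g) (erefl a3) (erefl a4) (tri_phi3 (ev g))
  (erefl _) (erefl _) (tri_phi3 (ev a1)) (erefl _) (erefl _) (tri_phi3 (ev a2))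
  (erefl _) (erefl _) (tri_phi3 (ev a3)) (erefl _) (erefl _) (tri_phi3 (ev a4))
  labels_uniq c_gt0 conn).
Qed.

End TripartiteTriangulation.

(** * Maps given by tables and checked by computation *)

Section Masks.

Definition masks v : seq bitseq :=
  iter v (fun ms => [seq b :: m | b <- [:: true; false], m <- ms]) [:: [::]].

Lemma mem_masks (m : bitseq) : m \in masks (size m).
Proof.
elim: m => [|b m IHm]; first by rewrite mem_seq1.
have -> : masks (size (b :: m)) =
  [seq b' :: m' | b' <- [:: true; false], m' <- masks (size m)] by [].
by apply/allpairsP; exists (b, m); split=> //; case: b.
Qed.

Variables (v : nat) (nb : seq (seq nat)).

Definition reach_step (m : bitseq) (s : seq nat) :=
  [seq w <- iota 0 v | ~~ nth true m w && ((w \in s) || has (fun u => w \in nth [::] nb u) s)].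

(** The search starts at the first vertex not deleted. Five rounds are enough for the two maps at
    hand; too few could only make the check fail. *)
Definition reach m := iter 5 (reach_step m) [:: index false m].

Definition masks_connected c :=
  all (fun m => (count id m < c) ==>
    let s := reach m in all (fun a => nth true m a || (a \in s)) (iota 0 v)) (masks v).

End Masks.

Section Tables.
Variables (n v : nat) (et rt st ft : seq nat) (nb : seq (seq nat)).

Definition dart_all (P : pred nat) := all P (iota 0 n).

Lemma dart_allP (P : pred nat) : dart_all P -> forall i : 'I_n, P i.
Proof. by move=> /allP allP i; apply: allP; rewrite mem_iota ltn_ord. Qed.

Definition table_fun (t : seq nat) (i : 'I_n) : 'I_n := insubd i (nth 0 t i).

Lemma table_funE t : dart_all (fun i => nth 0 t i < n) ->
  forall i, table_fun t i = nth 0 t i :> nat.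
Proof. by move=> /dart_allP tn i; rewrite val_insubd tn. Qed.

Definition permutes t := dart_all (fun i => nth 0 t i < n) &&
  dart_all (fun i => dart_all (fun j => (nth 0 t i == nth 0 t j) ==> (i == j))).

Lemma table_fun_inj t : permutes t -> injective (table_fun t).
Proof.
case/andP=> tn /dart_allP tinj i j ij; apply/val_inj/eqP.
have /dart_allP/(_ j)/implyP := tinj i; apply.
by rewrite -!table_funE // ij.
Qed.

Definition orbits_ok (t lt : seq nat) :=
  dart_all (fun i => nth 0 lt (nth 0 t i) == nth 0 lt i) &&
  dart_all (fun i => dart_all (fun j =>
    (nth 0 lt i == nth 0 lt j) ==> (j \in traject (nth 0 t) i n))).

Lemma label_porbit (s : {perm 'I_n}) t lt :
  (forall i, s i = nth 0 t i :> nat) ->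
  orbits_ok t lt ->
  forall i j : 'I_n, porbit s i = porbit s j <-> nth 0 lt i = nth 0 lt j.
Proof.
move=> sE /andP[/dart_allP inv /dart_allP trans] i j; split=> [/eqP|/eqP ij].
  rewrite eq_porbit_mem => ij; apply/eqP.
  apply: (porbit_closed (P := fun k : 'I_n => nth 0 lt k == nth 0 lt j)) ij => // k.
  by rewrite sE (eqP (inv k)).
apply/eqP; rewrite eq_sym eq_porbit_mem; have /dart_allP/(_ j) := trans i.
rewrite ij => /trajectP[k _ jk]; apply/porbitP; exists k; apply: val_inj.
rewrite /= jk; elim: k {jk} => [|k IHk]; first by rewrite perm1.
by rewrite expgSr permM sE iterS IHk.
Qed.

Definition simple_ok (lt : seq nat) :=
  dart_all (fun i => nth 0 lt i != nth 0 lt (nth 0 et i)) &&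
  dart_all (fun i => dart_all (fun j => (nth 0 lt i == nth 0 lt j) ==>
    (nth 0 lt (nth 0 et i) == nth 0 lt (nth 0 et j)) ==> (i == j))).

Definition embedding_ok :=
  [&& permutes et, permutes rt &
    dart_all (fun i => (nth 0 et (nth 0 et i) == i) && (nth 0 et i != i))].

Definition graph_ok c :=
  [&& c < v, masks_connected v nb c, dart_all (fun i => nth 0 st i < v),
    all (fun a => has (fun i => nth 0 st i == a) (iota 0 n)) (iota 0 v) &
    all (fun a => all (fun b => has (fun i => (nth 0 st i == a) &&
      (nth 0 st (nth 0 et i) == b)) (iota 0 n)) (nth [::] nb a)) (iota 0 v)].

Definition table_phi := [seq nth 0 rt (nth 0 et i) | i <- iota 0 n].

Definition face_size f := count (fun i => nth 0 ft i == f) (iota 0 n).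

(* Faces [0] and [1] separate the faces in [2, m) from those from [m] on. *)
Definition faces_ok m :=
  [&& all (fun f => has (fun i => nth 0 ft i == f) (iota 0 n)) [:: 0; 1; 2; m], 2 < m,
    dart_all (fun i => (1 < nth 0 ft i < m) ==> (nth 0 ft (nth 0 et i) < m)),
    dart_all (fun i => (1 < nth 0 ft i) ==> (face_size (nth 0 ft i) == 3)) &
    1 < count (fun i => (nth 0 ft i == 0) && has (fun j => (nth 0 ft j == 1) &&
      (nth 0 st i == nth 0 st j)) (iota 0 n)) (iota 0 n)].

Definition table_ok c m :=
  [&& embedding_ok, orbits_ok rt st, simple_ok st, graph_ok c &
    [&& orbits_ok table_phi ft, simple_ok ft & faces_ok m]].

Lemma card_ord_count (P : pred nat) : #|[pred i : 'I_n | P i]| = count P (iota 0 n).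
Proof.
by rewrite -val_enum_ord count_map cardE [in LHS]/enum_mem size_filter enumT; apply: eq_count.
Qed.

Lemma table_example c m : 1 <= c -> table_ok c m -> exists G : embedding,
  [/\ is_map G, k_connected c G,
    exists f f' : {set dart G},
      [/\ doubly_intersecting f f', #|f| + #|f'| = face_size 0 + face_size 1
        & forall f'' : {set dart G},
            f'' \in faces G -> f'' <> f -> f'' <> f' -> #|f''| = 3],
    simple_graph (dual_map G)
  & exists S : {set {set dart (dual_map G)}}, is_cut 2 S].
Proof.
move=> c_gt0 /and5P[/and3P[et_perm rt_perm /dart_allP etK] st_orbits].
case/andP=> /dart_allP st_loop /dart_allP st_simple.
case/and5P=> cv conn /dart_allP st_v /allP st_onto /allP nbP.
case/and3P=> ft_orbits /andP[/dart_allP ft_loop /dart_allP ft_simple].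
case/and5P=> /allP ft_onto m2 /dart_allP ft_sep /dart_allP ft_size inter.
have etn : dart_all (fun i => nth 0 et i < n) by case/andP: et_perm.
have rtn : dart_all (fun i => nth 0 rt i < n) by case/andP: rt_perm.
have edgeK' : involutive (perm (table_fun_inj et_perm)).
  by move=> i; apply: val_inj; rewrite /= !permE !table_funE //; have /andP[/eqP] := etK i.
have edge_neq' i : perm (table_fun_inj et_perm) i != i.
  by rewrite -val_eqE /= permE table_funE //; have /andP[] := etK i.
pose G := Embedding (perm (table_fun_inj rt_perm)) edgeK' edge_neq'.
have edgeE (i : dart G) : edge G i = nth 0 et i :> nat by rewrite permE table_funE.
have rotE (i : dart G) : rotation G i = nth 0 rt i :> nat by rewrite permE table_funE.
have phiE (i : dart G) : face_perm G i = nth 0 table_phi i :> nat.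
  rewrite face_permE rotE edgeE (nth_map 0) ?size_iota ?nth_iota ?add0n //; exact: ltn_ord.
have startE : forall i j : dart G, start i = start j <-> nth 0 st i = nth 0 st j.
  exact: label_porbit rotE st_orbits.
have faceE : forall i j : dart G, face i = face j <-> nth 0 ft i = nth 0 ft j.
  exact: label_porbit phiE ft_orbits.
pose lab (i : dart G) : 'I_v := Ordinal (st_v i).
have labE (i j : dart G) : start i = start j <-> lab i = lab j.
  rewrite startE; split=> [ij|/(congr1 val)//]; exact: val_inj.
have G_simple : simple_graph G.
  split=> [d /startE|d d' /startE sd /startE td].
    by rewrite edgeE => /eqP; apply/negP; apply: st_loop.
  have /dart_allP/(_ d') := st_simple d; rewrite -!edgeE sd td !eqxx => /eqP.
  exact: val_inj.
have dual_simple : simple_graph (dual_map G).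
  split=> [d /faceE|d d' /faceE sd /faceE td].
    by rewrite edgeE => /eqP; apply/negP; apply: ft_loop.
  have /dart_allP/(_ d') := ft_simple d; rewrite -!edgeE sd td !eqxx => /eqP.
  exact: val_inj.
have pick_dart (P : pred nat) : has P (iota 0 n) -> exists i : dart G, P i.
  by case/hasP=> i; rewrite mem_iota => /= ltn Pi; exists (Ordinal ltn).
have G_connected : k_connected c G.
  apply: (label_k_connected labE); rewrite ?card_ord //.
    move=> a; have [|d /eqP da] := pick_dart _ (st_onto a _).
      by rewrite mem_iota ltn_ord.
    by exists d; apply: val_inj.
  move=> W Wc a b aW bW; pose mk := [seq x \in W | x <- enum 'I_v].
  have mkE (x : 'I_v) : nth true mk x = (x \in W).
    by rewrite (nth_map x) ?size_enum_ord // nth_ord_enum.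
  have size_mk : size mk = v by rewrite size_map size_enum_ord.
  have mkc : count id mk = #|W|.
    by rewrite count_map cardE [in RHS]/enum_mem size_filter enumT; apply: eq_count.
  have mk_in : mk \in masks v by have := mem_masks mk; rewrite size_mk.
  have /allP reach_all := implyP (allP conn _ mk_in) (eq_ind_r (fun k => k < c) Wc mkc).
  have false_mk : false \in mk.
    by rewrite -(negPf aW) -mkE mem_nth // size_mk.
  have o0_lt : index false mk < v by rewrite -size_mk index_mem.
  pose o0 := Ordinal o0_lt.
  have o0W : o0 \notin W by rewrite -mkE /= (set_nth_default false) ?size_mk // nth_index.
  have reachP k w : w \in iter k (reach_step v nb mk) [:: index false mk] ->
      exists2 o : 'I_v, o = w :> nat & o \notin W /\ connect (label_off lab W) o0 o.
    elim: k w => [|k IHk] w /=; first by rewrite inE => /eqP->; exists o0.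
    rewrite mem_filter mem_iota => /andP[/andP[mw near] wv].
    pose o : 'I_v := Ordinal wv; have oW : o \notin W by rewrite -mkE.
    case/orP: near => [/IHk//|/hasP[u /IHk[o' <- [o'W conn']] wu]].
    exists o => //; split=> //; apply: connect_trans conn' (connect1 _).
    rewrite /label_off o'W oW; apply/existsP.
    have [|d /andP[/eqP du /eqP dw]] := pick_dart _ (allP (nbP o' _) w wu).
      by rewrite mem_iota ltn_ord.
    by exists d; rewrite -!val_eqE /= edgeE du dw !eqxx.
  have root (x : 'I_v) : x \notin W -> connect (label_off lab W) o0 x.
    move=> xW; have := reach_all x; rewrite mem_iota ltn_ord mkE (negPf xW) => /(_ isT).
    by case/reachP=> o /val_inj-> [].
  apply: connect_trans (root _ bW); rewrite sym_connect_sym ?root //.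
  move=> x y; rewrite /label_off andbCA; congr (_ && (_ && _)).
  by apply/existsP/existsP=> -[d /andP[dx dy]]; exists (edge G d); rewrite edgeK dy dx.
have faces_of k : k \in [:: 0; 1; 2; m] -> exists i : dart G, nth 0 ft i = k.
  by case/ft_onto/pick_dart=> i /eqP; exists i.
have [[i0 f0] [i1 f1] [i2 f2] [im fm]] : [/\ exists i : dart G, nth 0 ft i = 0,
    exists i : dart G, nth 0 ft i = 1, exists i : dart G, nth 0 ft i = 2 &
    exists i : dart G, nth 0 ft i = m].
  by split; apply: faces_of; rewrite !inE eqxx ?orbT.
have memF (i j : dart G) : (i \in face j) = (nth 0 ft i == nth 0 ft j).
  by rewrite mem_face; apply/eqP/eqP=> /faceE.
have F01 : face i0 <> face i1 by move/faceE; rewrite f0 f1.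
have cardF (i : dart G) : #|face i| = face_size (nth 0 ft i).
  by rewrite /face_size -card_ord_count; apply: eq_card => j; rewrite memF inE.
exists G; split=> //; first by split=> //; apply: k_connected_connected c_gt0 _.
- exists (face i0), (face i1); split; last first.
  + move=> _ /imsetP[d _ ->]; rewrite -/(face d) => n0 n1; rewrite cardF; apply/eqP.
    apply: (implyP (ft_size d)); rewrite ltnNge; apply/negP=> d1.
    have : (nth 0 ft d == 0) || (nth 0 ft d == 1) by case: (nth 0 ft d) d1 => [|[|]].
    by case/orP=> /eqP E; [apply: n0|apply: n1]; apply/faceE; rewrite E.
  + by rewrite !cardF f0 f1.
  split; rewrite ?face_in_faces //; left; move: inter; rewrite -card_ord_count => inter.
  apply: leq_trans inter _; apply/subset_leq_card/subsetP=> d.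
  rewrite inE => /andP[d0 /pick_dart[j /andP[/eqP j1 /eqP dj]]].
  rewrite inE memF f0 d0 /=; have /startE -> := dj.
  by apply: (imset_f (@start G)); rewrite memF f1 j1.
pose A : {set dart G} := [set i : dart G | 1 < nth 0 ft i < m].
pose B : {set dart G} := [set i : dart G | m <= nth 0 ft i].
have ft_phi (d : dart G) : nth 0 ft (face_perm G d) = nth 0 ft d.
  by apply/faceE; rewrite face_face_perm.
exists [set face i0; face i1]; apply: (@separation_cut _ A B); rewrite ?face_in_faces //.
- split=> d; rewrite !inE ?ft_phi //; first by case/andP=> _; rewrite -ltnNge.
  by rewrite edgeE -ltnNge => /(implyP (ft_sep d)).
- by apply/set0Pn; exists i2; rewrite inE f2.
- by apply/set0Pn; exists im; rewrite inE fm.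
apply/setP=> d; rewrite in_separator in_setU !memF f0 f1 !inE.
by case: (nth 0 ft d) => [|[|k]] /=; case: (m) m2 => [|[|[|?]]] //= _; case: ltnP.
Qed.

End Tables.

(* Darts are numbered in the lexicographic order of their start and target. In
   the planar map, the triangle 0 1 2 contains the vertex 3, the quadrilateral
   0 4 1 5 is cut by the edge 4 5, and the faces 0 and 1 are 1 0 4 and 0 2 1 5.
   In the map on the torus, the vertices 0, 1, 2, 3 are mutually adjacent, and two
   discs bounded by the pentagons 4 0 1 2 3 and 7 2 0 3 1 contain the vertices
   5, 6 and 8, 9. *)
Definition planar_edge : seq nat := [:: 5; 10; 13; 16; 19; 0; 11; 14; 17; 20;
  1; 6; 15; 2; 7; 12; 3; 8; 21; 4; 9; 18].

Definition planar_rotation : seq nat := [:: 3; 2; 0; 4; 1; 7; 9; 6; 5; 8; 11;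
  12; 10; 15; 13; 14; 17; 18; 16; 21; 19; 20].

Definition planar_start : seq nat := [:: 0; 0; 0; 0; 0; 1; 1; 1; 1; 1; 2; 2;
  2; 3; 3; 3; 4; 4; 4; 5; 5; 5].

Definition planar_face : seq nat := [:: 2; 1; 4; 0; 5; 0; 3; 2; 6; 1; 4; 1; 3;
  2; 3; 4; 5; 0; 6; 1; 6; 5].

Definition planar_neighbours : seq (seq nat) := [:: [:: 1; 2; 3; 4; 5]; [:: 0;
  2; 3; 4; 5]; [:: 0; 1; 3]; [:: 0; 1; 2]; [:: 0; 1; 5]; [:: 0; 1; 4]].

Definition torus_edge : seq nat := [:: 6; 12; 19; 26; 30; 43; 0; 13; 20; 31;
  39; 48; 1; 7; 21; 32; 35; 40; 44; 2; 8; 14; 27; 36; 45; 49; 3; 22; 33; 37;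
  4; 9; 15; 28; 38; 16; 23; 29; 34; 10; 17; 46; 50; 5; 18; 24; 41; 51; 11; 25;
  42; 47].

Definition torus_rotation : seq nat := [:: 4; 0; 5; 2; 3; 1; 10; 9; 7; 6; 11;
  8; 18; 12; 16; 13; 15; 14; 17; 22; 25; 20; 23; 21; 19; 24; 28; 26; 29; 27;
  31; 32; 34; 30; 33; 36; 37; 38; 35; 40; 41; 42; 39; 45; 43; 47; 44; 46; 50;
  48; 51; 49].

Definition torus_start : seq nat := [:: 0; 0; 0; 0; 0; 0; 1; 1; 1; 1; 1; 1; 2;
  2; 2; 2; 2; 2; 2; 3; 3; 3; 3; 3; 3; 3; 4; 4; 4; 4; 5; 5; 5; 5; 5; 6; 6; 6;
  6; 7; 7; 7; 7; 8; 8; 8; 8; 8; 9; 9; 9; 9].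

Definition torus_face : seq nat := [:: 1; 10; 0; 2; 3; 11; 3; 1; 12; 4; 1; 13;
  1; 4; 1; 8; 5; 9; 10; 11; 1; 5; 0; 6; 15; 12; 0; 6; 2; 7; 2; 3; 4; 7; 8; 8;
  5; 6; 7; 13; 1; 9; 14; 10; 9; 11; 14; 15; 12; 15; 13; 14].

Definition torus_neighbours : seq (seq nat) := [:: [:: 1; 2; 3; 4; 5; 8]; [::
  0; 2; 3; 5; 7; 9]; [:: 0; 1; 3; 5; 6; 7; 8]; [:: 0; 1; 2; 4; 6; 8; 9]; [::
  0; 3; 5; 6]; [:: 0; 1; 2; 4; 6]; [:: 2; 3; 4; 5]; [:: 1; 2; 8; 9]; [:: 0; 2;
  3; 7; 9]; [:: 1; 3; 7; 8]].

Lemma planar_ok : table_ok 22 6 planar_edge planar_rotation planar_start planar_face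
  planar_neighbours 2 5.
Proof. by vm_compute. Qed.

Lemma torus_ok : table_ok 52 10 torus_edge torus_rotation torus_start torus_face
  torus_neighbours 4 9.
Proof. by vm_compute. Qed.

Lemma k_connected_leq c c' G : c <= c' -> k_connected c' G -> k_connected c G.
Proof.
move=> cc' [ltV nocut]; split=> [|j S jc]; first exact: leq_ltn_trans cc' ltV.
exact: nocut (leq_trans jc cc').
Qed.

Theorem theorem1 (c : nat) (hc : 1 <= c) :
  (exists G : embedding,
     [/\ is_map G, k_connected c G,
         exists f f' : {set dart G},
           [/\ doubly_intersecting f f',
               #|f| + #|f'| = min2f c
             & forall f'' : {set dart G},
                 f'' \in faces G -> f'' <> f -> f'' <> f' -> #|f''| = 3],
         simple_graph (dual_map G)
       & exists S : {set {set dart (dual_map G)}}, is_cut 2 S])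
  /\
  (forall G : embedding,
     is_map G -> k_connected c G -> simple_graph (dual_map G) ->
     (forall f f' : {set dart G},
        doubly_intersecting f f' -> #|f| + #|f'| < min2f c) ->
     k_connected 3 (dual_map G)).
Proof.
split; last first.
  by move=> G [G_simple _] conn dual_simple; apply: dual_three_connected hc conn.
(* The 2-connected planar map also serves for [c = 1], and the 4-connected toroidal one for
   [c = 3]. *)
rewrite /min2f; case: ifP => c2.
  have [G [mapG connG faceG dualG cutG]] := table_example (isT : 1 <= 2) planar_ok.
  by exists G; split=> //; apply: k_connected_leq connG.
case: ifP => c4.
  have [G [mapG connG faceG dualG cutG]] := table_example (isT : 1 <= 4) torus_ok.
  by exists G; split=> //; apply: k_connected_leq connG.
by exists (flipped_tripartite c); apply: flipped_tripartite_example.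
Qed.
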